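(* Let $(X^1_t)_{t\in[0,\infty)},\dots,(X^m_t)_{t\in[0,\infty)}$ be positive, independent (continuous) semimartingales with multiplicative Doob-Meyer decompositions $$X_t^i=M_t^i\exp\left(\int_0^t\frac{Y_s^i}{X_s^i}\,dV_s\right),\qquad i=1,\dots,m,$$ such that $\left(\frac{Y_t^i}{X_t^i}\right)_{t\in[0,\infty)}$ is non-increasing in $t$ for $i=1,\dots,m$. Then: (i) The product problem, i.e. the optimal stopping problem for $\left(\prod_{i=1}^mX^i_t\right)_{t\in[0,\infty)}$, is a monotone case problem with myopic rule $$\tau^*=\inf\left\{t:\ \prod_{i=1}^m\exp\left(\int_0^t\frac{Y_s^i}{X_s^i}\,dV_s\right)\leq 1\right\}=\inf\left\{t:\ \sum_{i=1}^m\int_0^t\frac{Y_s^i}{X_s^i}\,dV_s\leq 0\right\}.$$ (ii) If condition (V1) holds for $\left(\prod_{i=1}^mX^i_t\right)_{t\in[0,\infty)}$, then the myopic rule $\tau^*$ is optimal.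
   Context: The processes $X^1,\dots,X^m$ are adapted to a common filtration $(\mathcal A_t)_{t\in[0,\infty)}$. The process $(V_t)_{t\in[0,\infty)}$ is increasing and does not depend on $i$. The process $\int_0^tY^i_s\,dV_s$ is the locally bounded variation part in the additive Doob-Meyer decomposition of $X^i$, that is, $X^i_t=X^i_0+N^i_t+\int_0^tY^i_s\,dV_s$ with $N^i$ the martingale part; in the multiplicative decomposition, $M^i$ is a local martingale. Regularity assumptions ensuring that these decompositions exist are in force. The optimal stopping problem for a process $(X_t)_{t\in[0,\infty)}$ is to find a stopping time $\tau^*$ with $EX_{\tau^*}=\sup_\tau EX_\tau$; such a $\tau^*$ is called optimal. Here $\tau$ runs through all stopping times with respect to $(\mathcal A_t)$, with the value $\infty$ allowed, for which $EX_\tau$ exists, and $X_\infty=\liminf_{t\to\infty}X_t$. For a process with additive Doob-Meyer decomposition $X_t=X_0+N_t+\int_0^tY_s\,dV_s$ ($N$ the martingale part, $V$ increasing), the myopic stopping time (infinitesimal look ahead rule) is defined as $\inf\{t:Y_t\leq 0\}$, and the problem is called a monotone case problem if $Y_t\leq 0$ for all $t$ greater than the myopic stopping time. Condition (V1) for $(X_t)_{t\in[0,\infty)}$ is: $\lim_{L\to\infty}EX_{\min\{\tau^*,L\}}\leq EX_{\tau^*}$.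
   Formalization: In the displayed myopic rule the integrals of Y^i/X^i dV are replaced by the integrands Y^i_t/X^i_t (as printed both infima are 0); in (ii) the martingale part N of the product's additive decomposition is assumed to be a true martingale, as (ii) fails for strict local martingales. *)

(* Defs.v *)
From HB Require Import structures.
From mathcomp Require Export all_boot all_order all_algebra.
From mathcomp Require Export all_classical all_reals all_analysis.
From mathcomp Require Export measurable_realfun.
Export Order.TTheory GRing.Theory Num.Theory.
Export numFieldNormedType.Exports.

Set Implicit Arguments.
Unset Strict Implicit.
Unset Printing Implicit Defensive.

Local Open Scope classical_set_scope.
Local Open Scope ring_scope.

(* A process (X_t)_{t in [0, oo)} is a function X : R -> T -> R whose values at
   negative times are never looked at. *)

Section Processes.
Context {d : measure_display} {T : measurableType d} {R : realType}.
Implicit Types (P : probability T R) (F : R -> set (set T)).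
Implicit Types (X N Y : R -> T -> R) (tau : T -> \bar R).

Definition filtration F : Prop :=
  [/\ forall t, 0 <= t -> sigma_algebra setT (F t),
      forall t, 0 <= t -> F t `<=` measurable &
      forall s t, 0 <= s -> s <= t -> F s `<=` F t].

Definition right_continuous_filtration F : Prop :=
  forall t, 0 <= t -> F t = \bigcap_(s in [set s | t < s]) F s.

Definition adapted F X : Prop :=
  forall t, 0 <= t -> forall B : set R, measurable B -> F t (X t @^-1` B).

Definition continuous_paths X : Prop :=
  forall w, {within `[0, +oo[, continuous (fun t => X t w)}.

Definition process_sigma_algebra X : set (set T) :=
  <<s [set A | exists t (B : set R),
               [/\ 0 <= t, measurable B & A = X t @^-1` B]] >>.

(* Each sigma-algebra contains setT, so the product rule for full families of
   events gives the rule for every subfamily. *)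
Definition independent_processes P (m : nat) (X : 'I_m -> R -> T -> R) : Prop :=
  forall E : 'I_m -> set T, (forall i, process_sigma_algebra (X i) (E i)) ->
  P (\bigcap_(i in [set: 'I_m]) E i) = (\prod_(i < m) P (E i))%E.

Definition stopping_time F tau : Prop :=
  (forall w, 0 <= tau w)%E /\
  forall t, 0 <= t -> F t [set w | (tau w <= t%:E)%E].

(* X_tau, with X_oo = liminf_{t -> oo} X_t *)
Definition stopped_value X tau (w : T) : \bar R :=
  match tau w with
  | r%:E => (X r w)%:E
  | _ => limf_einf (fun t => (X t w)%:E) (+oo)%R
  end.

(* X^tau_t = X_{min(tau, t)} *)
Definition stopped_process X tau : R -> T -> R :=
  fun t w => X (fine (mine (tau w) t%:E)) w.

(* The last clause is the defining property of E[X_t | F_s] = X_s. *)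
Definition martingale P F X : Prop :=
  [/\ adapted F X,
      forall t, 0 <= t -> P.-integrable setT (fun w => (X t w)%:E) &
      forall s t, 0 <= s -> s <= t -> forall A, F s A ->
        (\int[P]_(w in A) (X t w)%:E = \int[P]_(w in A) (X s w)%:E)%E].

(* X_0 is subtracted so that it need not be integrable. *)
Definition local_martingale P F X : Prop :=
  adapted F X /\
  exists tau : nat -> T -> \bar R,
    [/\ forall n, stopping_time F (tau n),
        forall n w, (tau n w <= tau n.+1 w)%E,
        {ae P, forall w, tau n w @[n --> \oo] --> (+oo)%E} &
        forall n, martingale P F
          (fun t w => stopped_process X (tau n) t w - X 0 w)].

(* int_0^t Y_s dV_s. Each path of V is a nondecreasing right-continuous
   function on R, of which only the restriction to [0, t] matters here. *)
Definition stieltjes_integral (V : T -> cumulative R R) Y (t : R) (w : T) : R :=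
  \int[lebesgue_stieltjes_measure (V w)]_(s in `]0, t]) Y s w.

(* X = X_0 + N + int Y dV, for a continuous semimartingale X *)
Definition doob_meyer P F (V : T -> cumulative R R) X N Y : Prop :=
  [/\ local_martingale P F N, continuous_paths N, adapted F Y,
      forall t w, 0 <= t -> (lebesgue_stieltjes_measure (V w)).-integrable
        `]0, t] (fun s => (Y s w)%:E) &
      forall t w, 0 <= t -> X t w = X 0 w + N t w + stieltjes_integral V Y t w].

(* inf S within [0, oo], with inf set0 = +oo *)
Definition first_time (S : set R) : \bar R :=
  ereal_inf [set t%:E | t in [set t | 0 <= t /\ S t]].

Definition myopic_time Y (w : T) : \bar R := first_time [set t | Y t w <= 0].

Definition monotone_case P F (V : T -> cumulative R R) X Y : Prop :=
  (exists N, doob_meyer P F V X N Y) /\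
  forall w t, 0 <= t -> (myopic_time Y w < t%:E)%E -> Y t w <= 0.

Definition expectation_exists P (f : T -> \bar R) : Prop :=
  measurable_fun setT f /\
  ((\int[P]_w (f^\+ w) < +oo)%E \/ (\int[P]_w (f^\- w) < +oo)%E).

Definition admissible P F X tau : Prop :=
  stopping_time F tau /\ expectation_exists P (stopped_value X tau).

Definition optimal P F X tau : Prop :=
  admissible P F X tau /\
  (\int[P]_w stopped_value X tau w =
   ereal_sup [set \int[P]_w stopped_value X sigma w
             | sigma in [set sigma | admissible P F X sigma]])%E.

Definition condition_V1 P X tau : Prop :=
  exists l : \bar R,
    (\int[P]_w stopped_value X (fun w => mine (tau w) L%:E) w)%E
      @[L --> (+oo)%R] --> l /\
    (l <= \int[P]_w stopped_value X tau w)%E.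

Definition product_process (m : nat) (X : 'I_m -> R -> T -> R) : R -> T -> R :=
  fun t w => \prod_(i < m) X i t w.

(* The dV-density of the bounded variation part of prod_i X^i when X^i has
   density Y^i: by independence the continuous X^i have no covariation, so the
   product rule has no second-order term. *)
Definition product_density (m : nat) (X Y : 'I_m -> R -> T -> R) :
    R -> T -> R :=
  fun t w => \sum_(i < m) Y i t w * \prod_(j < m | j != i) X j t w.

End Processes.

(* Main.v *)
From HB Require Import structures.
Require Import Defs.
From mathcomp Require Import all_boot all_order all_algebra.
From mathcomp Require Import all_classical all_reals all_analysis.
From mathcomp Require Import measurable_realfun.
From mathcomp Require Import ring lra.
Import Order.TTheory GRing.Theory Num.Theory.

(* Each [X i] is a semimartingale, and the product rule for the product needs
   the brackets of independent continuous semimartingales [S] and [X] to vanish,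
   although the decompositions live in a filtration much larger than the one
   generated by the processes.  For a fixed continuous path [x], the sums
   [sum_k (x_{k+1} - x_k) (X_{k+1} - X_k)] are integrals of uniformly small
   deterministic step functions against [X], hence tend to 0 in probability; by
   Doob's inequality this is uniform over partial sums and over small coefficients.
   Independence and Fubini allow to substitute the path of [S] for [x].  Then
   [S X - S_0 X_0 - int S dA^X - int X dA^S], stopped where everything is bounded,
   is a limit in probability of L^2-bounded martingale transforms, hence a
   martingale.

   The drift density of the product [Z] is [Z * sum_i (Y i / X i)], whose sign
   changes at most once, from positive to nonpositive.  So the drift [A] satisfies
   [A_(sigma /\ n) <= A_(tau /\ n)] pathwise for the myopic time [tau] and every
   stopping time [sigma]; optional stopping of the martingale part gives
   [E Z_(sigma /\ n) <= E Z_(tau /\ n)], and Fatou's lemma together with (V1)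
   concludes. *)

Set Implicit Arguments.
Unset Strict Implicit.
Unset Printing Implicit Defensive.

Local Open Scope classical_set_scope.
Local Open Scope ring_scope.

(** * Continuous paths on [0, oo) *)

(** Independence is assumed of the processes [X i] alone. Neither [N i] nor the drift of [X i] need
    be measurable for the sigma-algebra of [X i], so independence says nothing about products of the
    [N i]. The two structures are therefore used apart: [F] only for martingale transforms,
    independence only for the joint law of two paths. Fixing one path requires a bound that is
    uniform over deterministic coefficients. The bound [dl ^+ 2 * b ^+ 2 / lam ^+ 2] has this form
    because increments of a bounded martingale are orthogonal: only the sup of the coefficients and
    the bound of the martingale enter. It has to cover all partial sums since stopping cuts the
    bracket sum at a random cell. Convergence in probability alone would not preserve expectations;
    the uniform second moments do. With more than two factors, the product of the first [k] is
    paired with the next one, so what is needed is independence of a group of processes from a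
    single one. Stieltjes integrals enter the probabilistic part only through one pathwise
    inequality, which gives Riemann sums, continuity and adaptedness. *)

Section UniformContinuity.
Context {R : realType}.
Implicit Types (f g : R -> R).

(** Uniform continuity on each [[0, T]], the form of continuity that grids can use. Negative times
    are left out, as everywhere in the statement. *)
Definition ucont f := forall T e : R, 0 < e -> exists2 dl : R, 0 < dl &
  forall a b : R, 0 <= a <= T -> 0 <= b <= T -> `|a - b| < dl -> `|f a - f b| < e.

Lemma dist_half (a b c e : R) :
  `|a - b| < e / 2 -> `|b - c| < e / 2 -> `|a - c| < e.
Proof.
move=> h1 h2; rewrite (_ : a - c = (a - b) + (b - c)); last by ring.
by rewrite (le_lt_trans (ler_normD _ _))//; lra.
Qed.

(** Heine-Cantor: compactness of [[0, T]], in its near-covering form along [0^'+], turns the local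
    radii into one radius. *)
Lemma within_ucont f : {within `[0, +oo[, continuous f} -> ucont f.
Proof.
move=> fc T e e0.
have fd (x : R) : 0 <= x -> exists2 dl : R, 0 < dl &
    forall y : R, 0 <= y -> `|x - y| < dl -> `|f x - f y| < e / 2.
  move=> x0; move/subspace_continuousP : fc => /(_ x).
  rewrite /= in_itv/= andbT => /(_ x0)/cvgrPdist_lt/(_ (e / 2)).
  rewrite divr_gt0// => /(_ isT); rewrite near_withinE => -[dl /= dl0 H].
  exists dl => // y y0 xy; apply: H => //=.
  by rewrite in_itv/= y0.
have := @segment_compact R 0 T.
rewrite compact_near_coveringP => /(_ R (0^'+)
  (fun dl x => forall b, 0 <= b -> `|x - b| < dl -> 0 <= x -> `|f x - f b| < e) _).
case.
  move=> x /=; rewrite in_itv/= => /andP[x0 xT].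
  have [dl dl0 H] := fd _ x0.
  near=> y dl' => b b0 yb y0.
  have xy : `|x - y| < dl / 2 by near: y; exists (dl / 2); rewrite //= divr_gt0.
  have dd : dl' < dl / 2 by near: dl'; apply: nbhs_right_lt; rewrite divr_gt0.
  have H1 : `|f x - f y| < e / 2.
    by apply: H => //; apply: lt_trans xy _; rewrite ltr_pdivrMr// ltr_pMr// ltr1n.
  have H2 : `|f x - f b| < e / 2.
    by apply: H => //; apply: (dist_half xy); exact: lt_trans yb dd.
  by apply: dist_half H2; rewrite distrC.
move=> dl /= dl0 H; exists (dl / 2); first by rewrite divr_gt0.
move=> a b /andP[a0 aT] /andP[b0 bT] ab.
have := H (dl / 2); apply => //=.
- by rewrite sub0r normrN gtr0_norm ?divr_gt0// gtr_pMr// invf_lt1// ltr1n.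
- by rewrite divr_gt0.
- by rewrite in_itv/= a0.
Unshelve. all: by end_near. Qed.

Lemma ucont_within f : ucont f -> {within `[0, +oo[, continuous f}.
Proof.
move=> fc; apply/subspace_continuousP => x /=; rewrite in_itv/= andbT => x0.
apply/cvgrPdist_lt => e e0; have [dl dl0 H] := fc (x + 1) e e0.
rewrite near_withinE; exists (Num.min dl 1); rewrite /= ?lt_min ?dl0 ?ltr01//.
move=> y /=; rewrite lt_min in_itv/= andbT => /andP[xy xy1] y0.
apply: H => //; first by rewrite x0 lerDl ler01.
by move: xy1; rewrite y0 ltr_norml => /andP[xy1 _]/=; lra.
Qed.

Lemma ucont_ext f g : (forall t : R, 0 <= t -> f t = g t) -> ucont f -> ucont g.
Proof.
move=> fg fc T e e0; have [dl dl0 H] := fc T e e0; exists dl => // a b aT bT ab.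
by rewrite -!fg; [exact: H|case/andP: bT|case/andP: aT].
Qed.

Lemma ucont_cst (c : R) : ucont (fun=> c).
Proof. by move=> T e e0; exists 1 => // a b _ _ _; rewrite subrr normr0. Qed.

Lemma ucontD f g : ucont f -> ucont g -> ucont (fun t => f t + g t).
Proof.
move=> fc gc T e e0; have e20 : 0 < e / 2 by rewrite divr_gt0.
have [d1 d10 H1] := fc T _ e20; have [d2 d20 H2] := gc T _ e20.
exists (Num.min d1 d2); first by rewrite lt_min d10.
move=> a b aT bT; rewrite lt_min => /andP[ab1 ab2].
rewrite (_ : _ - _ = (f a - f b) + (g a - g b)); last by ring.
rewrite (le_lt_trans (ler_normD _ _))//.
by have := H1 _ _ aT bT ab1; have := H2 _ _ aT bT ab2; lra.
Qed.

Lemma ucont_le f g : (forall a b : R, 0 <= a -> 0 <= b -> `|g a - g b| <= `|f a - f b|) ->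
  ucont f -> ucont g.
Proof.
move=> fg fc T e e0; have [dl dl0 H] := fc T e e0; exists dl => // a b aT bT ab.
apply: le_lt_trans (H a b aT bT ab); apply: fg.
  by case/andP: aT.
by case/andP: bT.
Qed.

Lemma ucontN f : ucont f -> ucont (fun t => - f t).
Proof.
by apply: ucont_le => a b _ _; rewrite -opprD normrN.
Qed.

Lemma ucont_norm f : ucont f -> ucont (fun t => `|f t|).
Proof. by apply: ucont_le => a b _ _; exact: ler_dist_dist. Qed.

Lemma ucontB f g : ucont f -> ucont g -> ucont (fun t => f t - g t).
Proof. by move=> fc gc; apply: ucontD => //; exact: ucontN. Qed.

(** Steps of length [dl / 2], with [dl] a modulus for oscillation 1, raise [|f|] by at most 1 each,
    and finitely many of them reach [T]. *)
Lemma ucont_bounded f (T : R) : ucont f -> exists2 c : R, 0 < c & forall t : R, 0 <= t <= T -> `|f t| <= c.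
Proof.
move=> fc; have [dl dl0 H] := fc T 1 ltr01.
have K n : forall t : R, 0 <= t <= T -> t <= n%:R * (dl / 2) -> `|f t| <= `|f 0| + n%:R.
  elim: n => [|n IH].
    move=> t /andP[t0 _]; rewrite mul0r => t0'.
    by rewrite (_ : t = 0) ?addr0//; apply/eqP; rewrite eq_le t0'.
  move=> t tT tn; have [tn'|tn'] := leP t (n%:R * (dl / 2)).
    by rewrite (le_trans (IH _ tT tn'))// lerD2l ler_nat.
  have n0 : 0 <= n%:R * (dl / 2) by rewrite mulr_ge0// divr_ge0// ltW.
  have nT : 0 <= n%:R * (dl / 2) <= T.
    by rewrite n0/=; move: tT => /andP[_]; apply: le_trans; exact: ltW.
  have /= h1 := IH _ nT (lexx _).
  have h2 : `|f t - f (n%:R * (dl / 2))| < 1.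
    apply: H => //; rewrite gtr0_norm ?subr_gt0//.
    by move: tn; rewrite -natr1 mulrDl mul1r; lra.
  rewrite -natr1 addrA.
  rewrite (_ : f t = f (n%:R * (dl / 2)) + (f t - f (n%:R * (dl / 2)))); last by ring.
  by rewrite (le_trans (ler_normD _ _))//; lra.
have [n Tn] : exists n : nat, T / (dl / 2) <= n%:R.
  exists (Num.bound `|T / (dl / 2)|).
  by rewrite (le_trans (ler_norm _))// ltW// archi_boundP.
exists (`|f 0| + n%:R + 1); first by rewrite ltr_wpDl// addr_ge0.
move=> t tT; rewrite (le_trans (K n _ tT _))//; last by rewrite lerDl.
by case/andP: tT => _ /le_trans; apply; rewrite -ler_pdivrMr// divr_gt0.
Qed.

Lemma ucontM f g : ucont f -> ucont g -> ucont (fun t => f t * g t).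
Proof.
move=> fc gc T e e0.
have [c c0 fb] := ucont_bounded T fc; have [d d0 gb] := ucont_bounded T gc.
have e1 : 0 < e / 2 / c by rewrite !divr_gt0.
have e2 : 0 < e / 2 / d by rewrite !divr_gt0.
have [d1 d10 H1] := fc T _ e2; have [d2 d20 H2] := gc T _ e1.
exists (Num.min d1 d2); first by rewrite lt_min d10.
move=> a b aT bT; rewrite lt_min => /andP[ab1 ab2].
rewrite (_ : _ - _ = f a * (g a - g b) + (f a - f b) * g b); last by ring.
rewrite (le_lt_trans (ler_normD _ _))// !normrM.
have h1 : `|f a| * `|g a - g b| <= c * `|g a - g b| by rewrite ler_wpM2r ?fb.
have h2 : `|f a - f b| * `|g b| <= `|f a - f b| * d by rewrite ler_wpM2l ?gb.
have := H2 _ _ aT bT ab2; rewrite ltr_pdivlMr// mulrC => h3.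
have := H1 _ _ aT bT ab1; rewrite ltr_pdivlMr// => h4.
by rewrite (le_lt_trans (lerD h1 h2))//; lra.
Qed.

Lemma ucont_min f (u : R) : 0 <= u -> ucont f -> ucont (fun t => f (Num.min u t)).
Proof.
move=> u0 fc T e e0; have [dl dl0 H] := fc T e e0; exists dl => // a b aT bT ab.
apply: H.
- by rewrite le_min u0 ge_min; case/andP: aT => -> ->; rewrite orbT.
- by rewrite le_min u0 ge_min; case/andP: bT => -> ->; rewrite orbT.
- apply: le_lt_trans ab; rewrite ler_norml.
  have := ler_norm (a - b); have := ler_norm (b - a); rewrite distrC.
  by rewrite /Order.min; case: ltP => ?; case: ltP => ? ? ?; apply/andP; split; lra.
Qed.

End UniformContinuity.

(** * Stieltjes integrals along one path *)

Section PathIntegral.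
Context {R : realType} (v : cumulative R R).
Let mu := lebesgue_stieltjes_measure v.
Variables (S D : R -> R).
Hypothesis Sc : ucont S.
Hypothesis Di : forall t : R, 0 <= t -> mu.-integrable `]0, t] (EFin \o D).

Lemma integrable_itv_oc (a b : R) : 0 <= a -> 0 <= b -> mu.-integrable `]a, b] (EFin \o D).
Proof.
move=> a0 b0; apply: integrableS (Di b0) => //.
by apply: subset_itvr; rewrite bnd_simp.
Qed.

Lemma measurable_ucont (t : R) : measurable_fun (`]0, t] : set R) S.
Proof.
have mS : measurable_fun (`[0, +oo[ : set R) S.
  by apply: subspace_continuous_measurable_fun => //; exact: ucont_within.
apply: (measurable_funS _ _ mS) => //.
by apply: subset_itv; rewrite bnd_simp.
Qed.

Lemma ucont_integrableM (t : R) : 0 <= t ->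
  mu.-integrable `]0, t] (EFin \o (fun s => S s * D s)).
Proof.
move=> t0.
have [c c0 Sb] := ucont_bounded t Sc.
have := @integrableMr _ _ _ mu `]0, t] _ S (EFin \o D).
apply => //; [exact: measurable_ucont| |exact: Di].
exists c; split; first by rewrite num_real.
move=> x cx s /=; rewrite in_itv/= => /andP[s0 st].
by apply/ltW/(le_lt_trans _ cx)/Sb; rewrite ltW//=.
Qed.

Lemma Rintegral_ocB (f : R -> R) (a b : R) :
  (forall t : R, 0 <= t -> mu.-integrable `]0, t] (EFin \o f)) -> 0 <= a -> a <= b ->
  \int[mu]_(s in `]0, b]) f s - \int[mu]_(s in `]0, a]) f s =
  \int[mu]_(s in `]a, b]) f s.
Proof.
move=> fi a0 ab; have b0 := le_trans a0 ab.
rewrite (@itv_bndbnd_setU _ _ _ (BRight a)) ?bnd_simp//.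
rewrite Rintegral_setU//=.
- by rewrite addrAC subrr add0r.
- by rewrite -itv_bndbnd_setU ?bnd_simp//; exact: fi.
- apply/disj_setPS => y [/=]; rewrite 2!in_itv/= => /andP[_ ya] /andP[].
  by rewrite ltNge ya.
Qed.

(** The left side is the integral of [(S s - c) * D s] over []a, b]]. This inequality is what later
    arguments retain of the integral; it is abstracted as [stieltjes_like]. *)
Lemma stieltjes_estimate (a b c e : R) : 0 <= a -> a <= b ->
  (forall s : R, a < s <= b -> `|S s - c| <= e) ->
  `|\int[mu]_(s in `]0, b]) (S s * D s) - \int[mu]_(s in `]0, a]) (S s * D s) -
    c * (\int[mu]_(s in `]0, b]) D s - \int[mu]_(s in `]0, a]) D s)| <=
  e * (\int[mu]_(s in `]0, b]) `|D s| - \int[mu]_(s in `]0, a]) `|D s|).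
Proof.
move=> a0 ab Se; have b0 := le_trans a0 ab.
have iD : mu.-integrable `]a, b] (EFin \o D) by exact: integrable_itv_oc.
have iSD : mu.-integrable `]a, b] (EFin \o (fun s => S s * D s)).
  apply: integrableS (ucont_integrableM b0) => //.
  by apply: subset_itvr; rewrite bnd_simp.
rewrite !Rintegral_ocB//; last 2 first.
- by move=> t t0; apply: integrable_norm => //; exact: Di.
- by move=> t t0; exact: (ucont_integrableM t0).
have icD : mu.-integrable `]a, b] (EFin \o (fun s => c * D s)).
  exact: (integrableZl _ _ iD).
rewrite -RintegralZl// -RintegralB// -RintegralZl//; last exact: integrable_norm.
have iB : mu.-integrable `]a, b] (EFin \o (fun s => S s * D s - c * D s)).
  exact: (integrableB _ iSD icD).
apply: le_trans (le_normr_Rintegral _ _) _ => //.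
apply: le_Rintegral => //.
- exact: integrable_norm.
- by apply: (integrableZl _ _ (integrable_norm _)) => //.
- move=> s /=; rewrite in_itv/= => sab.
  by rewrite -mulrBl normrM ler_wpM2r// Se.
Qed.

Lemma stieltjes_variation (a b : R) : 0 <= a -> a <= b ->
  `|\int[mu]_(s in `]0, b]) D s - \int[mu]_(s in `]0, a]) D s| <=
  \int[mu]_(s in `]0, b]) `|D s| - \int[mu]_(s in `]0, a]) `|D s|.
Proof.
move=> a0 ab; have b0 := le_trans a0 ab.
rewrite !Rintegral_ocB//; last by move=> t t0; apply: integrable_norm => //; exact: Di.
by apply: le_normr_Rintegral => //; exact: integrable_itv_oc.
Qed.

End PathIntegral.

(** * Grids, Riemann sums and bracket sums *)

Section Grid.
Context {R : realType}.

Definition grid (s t : R) (n k : nat) : R := s + (t - s) * (k%:R / n.+1%:R).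

Lemma grid0 s t n : grid s t n 0 = s.
Proof. by rewrite /grid mul0r mulr0 addr0. Qed.

Lemma gridn s t n : grid s t n n.+1 = t.
Proof. by rewrite /grid divff ?pnatr_eq0// mulr1 addrCA subrr addr0. Qed.

Lemma grid_step s t n k : grid s t n k.+1 - grid s t n k = (t - s) / n.+1%:R.
Proof. by rewrite /grid -(natr1 k); ring. Qed.

Lemma grid_le s t n k j : s <= t -> (k <= j)%N -> grid s t n k <= grid s t n j.
Proof.
move=> st kj; rewrite lerD2l ler_wpM2l ?subr_ge0// ler_wpM2r ?invr_ge0//.
by rewrite ler_nat.
Qed.

Lemma grid_ge s t n k : s <= t -> s <= grid s t n k.
Proof. by move=> st; rewrite -{1}(grid0 s t n) grid_le. Qed.

Lemma grid_ge0 s t n k : 0 <= s -> s <= t -> 0 <= grid s t n k.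
Proof. by move=> s0 st; rewrite (le_trans s0)// grid_ge. Qed.

Lemma grid_le_end s t n k : s <= t -> (k <= n.+1)%N -> grid s t n k <= t.
Proof. by move=> st kn; rewrite -[leRHS](gridn s t n) grid_le. Qed.

Lemma grid_mesh s t dl : s <= t -> 0 < dl -> exists N, forall n, (N <= n)%N ->
  forall k, grid s t n k.+1 - grid s t n k < dl.
Proof.
move=> st dl0; exists (Num.bound `|(t - s) / dl|) => n Nn k.
rewrite grid_step ltr_pdivrMr// mulrC -ltr_pdivrMr//.
rewrite (le_lt_trans (ler_norm _))// (lt_le_trans (archi_boundP _))// ler_nat.
exact: leq_trans Nn _.
Qed.

Lemma min_grid_mesh s t n k u dl : s <= t -> grid s t n k.+1 - grid s t n k < dl ->
  0 <= Num.min u (grid s t n k.+1) - Num.min u (grid s t n k) < dl.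
Proof.
move=> st h; have := grid_le n st (leqnSn k).
by rewrite /Order.min; case: ltP => ?; case: ltP => ? ?; lra.
Qed.

Lemma telescope_ord (f : nat -> R) n : \sum_(k < n) (f k.+1 - f k) = f n - f 0.
Proof. by rewrite -(big_mkord predT (fun k => f k.+1 - f k)) telescope_sumr. Qed.

Lemma discrete_product_rule (a b : nat -> R) n :
  a n * b n - a 0 * b 0 =
    \sum_(k < n) a k * (b k.+1 - b k) + \sum_(k < n) b k * (a k.+1 - a k) +
    \sum_(k < n) (a k.+1 - a k) * (b k.+1 - b k).
Proof.
rewrite -2!big_split/= -(telescope_ord (fun k => a k * b k)).
by apply: eq_bigr => k _; ring.
Qed.

Lemma ucont_grid (f : R -> R) (s t e : R) : ucont f -> 0 <= s -> s <= t -> 0 < e ->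
  exists N, forall n, (N <= n)%N -> forall k, (k <= n)%N -> forall u, 0 <= u ->
  `|f (Num.min u (grid s t n k.+1)) - f (Num.min u (grid s t n k))| < e.
Proof.
move=> fc s0 st e0; have [dl dl0 H] := fc t _ e0.
have [N HN] := grid_mesh st dl0; exists N => n Nn k kn u u0.
have gt0 j : (j <= n.+1)%N -> 0 <= Num.min u (grid s t n j) <= t.
  by move=> jn; rewrite le_min u0 grid_ge0//= ge_min grid_le_end// orbT.
apply: H; [exact: gt0|by apply: gt0; rewrite leqW|].
have /andP[h1 h2] := min_grid_mesh u st (HN _ Nn k).
by rewrite ger0_norm.
Qed.

(** Each cell is estimated by [est] with [c] the value of [S] at its left end, and the bounds
    telescope in [W]. Times are capped at [u] so that the lemma applies to stopped paths: cells
    beyond [u] collapse to a point. *)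
Lemma riemann_stieltjes_grid (S A I W : R -> R) (s t u e : R) :
  ucont S -> 0 <= s -> s <= t -> 0 <= u -> 0 < e ->
  (forall a b c e : R, 0 <= a -> a <= b ->
    (forall x : R, a < x <= b -> `|S x - c| <= e) ->
    `|I b - I a - c * (A b - A a)| <= e * (W b - W a)) ->
  exists N, forall n, (N <= n)%N ->
  `|\sum_(k < n.+1) S (Num.min u (grid s t n k)) *
     (A (Num.min u (grid s t n k.+1)) - A (Num.min u (grid s t n k))) -
    (I (Num.min u t) - I (Num.min u s))| <= e.
Proof.
move=> Sc s0 st u0 e0 est.
(* The total of the telescoped bounds; the tolerance on [S] is [e / (w + 1)], where [+ 1] keeps the
   denominator positive. *)
pose w := `|W (Num.min u t) - W (Num.min u s)|.
have w0 : 0 < w + 1 by rewrite /w ltr_wpDl.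
have e1 : 0 < e / (w + 1) by rewrite divr_gt0.
have [dl dl0 H] := Sc t _ e1.
have [N HN] := grid_mesh st dl0; exists N => n Nn.
pose m k := Num.min u (grid s t n k).
have mt k : (k <= n.+1)%N -> 0 <= m k <= t.
  by move=> jn; rewrite le_min u0 grid_ge0//= ge_min grid_le_end// orbT.
have mm k : 0 <= m k.+1 - m k < dl := min_grid_mesh u st (HN _ Nn k).
have -> : I (Num.min u t) - I (Num.min u s) = \sum_(k < n.+1) (I (m k.+1) - I (m k)).
  by rewrite (telescope_ord (fun k => I (m k))) /m gridn grid0.
rewrite -sumrB (le_trans (ler_norm_sum _ _ _))//.
apply: (@le_trans _ _ (\sum_(k < n.+1) (e / (w + 1)) * (W (m k.+1) - W (m k)))).
  apply: ler_sum => k _; rewrite distrC; have /andP[mk mk'] := mm k.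
  have kn : (k <= n)%N by rewrite -ltnS.
  apply: est; [by case/andP: (mt k (leqW kn))|by rewrite -subr_ge0|].
  move=> x /andP[kx xk]; apply/ltW/H.
  - have /andP[_ h2] := mt k.+1 kn; have /andP[h3 _] := mt k (leqW kn).
    by rewrite (le_trans xk)// andbT (le_trans h3)// ltW.
  - exact: mt k (leqW kn).
  - by rewrite ger0_norm ?subr_ge0 ?(ltW kx)//; apply: le_lt_trans mk'; rewrite lerD2r.
rewrite -mulr_sumr (telescope_ord (fun k => W (m k))) /m gridn grid0.
rewrite mulrAC ler_pdivrMr// ler_wpM2l ?(ltW e0)//.
by rewrite (le_trans (ler_norm _))// lerDl.
Qed.

(* Stopping at [u] changes the bracket sum only through the cell containing
   [u]. *)
Lemma stopped_bracket (S X : R -> R) (g : nat -> R) (u e : R) n :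
  (forall k, g k <= g k.+1) -> 0 <= e ->
  (forall k, (k < n)%N -> `|S (Num.min u (g k.+1)) - S (Num.min u (g k))| <= e) ->
  (forall k, (k < n)%N -> `|X (Num.min u (g k.+1)) - X (Num.min u (g k))| <= e) ->
  exists2 j, (j <= n)%N &
  `|\sum_(k < n) (S (Num.min u (g k.+1)) - S (Num.min u (g k))) *
                 (X (Num.min u (g k.+1)) - X (Num.min u (g k))) -
    \sum_(k < j) (S (g k.+1) - S (g k)) * (X (g k.+1) - X (g k))| <= e * e.
Proof.
move=> gle e0.
have K m : g m <= u -> \sum_(k < m) (S (Num.min u (g k.+1)) - S (Num.min u (g k))) *
                 (X (Num.min u (g k.+1)) - X (Num.min u (g k))) =
    \sum_(k < m) (S (g k.+1) - S (g k)) * (X (g k.+1) - X (g k)).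
  have gle' a b : (a <= b)%N -> g a <= g b.
    exact: (@homo_leq _ g (fun x y => x <= y) (@lexx _ _) (@le_trans _ _) gle).
  move=> gu; apply: eq_bigr => k _.
  have h1 : g k.+1 <= u by apply: le_trans gu; exact: gle'.
  have h2 : g k <= u by apply: le_trans h1.
  by rewrite !(min_idPr h1) !(min_idPr h2).
elim: n => [|n IH] HS HX.
  by exists 0 => //; rewrite !big_ord0 subr0 normr0 mulr_ge0.
have [gu|ug] := leP (g n) u.
  exists n => //; rewrite big_ord_recr/= K// addrAC subrr add0r normrM.
  by apply: ler_pM => //; [exact: HS|exact: HX].
have [||j jn Hj] := IH.
- by move=> k kn; apply: HS; rewrite ltnS ltnW.
- by move=> k kn; apply: HX; rewrite ltnS ltnW.
exists j; first exact: leqW.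
rewrite big_ord_recr/= (min_idPl (ltW ug)) (min_idPl (le_trans (ltW ug) (gle n))).
by rewrite !subrr mulr0 addr0.
Qed.

End Grid.

(** * Expectation calculus *)

Section LevelSets.
Context {d : measure_display} {T : measurableType d} {R : realType}.
Implicit Types (f g : T -> R).

Lemma measurable_gt f (c : R) : measurable_fun setT f -> measurable [set w | c < f w].
Proof.
move=> mf; rewrite [X in measurable X](_ : _ = setT `&` f @^-1` `]c, +oo[).
  by apply: mf.
by apply/seteqP; split => w /=; rewrite in_itv/= andbT // => -[].
Qed.

Lemma measurable_ge f (c : R) : measurable_fun setT f -> measurable [set w | c <= f w].
Proof.
move=> mf; rewrite [X in measurable X](_ : _ = setT `&` f @^-1` `[c, +oo[).
  by apply: mf.
by apply/seteqP; split => w /=; rewrite in_itv/= andbT // => -[].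
Qed.

Lemma measurable_le f (c : R) : measurable_fun setT f -> measurable [set w | f w <= c].
Proof.
move=> mf; rewrite [X in measurable X](_ : _ = setT `&` f @^-1` `]-oo, c]).
  by apply: mf.
by apply/seteqP; split => w /=; rewrite in_itv/= // => -[].
Qed.

End LevelSets.

Section Expectation.
Context {d : measure_display} {T : measurableType d} {R : realType}.
Variable P : probability T R.
Implicit Types (f g h : T -> R) (A B : set T).

(** Expectation and probability with values in [R], so that estimates end in linear arithmetic
    rather than in extended reals. *)
Definition mean f : R := \int[P]_w f w.
Definition intg f : Prop := P.-integrable setT (EFin \o f).
Definition bmeas f : Prop :=
  measurable_fun setT f /\ exists c : R, forall w, `|f w| <= c.
Definition pr A : R := fine (P A).

Lemma intg_meas f : intg f -> measurable_fun setT f.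
Proof. by move=> /measurable_int /measurable_EFinP. Qed.

Lemma bmeas_intg f : bmeas f -> intg f.
Proof.
move=> [mf [c fc]]; apply: measurable_bounded_integrable => //.
  by rewrite (@le_lt_trans _ _ 1%E) ?probability_le1 ?ltry.
exists c; split; first by rewrite num_real.
by move=> x cx w _ /=; rewrite (le_trans (fc w))// ltW.
Qed.

Lemma intgM f h : bmeas h -> intg f -> intg (fun w => h w * f w).
Proof.
move=> [mh [c hc]] fi; apply: (@integrableMr _ _ _ P setT measurableT h (EFin \o f)) => //.
exists c; split; first by rewrite num_real.
by move=> x cx w _ /=; rewrite (le_trans (hc w))// ltW.
Qed.

Lemma intgD f g : intg f -> intg g -> intg (fun w => f w + g w).
Proof. by move=> fi gi; exact: (integrableD measurableT fi gi). Qed.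

Lemma intgB f g : intg f -> intg g -> intg (fun w => f w - g w).
Proof. by move=> fi gi; exact: (integrableB measurableT fi gi). Qed.

Lemma intgZ c f : intg f -> intg (fun w => c * f w).
Proof. by move=> fi; exact: (integrableZl measurableT c fi). Qed.

Lemma intg_norm f : intg f -> intg (fun w => `|f w|).
Proof. by move=> fi; exact: (integrable_norm fi). Qed.

Lemma intg_le f g : measurable_fun setT f -> (forall w, `|f w| <= g w) ->
  intg g -> intg f.
Proof.
move=> mf fg gi; apply: (@le_integrable _ _ _ P setT measurableT (EFin \o f) (EFin \o g)) => //.
  exact/measurable_EFinP.
by move=> w _ /=; rewrite lee_fin (le_trans (fg w))// ler_norm.
Qed.

Lemma bmeas_cst c : bmeas (fun=> c).
Proof. by split; [exact: measurable_cst|exists `|c|]. Qed.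

Lemma intg_cst c : intg (fun=> c).
Proof. exact/bmeas_intg/bmeas_cst. Qed.

Lemma bmeasD f g : bmeas f -> bmeas g -> bmeas (fun w => f w + g w).
Proof.
move=> [mf [c fc]] [mg [c' gc]]; split; first exact: measurable_funD.
by exists (c + c') => w; rewrite (le_trans (ler_normD _ _))// lerD.
Qed.

Lemma bmeasM f g : bmeas f -> bmeas g -> bmeas (fun w => f w * g w).
Proof.
move=> [mf [c fc]] [mg [c' gc]]; split; first exact: measurable_funM.
by exists (c * c') => w; rewrite normrM ler_pM.
Qed.

Lemma bmeasN f : bmeas f -> bmeas (fun w => - f w).
Proof.
move=> [mf [c fc]]; split; first exact: measurableT_comp.
by exists c => w; rewrite normrN.
Qed.

Lemma bmeasB f g : bmeas f -> bmeas g -> bmeas (fun w => f w - g w).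
Proof. by move=> fb gb; apply: bmeasD => //; exact: bmeasN. Qed.

Lemma bmeas_sum n (F : nat -> T -> R) : (forall k, (k < n)%N -> bmeas (F k)) ->
  bmeas (fun w => \sum_(k < n) F k w).
Proof.
elim: n => [|n IH] HF.
  by under eq_fun do rewrite big_ord0; exact: bmeas_cst.
under eq_fun do rewrite big_ord_recr/=.
by apply: bmeasD; [apply: IH => k kn; apply: HF; exact: ltnW|exact: HF].
Qed.

Lemma bmeas_indic A : measurable A -> bmeas (\1_A : T -> R).
Proof.
move=> mA; split; first exact: measurable_indic.
by exists 1 => w; rewrite indicE; case: (_ \in _); rewrite ?normr1 ?normr0.
Qed.

Lemma meanD f g : intg f -> intg g -> mean (fun w => f w + g w) = mean f + mean g.
Proof. by move=> fi gi; exact: RintegralD. Qed.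

Lemma meanB f g : intg f -> intg g -> mean (fun w => f w - g w) = mean f - mean g.
Proof. by move=> fi gi; exact: RintegralB. Qed.

Lemma meanZ c f : intg f -> mean (fun w => c * f w) = c * mean f.
Proof. by move=> fi; exact: RintegralZl. Qed.

Lemma mean_cst c : mean (fun=> c) = c.
Proof.
rewrite /mean Rintegral_cst// [fine _](_ : _ = 1) ?mulr1//.
exact: (congr1 fine (probability_setT P)).
Qed.

Lemma le_mean f g : intg f -> intg g -> (forall w, f w <= g w) -> mean f <= mean g.
Proof. by move=> fi gi fg; apply: le_Rintegral. Qed.

Lemma mean_ge0 f : (forall w, 0 <= f w) -> 0 <= mean f.
Proof. by move=> f0; exact: Rintegral_ge0. Qed.

Lemma le_norm_mean f : intg f -> `|mean f| <= mean (fun w => `|f w|).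
Proof. by move=> fi; exact: le_normr_Rintegral. Qed.

Lemma eq_mean f g : (forall w, f w = g w) -> mean f = mean g.
Proof. by move=> fg; apply: eq_Rintegral => w _. Qed.

Lemma intg_sum n (F : nat -> T -> R) : (forall k, (k < n)%N -> intg (F k)) ->
  intg (fun w => \sum_(k < n) F k w).
Proof.
elim: n => [|n IH] HF.
  by under eq_fun do rewrite big_ord0; exact: intg_cst.
under eq_fun do rewrite big_ord_recr/=.
by apply: intgD; [apply: IH => k kn; apply: HF; exact: ltnW|exact: HF].
Qed.

Lemma mean_sum n (F : nat -> T -> R) : (forall k, (k < n)%N -> intg (F k)) ->
  mean (fun w => \sum_(k < n) F k w) = \sum_(k < n) mean (F k).
Proof.
elim: n => [|n IH] HF.
  by under eq_mean do rewrite big_ord0; rewrite mean_cst big_ord0.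
under eq_mean do rewrite big_ord_recr/=.
rewrite meanD; last 2 first.
- by apply: intg_sum => k kn; apply: HF; exact: ltnW.
- exact: HF.
by rewrite big_ord_recr/= IH// => k kn; apply: HF; exact: ltnW.
Qed.

Lemma P_pr A : measurable A -> P A = (pr A)%:E.
Proof. by move=> mA; rewrite /pr fineK// fin_num_measure. Qed.

Lemma pr_ge0 A : 0 <= pr A.
Proof. by rewrite /pr fine_ge0. Qed.

Lemma pr_le A B : measurable A -> measurable B -> A `<=` B -> pr A <= pr B.
Proof.
move=> mA mB AB; rewrite -lee_fin -!P_pr//; apply: le_measure => //; exact/mem_set.
Qed.

Lemma pr_leU A B : measurable A -> measurable B -> pr (A `|` B) <= pr A + pr B.
Proof.
move=> mA mB; rewrite -lee_fin EFinD -!P_pr//; last exact: measurableU.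
exact: measureU2.
Qed.

Lemma mean_indic A : measurable A -> mean \1_A = pr A.
Proof. by move=> mA; rewrite /mean /Rintegral integral_indic// setIT. Qed.

Lemma chebyshev_sq f (lam : R) : bmeas f -> 0 < lam ->
  pr [set w | lam < `|f w|] * lam ^+ 2 <= mean (fun w => f w ^+ 2).
Proof.
move=> fb lam0.
have mA : measurable [set w | lam < `|f w|].
  by apply: measurable_gt; apply: measurableT_comp => //; case: fb.
rewrite -mean_indic// mulrC -meanZ; last exact/bmeas_intg/bmeas_indic.
apply: le_mean.
- exact/intgZ/bmeas_intg/bmeas_indic.
- by apply: bmeas_intg; under eq_fun do rewrite expr2; exact: bmeasM.
move=> w; rewrite indicE; case: (boolP (_ \in _)) => [|_]; last by rewrite mulr0 sqr_ge0.
rewrite inE/= mulr1 => lf; rewrite -[leRHS]real_normK ?num_real// ler_sqr ?nnegrE//; exact: ltW.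
Qed.

(** Dominated convergence for the indicators of [E n]. It turns statements on each single path into
    convergence in probability. *)
Lemma pr_cvg0 (E : nat -> set T) : (forall n, measurable (E n)) ->
  {ae P, forall w, exists N, forall n, (N <= n)%N -> ~ E n w} ->
  forall e : R, 0 < e -> exists N, forall n, (N <= n)%N -> pr (E n) <= e.
Proof.
move=> mE aeE e e0.
have [||||| _ _] := @dominated_convergence _ _ _ P setT measurableT
  (fun n => EFin \o \1_(E n)) (cst 0%E) (cst 1%E).
- by move=> n; apply/measurable_EFinP; exact: measurable_indic.
- exact: measurable_cst.
- apply: filterS aeE => w [N HN] _; apply: cvg_near_cst; exists N => // n /= /HN h.
  by rewrite indicE memNset.
- exact: (@intg_cst 1).
- apply: aeW => w n _ /=; rewrite lee_fin indicE.
  by case: (_ \in _); rewrite ?normr1 ?normr0.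
rewrite integral0 => h.
have : (fun n => (pr (E n))%:E) @ \oo --> 0%E.
  apply: cvg_trans h; apply: near_eq_cvg; near=> n => /=.
  by rewrite integral_indic// setIT; exact: P_pr.
move/fine_cvgP => [_] /cvgrPdist_le /(_ _ e0) [N _ HN].
exists N => n Nn; have := HN n Nn; rewrite /= sub0r normrN ger0_norm//.
exact: pr_ge0.
Unshelve. all: by end_near. Qed.

End Expectation.

(** * Limits of expectations *)

Section Limits.
Context {d : measure_display} {T : measurableType d} {R : realType}.
Variable P : probability T R.
Implicit Types (f g h : T -> R) (A B : set T).
Local Notation mean := (mean P).
Local Notation intg := (intg P).
Local Notation pr := (pr P).

Lemma mean_dct (F : nat -> T -> R) f g : (forall n, measurable_fun setT (F n)) ->
  measurable_fun setT f -> (forall w, F n w @[n --> \oo] --> f w) -> intg g ->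
  (forall n w, `|F n w| <= g w) ->
  intg f /\ mean (F n) @[n --> \oo] --> mean f.
Proof.
move=> mF mf Ff gi Fg.
have [||||| fi _ cf] := @dominated_convergence _ _ _ P setT measurableT
  (fun n => EFin \o F n) (EFin \o f) (EFin \o g).
- by move=> n; exact/measurable_EFinP.
- exact/measurable_EFinP.
- by apply: aeW => w _; apply: cvg_EFin; [exact: nearW|exact: Ff].
- exact: gi.
- by apply: aeW => w n _ /=; rewrite lee_fin.
split => //; apply: fine_cvg.
rewrite fineK; first exact: cf.
exact: integrable_fin_num.
Qed.

(** Monotone convergence along the truncations at [n]. Integrability is a conclusion here, which is
    how it is obtained for limits about which nothing is known beforehand. *)
Lemma intg_trunc f (K : R) : measurable_fun setT f -> (forall w, 0 <= f w) ->
  (forall n : nat, mean (fun w => Num.min (f w) n%:R) <= K) ->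
  intg f /\ mean f <= K.
Proof.
move=> mf f0 HK.
pose g (n : nat) (w : T) : \bar R := (Num.min (f w) n%:R)%:E.
have mg n : measurable_fun setT (fun w => Num.min (f w) (n%:R : R)).
  by apply: measurable_minr.
have gb n : bmeas (fun w => Num.min (f w) (n%:R : R)).
  split; first exact: mg.
  exists n%:R => w; rewrite ger0_norm; last by rewrite le_min f0/=.
  by rewrite ge_min lexx orbT.
have gK : forall n, (\int[P]_w g n w <= K%:E)%E.
  move=> n.
  rewrite -[leLHS]fineK; first by rewrite lee_fin; exact: HK.
  exact: integrable_fin_num (bmeas_intg P (gb n)).
have lg w : limn (g^~ w) = (f w)%:E.
  apply: cvg_lim => //; apply: cvg_near_cst.
  exists (Num.bound `|f w|) => // n /= fn; rewrite /g; congr EFin.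
  apply/min_idPl; rewrite (le_trans (ler_norm _))// (le_trans (ltW (archi_boundP _)))//.
  by rewrite ler_nat.
have mct : (\int[P]_w limn (g^~ w) = limn (fun n => \int[P]_w g n w))%E.
  apply: monotone_convergence => //.
  - by move=> n; apply/measurable_EFinP; exact: mg.
  - by move=> n w _; rewrite lee_fin le_min f0/=.
  - move=> w _ n m nm; rewrite /g lee_fin le_min !ge_min lexx/= ler_nat nm orbT//.
have fK : (\int[P]_w (f w)%:E <= K%:E)%E.
  under eq_integral do rewrite -lg.
  rewrite mct; apply: lime_le.
    apply: ereal_nondecreasing_is_cvgn => n m nm; apply: ge0_le_integral => //.
    - by move=> w _; rewrite lee_fin le_min f0/=.
    - by apply/measurable_EFinP; exact: mg.
    - by apply/measurable_EFinP; exact: mg.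
    - by move=> w _; rewrite /g lee_fin le_min !ge_min lexx/= ler_nat nm orbT.
  by apply: nearW => n; exact: gK.
have fi : intg f.
  apply/integrableP; split; first exact/measurable_EFinP.
  rewrite (le_lt_trans _ (ltry K))// (le_trans _ fK)//.
  by under eq_integral do rewrite /= ger0_norm ?f0//.
split => //; rewrite -lee_fin /mean /Rintegral fineK//.
exact: integrable_fin_num.
Qed.

(** Bounded second moments make the [J n] uniformly integrable, so a limit in probability keeps the
    mean 0. For each tolerance a single good index [n] is enough; no subsequence is extracted. *)
Lemma mean0_cvg_prob (J : nat -> T -> R) f (K : R) :
  (forall n, bmeas (J n)) -> (forall n, mean (J n) = 0) ->
  (forall n, mean (fun w => J n w ^+ 2) <= K) -> measurable_fun setT f ->
  (forall e d : R, 0 < e -> 0 < d -> exists n,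
     pr [set w | e < `|J n w - f w|] <= d) ->
  intg f /\ mean f = 0.
Proof.
move=> bJ J0 JK mf cJ.
have mA n e : measurable [set w | e < `|J n w - f w|].
  apply: measurable_gt; apply: measurableT_comp => //.
  by apply: measurable_funB => //; case: (bJ n).
have K0 : 0 <= K by rewrite (le_trans _ (JK 0%N))// mean_ge0// => w; exact: sqr_ge0.
have iJ n : intg (fun w => J n w ^+ 2).
  by apply: bmeas_intg; under eq_fun do rewrite expr2; exact: bmeasM.
have c1 (c : nat) : 0 < (c%:R + 1 : R)^-1 by rewrite invr_gt0 ltr_wpDl.
have [fi2 fK] : intg (fun w => f w ^+ 2) /\ mean (fun w => f w ^+ 2) <= 2 * K + 3.
  apply: intg_trunc; first exact: measurable_funX.
    by move=> w; exact: sqr_ge0.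
  (* Off an event of probability at most [1 / (c + 1)], [f] is within 1 of [J n], so
     [f ^+ 2 <= 2 * J n ^+ 2 + 2]. On that event the truncated square is at most [c], which
     contributes at most 1; hence [2 * K + 3]. *)
  move=> c; have [n Hn] := cJ 1 (c%:R + 1)^-1 ltr01 (c1 c).
  pose A := [set w | 1 < `|J n w - f w|].
  have iA : intg (\1_A : T -> R) by apply/bmeas_intg/bmeas_indic; exact: mA.
  apply: (@le_trans _ _ (mean (fun w => 2 * J n w ^+ 2 + (2 + c%:R * \1_A w)))).
    apply: le_mean.
    - apply: bmeas_intg; split.
        by apply: measurable_minr => //; exact: measurable_funX.
      exists c%:R => w; rewrite ger0_norm; last by rewrite le_min sqr_ge0/=.
      by rewrite ge_min lexx orbT.
    - apply: intgD; first exact: intgZ.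
      by apply: intgD; [exact: intg_cst|exact: intgZ].
    - move=> w; rewrite indicE; case: (boolP (_ \in _)) => [|].
        move=> _; rewrite ge_min mulr1; apply/orP; right.
        by rewrite addrA lerDr addr_ge0// mulr_ge0// sqr_ge0.
      rewrite notin_setE/= => /negP; rewrite -leNgt mulr0 addr0 => h.
      rewrite ge_min; apply/orP; left.
      have : (J n w - f w) ^+ 2 <= 1.
        by rewrite -[leLHS]real_normK ?num_real// expr_le1.
      by have := sqr_ge0 (2 * J n w - f w); nra.
  rewrite meanD; last 2 first.
  - exact: intgZ.
  - by apply: intgD; [exact: intg_cst|exact: intgZ].
  rewrite meanD; last 2 first.
  - exact: intg_cst.
  - exact: intgZ.
  rewrite !meanZ// mean_cst mean_indic; last exact: mA.
  have := JK n.
  have : c%:R * pr A <= 1.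
    apply: (@le_trans _ _ (c%:R * (c%:R + 1)^-1)); first by rewrite ler_wpM2l.
    by rewrite ler_pdivrMr ?mul1r ?lerDl// ltr_wpDl.
  lra.
have fi : intg f.
  apply: (@intg_le _ _ _ _ _ (fun w => 1 + f w ^+ 2)) => //.
    by move=> w; rewrite -[f w ^+ 2]real_normK ?num_real//; nra.
  by apply: intgD => //; exact: intg_cst.
split => //; apply/eqP; rewrite -normr_le0; apply/ler_addgt0Pr => e e0.
rewrite add0r.
(* [6 * K + 6] is [2 * K + 2 * (2 * K + 3)], a bound for the mean of [2 * J n ^+ 2 + 2 * f ^+ 2].
   With [C = 3 * K' / e], the inequality [x <= C^-1 * x ^+ 2 + C] on the bad event costs [e / 3] for
   the square and [e / 3] for the constant; the good event costs the last [e / 3]. *)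
pose K' := 6 * K + 6 + 1.
have K'0 : 0 < K' by rewrite ltr_wpDl// addr_ge0// mulr_ge0.
pose C := 3 * K' / e.
have C0 : 0 < C by rewrite divr_gt0// mulr_gt0.
have e3 : 0 < e / 3 by rewrite divr_gt0.
have [n Hn] := cJ (e / 3) (e / 3 / C) e3 (divr_gt0 e3 C0).
pose A := [set w | e / 3 < `|J n w - f w|].
have iA : intg (\1_A : T -> R) by apply/bmeas_intg/bmeas_indic; exact: mA.
have iD : intg (fun w => J n w - f w) by apply: intgB => //; exact: bmeas_intg.
have iD2 : intg (fun w => C^-1 * (2 * J n w ^+ 2 + 2 * f w ^+ 2)).
  by apply/intgZ/intgD; exact: intgZ.
have iR : intg (fun w => e / 3 + C * \1_A w).
  by apply: intgD; [exact: intg_cst|exact: intgZ].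
have -> : `|mean f| = `|mean (fun w => J n w - f w)|.
  by rewrite meanB ?J0 ?sub0r ?normrN//; exact: bmeas_intg.
rewrite (le_trans (le_norm_mean iD))//.
apply: (@le_trans _ _ (mean (fun w => C^-1 * (2 * J n w ^+ 2 + 2 * f w ^+ 2) +
    (e / 3 + C * \1_A w)))).
  apply: le_mean; [exact: intg_norm|exact: intgD|].
  move=> w; rewrite indicE; case: (boolP (_ \in _)) => [_|].
    rewrite mulr1.
    have h : `|J n w - f w| <= C^-1 * (`|J n w - f w| ^+ 2) + C.
      rewrite -(ler_pM2l C0) mulrDr mulrA divff ?gt_eqF// mul1r.
      have := sqr_ge0 (`|J n w - f w| - C); have := normr_ge0 (J n w - f w).
      nra.
    have h2 : C^-1 * (`|J n w - f w| ^+ 2) <= C^-1 * (2 * J n w ^+ 2 + 2 * f w ^+ 2).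
      rewrite ler_wpM2l ?invr_ge0 ?(ltW C0)//.
      rewrite real_normK ?num_real//; have := sqr_ge0 (J n w + f w); nra.
    lra.
  rewrite notin_setE/= => /negP; rewrite -leNgt mulr0 addr0 => h.
  apply: (le_trans h); rewrite lerDr mulr_ge0 ?invr_ge0 ?(ltW C0)//.
  by rewrite addr_ge0// mulr_ge0// sqr_ge0.
rewrite meanD// meanZ; last by apply: intgD; exact: intgZ.
rewrite meanD; [|exact: intgZ|exact: intgZ].
rewrite [X in _ + X]meanD; [|exact: intg_cst|exact: intgZ].
rewrite mean_cst !meanZ// mean_indic; last exact: mA.
have h1 : C * pr A <= e / 3.
  by rewrite mulrC -ler_pdivlMr.
have h2 : C^-1 * (2 * mean (fun w => J n w ^+ 2) + 2 * mean (fun w => f w ^+ 2)) <= e / 3.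
  rewrite -(ler_pM2l C0) mulrA divff ?gt_eqF// mul1r.
  rewrite [leRHS](_ : _ = K'); last by rewrite /C; field; rewrite gt_eqF.
  by rewrite /K'; have := JK n; lra.
lra.
Qed.

End Limits.

(** * Discrete martingale transforms *)

Section SubSigmaAlgebra.
Context {d : measure_display} {T : measurableType d} {R : realType}.
Variable G : set (set T).
Hypothesis sG : sigma_algebra setT G.
Implicit Types (f g : T -> R).

Definition gmeas f : Prop := forall B : set R, measurable B -> G (f @^-1` B).

Lemma gmeasP f : gmeas f <-> measurable_fun setT (f : g_sigma_algebraType G -> R).
Proof.
split => [Gf _ B mB|mf B mB].
  by rewrite setTI; apply: sub_sigma_algebra; exact: Gf.
rewrite -(measurable_g_measurableTypeE sG) -[_ @^-1` _]setTI; exact: mf.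
Qed.

Lemma gmeasD f g : gmeas f -> gmeas g -> gmeas (fun w => f w + g w).
Proof. by rewrite !gmeasP => mf mg; exact: measurable_funD. Qed.

Lemma gmeasM f g : gmeas f -> gmeas g -> gmeas (fun w => f w * g w).
Proof. by rewrite !gmeasP => mf mg; exact: measurable_funM. Qed.

Lemma gmeasB f g : gmeas f -> gmeas g -> gmeas (fun w => f w - g w).
Proof. by rewrite !gmeasP => mf mg; exact: measurable_funB. Qed.

Lemma gmeas_norm f : gmeas f -> gmeas (fun w => `|f w|).
Proof. by rewrite !gmeasP => mf; exact: measurableT_comp. Qed.

Lemma gmeas_cst (c : R) : gmeas (fun=> c).
Proof. by rewrite !gmeasP. Qed.

Lemma gmeas_comp (phi : R -> R) f : measurable_fun setT phi -> gmeas f ->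
  gmeas (fun w => phi (f w)).
Proof. by rewrite !gmeasP => mp mf; exact: (measurableT_comp mp mf). Qed.

Lemma gmeas_sum n (F : nat -> T -> R) : (forall k, (k < n)%N -> gmeas (F k)) ->
  gmeas (fun w => \sum_(k < n) F k w).
Proof.
elim: n => [|n IH] HF.
  by under eq_fun do rewrite big_ord0; exact: gmeas_cst.
under eq_fun do rewrite big_ord_recr/=.
by apply: gmeasD; [apply: IH => k kn; apply: HF; exact: ltnW|exact: HF].
Qed.

Lemma gmeas_indic A : G A -> gmeas (\1_A : T -> R).
Proof.
move=> GA; apply/gmeasP; apply: measurable_indic.
exact: sub_sigma_algebra.
Qed.

Lemma gmeas_cvg (F : nat -> T -> R) f : (forall n, gmeas (F n)) ->
  (forall w, F n w @[n --> \oo] --> f w) -> gmeas f.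
Proof.
move=> GF Ff; apply/gmeasP.
apply: (@measurable_fun_cvg _ (g_sigma_algebraType G) R setT F f) => [n|w _]; last exact: Ff.
by apply/gmeasP.
Qed.

Lemma gset0 : G set0. Proof. by case: sG. Qed.

Lemma gsetC A : G A -> G (~` A).
Proof. by case: sG => _ h _ GA; rewrite -setTD; exact: h. Qed.

Lemma gset_bigcup (F : nat -> set T) : (forall n, G (F n)) -> G (\bigcup_n F n).
Proof. by case: sG => _ _ h; exact: h. Qed.

Lemma gsetU A B : G A -> G B -> G (A `|` B).
Proof.
rewrite -(measurable_g_measurableTypeE sG); exact: measurableU.
Qed.

Lemma gsetI A B : G A -> G B -> G (A `&` B).
Proof.
rewrite -(measurable_g_measurableTypeE sG); exact: measurableI.
Qed.

Lemma gset_bigcap (F : nat -> set T) : (forall n, G (F n)) -> G (\bigcap_n F n).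
Proof.
move=> h; rewrite -(setCK (\bigcap_n F n)) setC_bigcap; apply: gsetC.
by apply: gset_bigcup => n; exact: gsetC.
Qed.

Lemma gset_ge f (c : R) : gmeas f -> G [set w | c <= f w].
Proof.
move=> /gmeasP mf; rewrite -(measurable_g_measurableTypeE sG).
exact: measurable_ge mf.
Qed.

Lemma gset_gt f (c : R) : gmeas f -> G [set w | c < f w].
Proof.
move=> /gmeasP mf; rewrite -(measurable_g_measurableTypeE sG).
exact: measurable_gt mf.
Qed.

Lemma gset_le f (c : R) : gmeas f -> G [set w | f w <= c].
Proof.
move=> /gmeasP mf; rewrite -(measurable_g_measurableTypeE sG).
exact: measurable_le mf.
Qed.

Hypothesis Gm : G `<=` measurable.

Lemma gmeas_measurable f : gmeas f -> measurable_fun setT f.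
Proof. by move=> Gf _ B mB; rewrite setTI; apply: Gm; exact: Gf. Qed.

End SubSigmaAlgebra.

Lemma gmeasS {d : measure_display} {T : measurableType d} {R : realType}
  (G G' : set (set T)) (f : T -> R) : G `<=` G' -> gmeas G f -> gmeas G' f.
Proof. by move=> GG Gf B mB; apply: GG; exact: Gf. Qed.

(** * Martingale increments against bounded measurable factors *)

Section Martingale.
Context {d : measure_display} {T : measurableType d} {R : realType}.
Variables (P : probability T R) (F : R -> set (set T)).
Hypothesis filtF : filtration F.
Local Notation mean := (mean P).
Local Notation intg := (intg P).
Local Notation pr := (pr P).

Lemma filtS (t : R) : 0 <= t -> sigma_algebra setT (F t).
Proof. by case: filtF => h _ _; exact: h. Qed.

Lemma filt_meas (t : R) : 0 <= t -> F t `<=` measurable.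
Proof. by case: filtF => _ h _; exact: h. Qed.

Lemma filt_le (s t : R) : 0 <= s -> s <= t -> F s `<=` F t.
Proof. by case: filtF => _ _ h; exact: h. Qed.

(** The sum is [dl] times the number of positive multiples of [dl] not exceeding [x], that is, [x]
    rounded down. Written this way, rounding a function gives a combination of indicators of its
    superlevel sets. *)
Lemma round_down (x dl : R) n : 0 < dl -> 0 <= x -> x <= n%:R * dl ->
  `|x - \sum_(j < n) dl * ((j.+1%:R * dl <= x)%R)%:R| <= dl.
Proof.
move=> dl0 x0; elim: n => [|n IH].
  rewrite mul0r => x0'; rewrite big_ord0 subr0.
  have -> : x = 0 by apply/eqP; rewrite eq_le x0'.
  by rewrite normr0 ltW.
move=> xn; rewrite big_ord_recr/=; have [xn'|xn'] := leP x (n%:R * dl).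
  rewrite (_ : (n.+1%:R * dl <= x) = false) ?mulr0 ?addr0; first exact: IH.
  by apply/negbTE; rewrite -ltNge (le_lt_trans xn')// ltr_pM2r// ltr_nat.
have -> : \sum_(j < n) dl * ((j.+1%:R * dl <= x)%R)%:R = n%:R * dl.
  rewrite (eq_bigr (fun=> dl)); last first.
    move=> j _; rewrite (_ : (_ <= x) = true) ?mulr1//.
    by rewrite (le_trans _ (ltW xn'))// ler_pM2r// ler_nat.
  by rewrite sumr_const card_ord mulr_natl.
move: xn; rewrite -natr1 mulrDl mul1r => xn.
by rewrite ler_norml; case: (leP (n%:R * dl + dl) x) => h /=; rewrite ?mulr1 ?mulr0; apply/andP; split; lra.
Qed.

Lemma martingale_mean_indic U (s t : R) A : martingale P F U -> 0 <= s -> s <= t -> F s A ->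
  mean (fun w => \1_A w * (U t w - U s w)) = 0.
Proof.
move=> [_ iU mU] s0 st FA; have t0 := le_trans s0 st.
have mA := filt_meas s0 FA.
have iA (r : R) : 0 <= r -> intg (fun w => \1_A w * U r w).
  by move=> r0; apply: intgM; [exact: bmeas_indic|exact: iU].
under eq_mean do rewrite mulrBr.
rewrite meanB; [|exact: iA|exact: iA].
have E (r : R) : mean (fun w => \1_A w * U r w) = \int[P]_(w in A) U r w.
  rewrite Rintegral_mkcond; apply: eq_Rintegral => w _.
  by rewrite patchE indicE; case: (_ \in _); rewrite ?mul1r ?mul0r.
by rewrite !E /Rintegral (mU s t s0 st A FA) subrr.
Qed.

(** The martingale property is given on events only. Shifted by [c] to be nonnegative, [H] is
    rounded down to a simple function [h], for which the claim follows by linearity; the error is at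
    most [dl] times the mean of [|D|], and [dl = e / (K + 1)] makes it at most [e]. *)
Lemma martingale_mean_mul U (s t : R) H : martingale P F U -> 0 <= s -> s <= t ->
  gmeas (F s) H -> bmeas H -> mean (fun w => H w * (U t w - U s w)) = 0.
Proof.
move=> MU s0 st GH [mH [c Hc]]; have t0 := le_trans s0 st.
have [_ iU _] := MU.
pose D w := U t w - U s w.
have iD : intg D by apply: intgB; exact: iU.
have FsT : F s setT by rewrite -setC0; apply: gsetC; [exact: filtS|exact: gset0 (filtS s0)].
have D0 : mean D = 0.
  rewrite -[RHS](martingale_mean_indic MU s0 st FsT).
  by apply: eq_mean => w; rewrite indicT mul1r.
have c0 : 0 <= c by rewrite (le_trans _ (Hc point)).
pose H' w := H w + c.
have H'0 w : 0 <= H' w by have := Hc w; rewrite ler_norml /H' => /andP[]; lra.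
have H'c w : H' w <= 2 * c by have := Hc w; rewrite ler_norml /H' => /andP[]; lra.
have bH : bmeas H by split => //; exists c.
have bH' : bmeas H' by apply: bmeasD => //; exact: bmeas_cst.
suff : mean (fun w => H' w * D w) = 0.
  rewrite /H'; under eq_mean do rewrite mulrDl.
  rewrite meanD; [|exact: intgM|exact: intgZ].
  by rewrite meanZ// D0 mulr0 addr0.
apply/eqP; rewrite -normr_le0; apply/ler_addgt0Pr => e e0; rewrite add0r.
pose K := mean (fun w => `|D w|).
have K0 : 0 <= K by apply: mean_ge0.
have K1 : 0 < K + 1 by rewrite ltr_wpDl.
pose dl := e / (K + 1).
have dl0 : 0 < dl by rewrite divr_gt0.
pose n := Num.bound `|2 * c / dl|.
have nb : 2 * c <= n%:R * dl.
  by rewrite -ler_pdivrMr// (le_trans (ler_norm _))// ltW// archi_boundP.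
pose A j := [set w | j.+1%:R * dl <= H' w].
have FA j : F s (A j).
  apply: gset_ge; first exact: filtS.
  by apply: gmeasD; [exact: filtS|exact: GH|apply: gmeas_cst; exact: filtS].
have mA j : measurable (A j) by exact: (filt_meas s0 (FA j)).
pose h w := \sum_(j < n) dl * \1_(A j) w.
have hE w : h w = \sum_(j < n) dl * ((j.+1%:R * dl <= H' w)%R)%:R.
  apply: eq_bigr => j _; rewrite indicE; congr (_ * _%:R).
  by rewrite /A mem_setE.
have bh : bmeas h.
  apply: (@bmeas_sum _ _ _ n (fun j w => dl * \1_(A j) w)) => k _.
  by apply: bmeasM; [exact: bmeas_cst|exact: bmeas_indic].
have h0 : mean (fun w => h w * D w) = 0.
  rewrite /h; under eq_mean do rewrite mulr_suml.
  rewrite (mean_sum (F := fun j w => dl * \1_(A j) w * D w)); last first.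
    move=> k _; apply: intgM => //.
    by apply: bmeasM; [exact: bmeas_cst|exact: bmeas_indic].
  rewrite big1// => k _; under eq_mean do rewrite -mulrA.
  rewrite meanZ; last by apply: intgM => //; exact: bmeas_indic.
  by rewrite (martingale_mean_indic MU s0 st (FA k)) mulr0.
have -> : mean (fun w => H' w * D w) = mean (fun w => (H' w - h w) * D w).
  under [RHS]eq_mean do rewrite mulrBl.
  by rewrite meanB ?h0 ?subr0//; exact: intgM.
have bB : bmeas (fun w => H' w - h w) by exact: bmeasB.
rewrite (le_trans (le_norm_mean _))//; first exact: intgM.
apply: (@le_trans _ _ (mean (fun w => dl * `|D w|))).
  apply: le_mean; first by apply: intg_norm; exact: intgM.
    by apply: intgZ; exact: intg_norm.
  move=> w; rewrite normrM ler_wpM2r// hE round_down//.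
  exact: le_trans nb.
rewrite meanZ; last exact: intg_norm.
rewrite -/K /dl mulrAC ler_pdivrMr//.
by rewrite ler_wpM2l ?(ltW e0)// lerDl.
Qed.

End Martingale.

Lemma measurable_exists_le {d : measure_display} {T : measurableType d}
  (E : nat -> set T) n : (forall j, measurable (E j)) ->
  measurable [set w | exists2 j, (j <= n)%N & E j w].
Proof.
move=> mE; rewrite [X in measurable X](_ : _ = \bigcup_(j in [set j | (j <= n)%N]) E j).
  exact: bigcup_measurable.
by apply/seteqP; split => w [j jn Ej]; exists j.
Qed.

(** * Martingale transforms on a grid and their maximal inequality *)

Section Transform.
Context {d : measure_display} {T : measurableType d} {R : realType}.
Variables (P : probability T R) (F : R -> set (set T)).
Hypothesis filtF : filtration F.
Variables (U : R -> T -> R) (g : nat -> R) (b : R).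
Hypothesis MU : martingale P F U.
Hypothesis g0 : 0 <= g 0.
Hypothesis gS : forall k, g k <= g k.+1.
Hypothesis Ub : forall k w, `|U (g k) w| <= b.
Local Notation mean := (mean P).
Local Notation intg := (intg P).
Local Notation pr := (pr P).

Definition transform (H : nat -> T -> R) n w :=
  \sum_(k < n) H k w * (U (g k.+1) w - U (g k) w).

Let gle j k : (j <= k)%N -> g j <= g k.
Proof. exact: (@homo_leq _ g (fun x y => x <= y) (@lexx _ _) (@le_trans _ _) gS). Qed.

Let gge k : 0 <= g k.
Proof. by rewrite (le_trans g0)// gle. Qed.

Let U_gmeas k : gmeas (F (g k)) (U (g k)).
Proof. by case: MU => aU _ _ B mB; exact: aU. Qed.

Let U_bmeas k : bmeas (U (g k)).
Proof.
split; last by exists b.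
exact: (gmeas_measurable (filt_meas filtF (gge k)) (U_gmeas k)).
Qed.

Lemma transform_gmeas H n : (forall k, (k < n)%N -> gmeas (F (g k)) (H k)) ->
  gmeas (F (g n)) (transform H n).
Proof.
move=> GH; have sF := filtS filtF (gge n).
apply: (@gmeas_sum _ _ _ _ sF n (fun k w => H k w * (U (g k.+1) w - U (g k) w))) => k kn.
apply: (gmeasM sF).
  by apply: gmeasS (GH k kn); apply: (filt_le filtF) => //; apply: gle; exact: ltnW.
by apply: (gmeasB sF); apply: gmeasS (U_gmeas _); apply: (filt_le filtF) => //;
  apply: gle => //; exact: ltnW.
Qed.

Section Bounded.
Variables (H : nat -> T -> R) (c : R).
Hypothesis GH : forall k, gmeas (F (g k)) (H k).
Hypothesis Hc : forall k w, `|H k w| <= c.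

Let H_bmeas k : bmeas (H k).
Proof.
split; last by exists c.
exact: (gmeas_measurable (filt_meas filtF (gge k)) (GH k)).
Qed.

Lemma transform_bmeas n : bmeas (transform H n).
Proof.
apply: (@bmeas_sum _ _ _ n (fun k w => H k w * (U (g k.+1) w - U (g k) w))) => k kn.
by apply: bmeasM => //; exact: bmeasB.
Qed.

Let mean_mul_incr (h : T -> R) k : gmeas (F (g k)) h -> bmeas h ->
  mean (fun w => h w * (U (g k.+1) w - U (g k) w)) = 0.
Proof. by move=> Gh bh; exact: (martingale_mean_mul filtF MU). Qed.

Lemma transform_mean n : mean (transform H n) = 0.
Proof.
rewrite (mean_sum (F := fun k w => H k w * (U (g k.+1) w - U (g k) w))); last first.
  by move=> k _; apply: bmeas_intg; apply: bmeasM => //; exact: bmeasB.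
by rewrite big1// => k _; exact: mean_mul_incr.
Qed.

(** Each increment is orthogonal to everything known before it, so the squares of the terms add up.
    The same orthogonality applied to [U] itself makes the sum of the mean squared increments
    telescope. *)
Lemma transform_mean_sqr_le n :
  mean (fun w => transform H n w ^+ 2) <=
  c ^+ 2 * (mean (fun w => U (g n) w ^+ 2) - mean (fun w => U (g 0) w ^+ 2)).
Proof.
have sq f : bmeas f -> intg (fun w => f w ^+ 2).
  by move=> bf; apply: bmeas_intg; under eq_fun do rewrite expr2; exact: bmeasM.
elim: n => [|n IH].
  rewrite subrr mulr0; under eq_mean do rewrite /transform big_ord0 expr0n.
  by rewrite mean_cst.
pose D w := U (g n.+1) w - U (g n) w.
have bD : bmeas D by exact: bmeasB.
have bT := transform_bmeas n.
have -> : mean (fun w => transform H n.+1 w ^+ 2) =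
    mean (fun w => transform H n w ^+ 2) + mean (fun w => (H n w * D w) ^+ 2).
  have -> : mean (fun w => transform H n.+1 w ^+ 2) =
    mean (fun w => transform H n w ^+ 2 + ((H n w * D w) ^+ 2 +
      2 * ((transform H n w * H n w) * D w))).
    by apply: eq_mean => w; rewrite {1}/transform big_ord_recr/= -/(transform H n w) -/(D w); ring.
  have bHD : bmeas (fun w => H n w * D w) by exact: bmeasM.
  have bTHD : bmeas (fun w => transform H n w * H n w * D w).
    by apply: bmeasM => //; exact: bmeasM.
  rewrite meanD; [|exact: sq|]; last first.
    by apply: intgD; [exact: sq|apply: intgZ; exact: bmeas_intg].
  rewrite meanD; [|exact: sq|apply: intgZ; exact: bmeas_intg].
  rewrite meanZ; last exact: bmeas_intg.
  rewrite mean_mul_incr ?mulr0 ?addr0//; last exact: bmeasM.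
  by apply: (gmeasM (filtS filtF (gge n))) => //; exact: transform_gmeas.
have DE : mean (fun w => D w ^+ 2) =
    mean (fun w => U (g n.+1) w ^+ 2) - mean (fun w => U (g n) w ^+ 2).
  have -> : mean (fun w => D w ^+ 2) =
    mean (fun w => U (g n.+1) w ^+ 2 - U (g n) w ^+ 2 + (-2) * (U (g n) w * D w)).
    by apply: eq_mean => w; rewrite /D; ring.
  rewrite meanD; [|by apply: intgB; exact: sq|]; last first.
    by apply: intgZ; apply: bmeas_intg; exact: bmeasM.
  rewrite meanB; [|exact: sq|exact: sq].
  rewrite meanZ; last by apply: bmeas_intg; exact: bmeasM.
  by rewrite mean_mul_incr ?mulr0 ?addr0.
have : mean (fun w => (H n w * D w) ^+ 2) <= c ^+ 2 * mean (fun w => D w ^+ 2).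
  rewrite -meanZ; last exact: sq.
  apply: le_mean; [by apply: sq; exact: bmeasM|by apply: intgZ; exact: sq|].
  move=> w; rewrite exprMn ler_wpM2r ?sqr_ge0//.
  rewrite -[leLHS]real_normK ?num_real// ler_sqr ?nnegrE//.
  by rewrite (le_trans _ (Hc n w)).
rewrite DE; move: IH; rewrite !mulrBr; lra.
Qed.

Lemma transform_mean_sqr n : mean (fun w => transform H n w ^+ 2) <= c ^+ 2 * b ^+ 2.
Proof.
apply: le_trans (transform_mean_sqr_le n) _; rewrite ler_wpM2l ?sqr_ge0//.
have h0 : 0 <= mean (fun w => U (g 0) w ^+ 2) by apply: mean_ge0 => w; exact: sqr_ge0.
suff : mean (fun w => U (g n) w ^+ 2) <= b ^+ 2 by lra.
rewrite -[leRHS](mean_cst P); apply: le_mean.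
- by apply: bmeas_intg; under eq_fun do rewrite expr2; exact: bmeasM.
- exact: intg_cst.
move=> w; rewrite -[leLHS]real_normK ?num_real// ler_sqr ?nnegrE//.
by rewrite (le_trans _ (Ub n w)).
Qed.

End Bounded.

Section Maximal.
Variables (c : nat -> R) (dl lam : R).
Hypothesis cdl : forall k, `|c k| <= dl.
Hypothesis lam0 : 0 < lam.

(* Frozen once it exceeds [lam], so that its terminal value detects the maximum. *)
Fixpoint frozen_transform n w : R :=
  if n is k.+1 then
    frozen_transform k w + c k * \1_[set v | `|frozen_transform k v| <= lam] w *
      (U (g k.+1) w - U (g k) w)
  else 0.

Let H k : T -> R := fun w => c k * \1_[set v | `|frozen_transform k v| <= lam] w.

Let frozenE n : frozen_transform n = transform H n.
Proof.
apply/funext => w; elim: n => [|n IH]; first by rewrite /transform big_ord0.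
by rewrite /= IH /transform big_ord_recr.
Qed.

Let H_gmeas k : gmeas (F (g k)) (H k).
Proof.
elim/ltn_ind: k => k IH; have sF := filtS filtF (gge k).
apply: (gmeasM sF); first exact: gmeas_cst.
apply: gmeas_indic => //; rewrite frozenE; apply: gset_le => //.
apply: gmeas_norm => //; exact: transform_gmeas.
Qed.

Let Hdl k w : `|H k w| <= dl.
Proof.
rewrite /H indicE; case: (_ \in _); rewrite ?mulr1// mulr0 normr0.
exact: le_trans (cdl k).
Qed.

Lemma transform_maximal n :
  pr [set w | exists2 j, (j <= n)%N & lam < `|transform (fun k _ => c k) j w|] <=
  dl ^+ 2 * b ^+ 2 / lam ^+ 2.
Proof.
have bT j : bmeas (transform H j) by exact: transform_bmeas Hdl j.
have bc j : bmeas (transform (fun k _ => c k) j).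
  apply: (@transform_bmeas _ dl) => // k.
  exact: gmeas_cst (filtS filtF (gge k)) _.
rewrite ler_pdivlMr ?exprn_gt0//.
apply: le_trans (transform_mean_sqr H_gmeas Hdl n).
apply: le_trans (chebyshev_sq P (bT n) lam0); rewrite ler_wpM2r ?sqr_ge0//.
apply: pr_le.
- apply: (@measurable_exists_le _ _ (fun j => [set w | lam < `|transform (fun k _ => c k) j w|])).
  by move=> j; apply: measurable_gt; apply: measurableT_comp => //; case: (bc j).
- by apply: measurable_gt; apply: measurableT_comp => //; case: (bT n).
move=> w /= [j jn lamj]; rewrite -frozenE ltNge; apply/negP => hn.
have frz k : lam < `|frozen_transform k w| -> lam < `|frozen_transform k.+1 w|.
  by move=> h /=; rewrite indicE memNset ?mulr0 ?mul0r ?addr0//= leNgt h.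
have all_le k : (k <= n)%N -> `|frozen_transform k w| <= lam.
  move=> kn; rewrite leNgt; apply/negP => h.
  suff : lam < `|frozen_transform n w| by rewrite ltNge hn.
  rewrite -(subnK kn); elim: (n - k)%N => [//|m IH]; rewrite addSn; exact: frz.
have E k : (k <= n)%N -> frozen_transform k w = transform (fun k _ => c k) k w.
  elim: k => [|k IH] kn; first by rewrite /transform big_ord0.
  rewrite /= IH 1?ltnW// /transform big_ord_recr/= indicE mem_set ?mulr1//=.
  by apply: all_le; exact: ltnW.
by move: lamj; rewrite -E// ltNge all_le.
Qed.

End Maximal.
End Transform.

(** * Optional stopping *)

Section Stopping.
Context {d : measure_display} {T : measurableType d} {R : realType}.
Variables (F : R -> set (set T)).
Hypothesis filtF : filtration F.
Implicit Types (tau : T -> \bar R) (X : R -> T -> R).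

Definition stop tau (t : R) (w : T) : R := fine (mine (tau w) t%:E).

Lemma stopE tau (t r : R) w : tau w = r%:E -> stop tau t w = Num.min r t.
Proof. by move=> tw; rewrite /stop tw -EFin_min. Qed.

Lemma stopy tau (t : R) w : tau w = +oo%E -> stop tau t w = t.
Proof. by move=> tw; rewrite /stop tw min_r// leey. Qed.

Section Positive.
Variables (tau : T -> \bar R) (w : T).
Hypothesis tau0 : (0 <= tau w)%E.

Lemma stop_le (t : R) : stop tau t w <= t.
Proof.
move: tau0; case E : (tau w) => [r| |]// _; last by rewrite (stopy _ E).
by rewrite (stopE _ E) ge_min lexx orbT.
Qed.

Lemma stop_ge0 (t : R) : 0 <= t -> 0 <= stop tau t w.
Proof.
move=> t0; move: tau0; case E : (tau w) => [r| |]//; last by rewrite (stopy _ E).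
by rewrite lee_fin (stopE _ E) le_min t0 => ->.
Qed.

Lemma stop_min (s t : R) : s <= t -> stop tau s w = Num.min (stop tau t w) s.
Proof.
move=> st; move: tau0; case E : (tau w) => [r| |]// _.
  by rewrite !(stopE _ E) -minA (min_idPr st).
by rewrite !(stopy _ E) (min_idPr st).
Qed.

Lemma stop_le_tau (t : R) : ((stop tau t w)%:E <= tau w)%E.
Proof.
move: tau0; case E : (tau w) => [r| |]// _; last by rewrite !leey.
by rewrite (stopE _ E) lee_fin ge_min lexx.
Qed.

Lemma stop_gt (t : R) : (t%:E < tau w)%E -> stop tau t w = t.
Proof.
move: tau0; case E : (tau w) => [r| |]// _; last by rewrite (stopy _ E).
by rewrite lte_fin (stopE _ E) => tr; rewrite min_r// ltW.
Qed.

End Positive.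

Lemma stopped_processE X tau (t : R) w : stopped_process X tau t w = X (stop tau t w) w.
Proof. by []. Qed.

Lemma stop0 tau w : (0 <= tau w)%E -> stop tau 0 w = 0.
Proof. by move=> h; apply/eqP; rewrite eq_le stop_le//= stop_ge0. Qed.

Lemma ucont_stopped X tau w : (0 <= tau w)%E -> ucont (fun t => X t w) ->
  ucont (fun t => stopped_process X tau t w).
Proof.
move=> tau0 cX; case E : (tau w) => [r| |].
- have r0 : 0 <= r by rewrite -lee_fin -E.
  apply: ucont_ext (ucont_min r0 cX) => t t0.
  by rewrite stopped_processE (stopE _ E).
- by apply: ucont_ext cX => t t0; rewrite stopped_processE (stopy _ E).
- by move: tau0; rewrite E.
Qed.

Lemma stopping_time_min tau tau' : stopping_time F tau -> stopping_time F tau' ->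
  stopping_time F (fun w => mine (tau w) (tau' w)).
Proof.
move=> [t0 tF] [t0' tF']; split; first by move=> w; rewrite le_min t0 t0'.
move=> t tt; rewrite (_ : [set w | _] = [set w | (tau w <= t%:E)%E] `|` [set w | (tau' w <= t%:E)%E]).
  by apply: gsetU; [exact: filtS|exact: tF|exact: tF'].
by apply/seteqP; split => w /=; rewrite ge_min => /orP.
Qed.

Lemma stopping_time_cst (r : \bar R) : (0 <= r)%E -> stopping_time F (fun=> r).
Proof.
move=> r0; split => // t t0; have [rt|rt] := boolP (r <= t%:E)%E.
  rewrite (_ : [set w | _] = ~` set0); last by apply/seteqP; split => w //= _ [].
  by apply: gsetC (gset0 _); exact: filtS.
rewrite (_ : [set w | _] = set0); first by apply: gset0; exact: filtS.
by apply/seteqP; split => w //= h; rewrite h in rt.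
Qed.

Lemma stopping_time_gt tau (t : R) : stopping_time F tau -> 0 <= t ->
  F t [set w | (t%:E < tau w)%E].
Proof.
move=> [_ tF] t0; rewrite (_ : [set w | _] = ~` [set w | (tau w <= t%:E)%E]).
  by apply: gsetC; [exact: filtS|exact: tF].
by apply/seteqP; split => w /=; rewrite ltNge => /negP.
Qed.

Hypothesis rcF : right_continuous_filtration F.

(* [E] need only be testable at rational times, which keeps the union
   countable; right-continuity of [F] turns [tau < u] into [tau <= u]. *)
Lemma stopping_time_first_time (E : R -> set T) : (forall t, 0 <= t -> F t (E t)) ->
  (forall w (t u : R), 0 <= t -> t < u -> E t w ->
     exists q : rat, [/\ 0 <= ratr q :> R, ratr q < u & E (ratr q) w]) ->
  stopping_time F (fun w => first_time [set t | E t w]).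
Proof.
move=> FE Eq; split.
  by move=> w; apply/ereal_infP => _ [t [t0 _] <-]; rewrite lee_fin.
move=> t t0; rewrite rcF// => s /= ts.
have s0 : 0 <= s by rewrite (le_trans t0)// ltW.
(* The [k]-th rational is a time of [E] before both [s] and [t + 1 / (n + 1)]. The first bound keeps
   the event in [F s]; the second, for all [n], forces the infimum to be at most [t]. Codes of no
   rational give [set0]. *)
pose A (n k : nat) : set T :=
  if unpickle k is Some q then
    if (0 <= ratr q :> R) && (ratr q < s) && (ratr q < t + n.+1%:R^-1) then E (ratr q) else set0
  else set0.
have FA n k : F s (A n k).
  rewrite /A; case: unpickle => [q|]; last exact: gset0 (filtS filtF s0).
  case: ifP => [/andP[/andP[q0 qs] _]|_]; last exact: gset0 (filtS filtF s0).
  by apply: (filt_le filtF q0 (ltW qs)); exact: FE.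
rewrite (_ : [set w | _] = \bigcap_n \bigcup_k A n k).
  apply: gset_bigcap; first exact: filtS.
  by move=> n; apply: gset_bigcup => [|k]; [exact: filtS|exact: FA].
apply/seteqP; split => w /=.
  move=> ht n _; pose u := Num.min s (t + n.+1%:R^-1).
  have tu : t < u by rewrite lt_min ts/= ltrDl invr_gt0 ltr0n.
  have : (first_time [set t | E t w] < u%:E)%E by apply: le_lt_trans ht _; rewrite lte_fin.
  move/ereal_inf_ltP => [_ [r [r0 Er] <-]]; rewrite lte_fin => ru.
  have [q [q0 qu Eqw]] := Eq _ _ _ r0 ru Er.
  exists (pickle q); first exact: Logic.I.
  rewrite /A pickleK.
  move: (ratr q) q0 qu Eqw => v v0; rewrite lt_min => /andP[vs vt] Ev.
  by rewrite v0 vs vt.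
move=> h; apply/lee_addgt0Pr => e e0.
have [n Hn] : exists n : nat, n.+1%:R^-1 < e.
  exists (Num.bound `|e^-1|); rewrite invf_plt ?posrE//.
  apply: le_lt_trans (ler_norm _) _; apply: lt_le_trans (archi_boundP _) _ => //.
  by rewrite ler_nat.
have [k _] := h n I; rewrite /A; case: unpickle => // q.
case: ifP => // /andP[/andP[q0 qs] qt] Eqw.
move: (ratr q) q0 qs qt Eqw => r r0 rs rt Er.
apply: (@le_trans _ _ r%:E).
  by apply: ge_ereal_inf; exists r%:E => //; exists r.
by rewrite -EFinD lee_fin ltW// (lt_trans rt)// ltrD2l.
Qed.

End Stopping.

(** * Optional stopping through grid times *)

Section OptionalStopping.
Context {d : measure_display} {T : measurableType d} {R : realType}.
Variables (P : probability T R) (F : R -> set (set T)).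
Hypothesis filtF : filtration F.
Variable tau : T -> \bar R.
Hypothesis st_tau : stopping_time F tau.
Implicit Types (X U : R -> T -> R).
Local Notation mean := (mean P).
Local Notation intg := (intg P).

Let tau0 w : (0 <= tau w)%E. Proof. by case: st_tau. Qed.

(* [X] evaluated at the first grid point that is at least [tau]. *)
Fixpoint upstop X (g : nat -> R) k w : R :=
  if k is j.+1 then
    if ((g j)%:E < tau w)%E then X (g j.+1) w else upstop X g j w
  else X (g 0) w.

Lemma upstop_gmeas X (g : nat -> R) k : adapted F X -> 0 <= g 0 ->
  (forall k, g k <= g k.+1) -> gmeas (F (g k)) (upstop X g k).
Proof.
move=> aX g0 gS.
have gge j : 0 <= g j by elim: j => // j /le_trans; exact.
elim: k => [|k IH]; first by move=> B mB; exact: aX.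
have sF := filtS filtF (gge k.+1).
have -> : upstop X g k.+1 = fun w =>
   \1_[set w | ((g k)%:E < tau w)%E] w * X (g k.+1) w +
   (1 - \1_[set w | ((g k)%:E < tau w)%E] w) * upstop X g k w.
  apply/funext => w /=; rewrite indicE; case: ifPn => h.
    by rewrite mem_set//=; ring.
  by rewrite memNset/=; [ring|exact/negP].
have Gi : gmeas (F (g k.+1)) (\1_[set w | ((g k)%:E < tau w)%E] : T -> R).
  apply: gmeas_indic => //; apply: (filt_le filtF (gge k)) => //.
  exact: stopping_time_gt.
apply: (gmeasD sF); apply: (gmeasM sF) => //.
- by move=> B mB; exact: aX.
- by apply: (gmeasB sF) => //; exact: gmeas_cst.
- by apply: gmeasS IH; exact: filt_le.
Qed.

(** The process on the grid overshoots [tau] by at most one mesh. The maximum with [s] appears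
    because the grid begins at [s]: a path with [tau] below [s] is frozen at [s] from the start. *)
Lemma upstop_near X (s t : R) n k w : 0 <= s -> s <= t -> (k <= n.+1)%N ->
  let sig := Num.max (stop tau t w) s in
  exists r : R, [/\ upstop X (grid s t n) k w = X r w,
    Num.min sig (grid s t n k) <= r,
    r <= Num.min sig (grid s t n k) + (t - s) / n.+1%:R & r <= t].
Proof.
move=> s0 st kn sig.
have sig_s : s <= sig by rewrite /sig le_max lexx orbT.
have m0 : 0 <= (t - s) / n.+1%:R by rewrite divr_ge0// subr_ge0.
elim: k kn => [|k IH] kn.
  exists s; rewrite /= grid0; split => //; rewrite ?ge_min ?lexx ?orbT//.
  by rewrite (min_idPr sig_s) lerDl.
have gk : grid s t n k <= t by apply: grid_le_end => //; exact: ltnW.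
have gk' : grid s t n k.+1 <= t by exact: grid_le_end.
have /= gS := grid_step s t n k.
case/boolP: ((grid s t n k)%:E < tau w)%E => h.
  exists (grid s t n k.+1); split => //; first by rewrite ge_min lexx orbT.
  have : grid s t n k <= Num.min sig (grid s t n k.+1).
    rewrite le_min; apply/andP; split; last exact: grid_le.
    rewrite /sig le_max; apply/orP; left.
    move: h (tau0 w); case E : (tau w) => [x| |]// h _.
      by rewrite (stopE _ E) le_min gk andbT; move: h; rewrite lte_fin => /ltW.
    by rewrite (stopy _ E).
  by rewrite -gS; lra.
have [r [Er r1 r2 r3]] := IH (ltnW kn).
have sg : sig <= grid s t n k.
  rewrite /sig ge_max grid_ge// andbT.
  move: h (tau0 w); rewrite -leNgt; case E : (tau w) => [x| |]// h _.
  by rewrite (stopE _ E) ge_min; move: h; rewrite lee_fin => ->.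
have sg' : sig <= grid s t n k.+1 by rewrite (le_trans sg)// grid_le.
exists r; split => //.
  by rewrite (min_idPl sg') -(min_idPl sg).
by rewrite (min_idPl sg') -(min_idPl sg).
Qed.

Lemma upstop_cvg X (s t : R) w : 0 <= s -> s <= t -> ucont (fun r => X r w) ->
  upstop X (grid s t n) n.+1 w @[n --> \oo] --> X (Num.max (stop tau t w) s) w.
Proof.
move=> s0 st cX; apply/cvgrPdist_lt => e e0.
have [dl dl0 H] := cX t e e0.
have [N HN] := grid_mesh st dl0.
exists N => // n Nn.
have [r [Er r1 r2 r3]] := upstop_near X w s0 st (leqnn n.+1).
have st' : Num.max (stop tau t w) s <= t by rewrite ge_max st andbT stop_le.
rewrite gridn (min_idPl st') in r1 r2.
have sig0 : 0 <= Num.max (stop tau t w) s by rewrite le_max s0 orbT.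
suff : `|X (Num.max (stop tau t w) s) w - X r w| < e by rewrite -Er.
apply: H; rewrite ?sig0 ?st'//=.
  by rewrite r3 (le_trans sig0).
have := HN n Nn 0; rewrite grid_step => hh.
by rewrite distrC ger0_norm ?subr_ge0// ltrBlDl (le_lt_trans r2)// ltrD2l.
Qed.

Lemma stopped_gmeas X (t : R) : 0 <= t -> adapted F X -> (forall w, ucont (fun r => X r w)) ->
  gmeas (F t) (stopped_process X tau t).
Proof.
move=> t0 aX cX; have sF := filtS filtF t0.
apply: (@gmeas_cvg _ _ _ _ sF (fun n => upstop X (grid 0 t n) n.+1)) => [n|w].
  rewrite -{1}(gridn 0 t n); apply: upstop_gmeas => //; first by rewrite grid0.
  by move=> k; exact: grid_le.
rewrite stopped_processE.
have := @upstop_cvg X 0 t w (lexx 0) t0 (cX w).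
by rewrite (max_idPl _)// stop_ge0.
Qed.

Lemma stopped_adapted X : adapted F X -> (forall w, ucont (fun r => X r w)) ->
  adapted F (stopped_process X tau).
Proof. by move=> aX cX t t0 B mB; exact: stopped_gmeas. Qed.

Section Test.
Variables (U : R -> T -> R) (s t : R) (B : set T).
Hypothesis MU : martingale P F U.
Hypothesis cU : forall w, ucont (fun r => U r w).
Hypothesis s0 : 0 <= s.
Hypothesis st : s <= t.
Hypothesis FB : F s B.

Let Usig w := U (Num.max (stop tau t w) s) w.
Let t0 : 0 <= t. Proof. exact: le_trans st. Qed.
Let mB : measurable B. Proof. exact: (filt_meas filtF s0 FB). Qed.
Let aU : adapted F U. Proof. by case: MU. Qed.
Let iU r : 0 <= r -> intg (U r). Proof. by case: MU => _ h _; exact: h. Qed.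

(* Testing against [phi] with [phi] and [phi x * x] bounded replaces the uniform
   integrability usually needed to pass to the limit in optional stopping. *)
Lemma test_upstop (phi : R -> R) (c : R) n k : measurable_fun setT phi ->
  (forall x, `|phi x| <= c) -> (forall x, `|phi x * x| <= c) -> (k <= n.+1)%N ->
  mean (fun w => \1_B w * phi (upstop U (grid s t n) k w) * upstop U (grid s t n) k w) =
  mean (fun w => \1_B w * phi (upstop U (grid s t n) k w) * U (grid s t n k) w).
Proof.
move=> mphi phic phixc; pose g := grid s t n; rewrite -/g.
have g0 k' : 0 <= g k' by exact: grid_ge0.
have gle j k' : (j <= k')%N -> g j <= g k' by move=> ?; exact: grid_le.
have gZ k' : gmeas (F (g k')) (upstop U g k').
  by apply: upstop_gmeas => // j; exact: gle.
have mZ k' : measurable_fun setT (upstop U g k').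
  exact: (gmeas_measurable (filt_meas filtF (g0 k')) (gZ k')).
have bphi k' : bmeas (fun w => phi (upstop U g k' w)).
  by split; [exact: measurableT_comp|exists c => w; exact: phic].
have bphix k' : bmeas (fun w => phi (upstop U g k' w) * upstop U g k' w).
  split; last by exists c => w; exact: phixc.
  by apply: measurable_funM => //; exact: measurableT_comp.
have bB := bmeas_indic (R := R) mB.
suff E k' : (k' <= n.+1)%N ->
   mean (fun w => \1_B w * phi (upstop U g k' w) * (upstop U g k' w - U (g k') w)) = 0.
  move=> kn; apply/eqP; rewrite -subr_eq0 -meanB; last 2 first.
  - apply: bmeas_intg; under eq_fun do rewrite -mulrA; exact: bmeasM.
  - apply: intgM; last exact: iU.
    exact: bmeasM.
  by apply/eqP; rewrite -[RHS](E k kn); apply: eq_mean => w; ring.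
elim: k' => [|k' IH] kn.
  by under eq_mean do rewrite /= subrr mulr0; rewrite mean_cst.
pose A := [set w | ((g k')%:E < tau w)%E].
have FA : F (g k') (~` A).
  by apply: gsetC; [exact: filtS|exact: stopping_time_gt].
(* From one grid time to the next, the difference between [upstop] and [U] changes only where
   [tau <= g k'], by minus the increment of [U]. This event is known at time [g k'], so the change
   has mean 0 against the test factor. *)
pose h w := \1_B w * \1_(~` A) w * phi (upstop U g k' w).
have nA w : \1_(~` A) w = 1 - \1_A w :> R.
  by rewrite !indicE in_setC; case: (_ \in A); rewrite ?subrr ?subr0.
have sF := filtS filtF (g0 k').
have Gh : gmeas (F (g k')) h.
  apply: (gmeasM sF); last first.
    exact: (gmeas_comp sF mphi (gZ k')).
  apply: (gmeasM sF); last exact: gmeas_indic.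
  apply: gmeas_indic => //; apply: (filt_le filtF s0) FB.
  by rewrite /g -{1}(grid0 s t n); exact: grid_le.
have bh : bmeas h.
  apply: bmeasM => //; apply: bmeasM => //; apply: bmeas_indic.
  exact: (filt_meas filtF (g0 k') FA).
have e1 : mean (fun w => \1_B w * phi (upstop U g k' w) * (upstop U g k' w - U (g k') w) -
    h w * (U (g k'.+1) w - U (g k') w)) = 0.
  rewrite meanB; last 2 first.
  - have -> : (fun w => \1_B w * phi (upstop U g k' w) * (upstop U g k' w - U (g k') w)) =
      (fun w => \1_B w * (phi (upstop U g k' w) * upstop U g k' w) -
        (\1_B w * phi (upstop U g k' w)) * U (g k') w).
      by apply/funext => w; ring.
    apply: intgB; first by apply: bmeas_intg; exact: bmeasM.
    by apply: intgM; [exact: bmeasM|exact: iU].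
  - by apply: intgM => //; apply: intgB; exact: iU.
  rewrite IH; last exact: ltnW.
  by rewrite (martingale_mean_mul filtF MU (g0 k') _ Gh bh) ?subrr//; exact: gle.
rewrite -[RHS]e1; apply: eq_mean => w.
have Zk : A w -> upstop U g k' w = U (g k') w.
  rewrite /A/=; case: (k') => //= j hj.
  by rewrite (le_lt_trans _ hj)// lee_fin gle.
rewrite /h nA; have [hA|hA] := boolP ((g k')%:E < tau w)%E.
  have -> : \1_A w = 1 :> R by rewrite indicE mem_set.
  by rewrite /= hA Zk//; ring.
have -> : \1_A w = 0 :> R by rewrite indicE memNset//; exact/negP.
by rewrite /= (negbTE hA); ring.
Qed.

(** Passage to the limit in the mesh: the bound on [phi x * x] dominates one side, [c * |U t|] the
    other. Continuity of [phi] carries the convergence of the grid values. *)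
Lemma test_stopped (phi : R -> R) (c : R) : continuous phi ->
  (forall x, `|phi x| <= c) -> (forall x, `|phi x * x| <= c) ->
  [/\ intg (fun w => \1_B w * phi (Usig w) * Usig w),
    intg (fun w => \1_B w * phi (Usig w) * U t w) &
  mean (fun w => \1_B w * phi (Usig w) * Usig w) =
  mean (fun w => \1_B w * phi (Usig w) * U t w)].
Proof.
move=> cphi phic phixc.
have mphi : measurable_fun setT phi by exact: continuous_measurable_fun.
have c0 : 0 <= c by exact: le_trans (phic 0).
pose Z n := upstop U (grid s t n) n.+1.
have mZ n : measurable_fun setT (Z n).
  have gZ : gmeas (F (grid s t n n.+1)) (Z n).
    by apply: upstop_gmeas => //; [exact: grid_ge0|move=> j; exact: grid_le].
  by apply: (gmeas_measurable _ gZ); apply: filt_meas => //; exact: grid_ge0.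
have cZ w : Z n w @[n --> \oo] --> Usig w by exact: upstop_cvg.
have mU : measurable_fun setT Usig.
  by apply: (@measurable_fun_cvg _ _ _ setT Z) => // w _; exact: cZ.
have mBi : measurable_fun setT (\1_B : T -> R) by exact: measurable_indic.
have B1 w : `|\1_B w| <= 1 :> R.
  by rewrite indicE; case: (_ \in _); rewrite ?normr1 ?normr0.
have phiZ w : phi (Z n w) @[n --> \oo] --> phi (Usig w).
  by apply: cvg_comp; [exact: cZ|exact: cphi].
have [i1 c1] : intg (fun w => \1_B w * phi (Usig w) * Usig w) /\
   mean (fun w => \1_B w * phi (Z n w) * Z n w) @[n --> \oo] -->
   mean (fun w => \1_B w * phi (Usig w) * Usig w).
  apply: (@mean_dct _ _ _ _ _ _ (fun=> c)).
  - move=> n; apply: measurable_funM => //; apply: measurable_funM => //.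
    exact: measurableT_comp.
  - apply: measurable_funM => //; apply: measurable_funM => //.
    exact: measurableT_comp.
  - move=> w; apply: cvgM; last exact: cZ.
    by apply: cvgM; [exact: cvg_cst|exact: phiZ].
  - exact: intg_cst.
  - move=> n w; rewrite -mulrA normrM (le_trans (ler_pM _ _ (B1 w) (phixc _)))//.
    by rewrite mul1r.
have [i2 c2] : intg (fun w => \1_B w * phi (Usig w) * U t w) /\
   mean (fun w => \1_B w * phi (Z n w) * U t w) @[n --> \oo] -->
   mean (fun w => \1_B w * phi (Usig w) * U t w).
  have mUt := intg_meas (iU t0).
  apply: (@mean_dct _ _ _ _ _ _ (fun w => c * `|U t w|)).
  - move=> n; apply: measurable_funM => //; apply: measurable_funM => //.
    exact: measurableT_comp.
  - apply: measurable_funM => //; apply: measurable_funM => //.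
    exact: measurableT_comp.
  - move=> w; apply: cvgM; last exact: cvg_cst.
    by apply: cvgM; [exact: cvg_cst|exact: phiZ].
  - by apply: intgZ; apply: intg_norm; exact: iU.
  - move=> n w; rewrite !normrM ler_wpM2r//.
    by rewrite (le_trans (ler_pM _ _ (B1 w) (phic _)))// mul1r.
split => //; apply: (cvg_unique _ c1) => //.
apply: cvg_trans c2; apply: near_eq_cvg; near=> n.
by rewrite /Z (test_upstop mphi phic phixc (leqnn _)) gridn.
Unshelve. all: by end_near. Qed.

End Test.
End OptionalStopping.

(** * A continuous cutoff *)

Section Cutoff.
Context {R : realType}.

(** Continuous substitute for the indicator of [|x| <= c]: bounded by 1, with [cutoff c x * x]
    bounded by [c], and tending to 1 as [c] grows. *)
Definition cutoff (c x : R) : R := c / (c + `|x|).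

Lemma cutoff_ge0 c x : 0 < c -> 0 <= cutoff c x.
Proof. by move=> c0; rewrite divr_ge0 ?addr_ge0 ?(ltW c0). Qed.

Lemma cutoff_le1 c x : 0 < c -> cutoff c x <= 1.
Proof. by move=> c0; rewrite ler_pdivrMr ?mul1r ?lerDl// ltr_pwDl. Qed.

Lemma cutoff_norm c x : 0 < c -> `|cutoff c x| <= 1.
Proof. by move=> c0; rewrite ger0_norm ?cutoff_ge0// cutoff_le1. Qed.

Lemma cutoffM c x : 0 < c -> `|cutoff c x * x| <= c.
Proof.
move=> c0; rewrite normrM ger0_norm ?cutoff_ge0// /cutoff mulrAC.
by rewrite ler_pdivrMr ?ler_pM2l ?lerDr ?(ltW c0)// ltr_pwDl.
Qed.

(** [cutoff c x * |x|] is half the harmonic mean of [c] and [|x|], hence at least half of their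
    minimum. *)
Lemma cutoff_min c x : 0 < c -> Num.min `|x| c <= 2 * (cutoff c x * `|x|).
Proof.
move=> c0; have h : 0 < c + `|x| by rewrite ltr_pwDl.
rewrite /cutoff mulrAC mulrA ler_pdivlMr//.
have := normr_ge0 x; rewrite /Order.min; case: ltP => ? ?; nra.
Qed.

Lemma continuous_cutoff c : 0 < c -> continuous (cutoff c).
Proof.
move=> c0 x; apply: cvgM; first exact: cvg_cst.
apply: cvgV; first by rewrite gt_eqF// ltr_pwDl.
by apply: cvgD; [exact: cvg_cst|apply: cvg_norm; exact: cvg_id].
Qed.

Lemma cvg_cutoff x : cutoff n.+1%:R x @[n --> \oo] --> (1 : R).
Proof.
apply/cvgrPdist_lt => e e0; exists (Num.bound `| `|x| / e |) => // n /= Nn.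
have h : 0 < n.+1%:R + `|x| by rewrite ltr_pwDl.
have -> : 1 - cutoff n.+1%:R x = `|x| / (n.+1%:R + `|x|).
  by rewrite /cutoff; field; rewrite gt_eqF.
rewrite ger0_norm ?divr_ge0 ?(ltW h)// ltr_pdivrMr// mulrC -ltr_pdivrMr//.
apply: (le_lt_trans (ler_norm _)); apply: (lt_le_trans (archi_boundP _)) => //.
by rewrite -[leLHS]addr0 lerD// ler_nat ltnW.
Qed.

End Cutoff.

(** * Stopped continuous martingales *)

Section StoppedMartingale.
Context {d : measure_display} {T : measurableType d} {R : realType}.
Variables (P : probability T R) (F : R -> set (set T)).
Hypothesis filtF : filtration F.
Local Notation mean := (mean P).
Local Notation intg := (intg P).

Lemma mean_indicM f A : measurable A -> intg f ->
  (\int[P]_(w in A) (f w)%:E)%E = (mean (fun w => \1_A w * f w))%:E.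
Proof.
move=> mA fi; have i1 : intg (fun w => \1_A w * f w).
  by apply: intgM => //; exact: bmeas_indic.
rewrite /mean /Rintegral fineK; last exact: integrable_fin_num i1.
rewrite [LHS]integral_mkcond; apply: eq_integral => w _.
by rewrite patchE indicE; case: (_ \in _); rewrite ?mul1r ?mul0r.
Qed.

Lemma martingaleP (U : R -> T -> R) : adapted F U ->
  (forall t, 0 <= t -> intg (U t)) ->
  (forall (s t : R) A, 0 <= s -> s <= t -> F s A ->
     mean (fun w => \1_A w * (U t w - U s w)) = 0) ->
  martingale P F U.
Proof.
move=> aU iU mU; split => // s t s0 st A FA.
have mA := filt_meas filtF s0 FA; have t0 := le_trans s0 st.
have bA := bmeas_indic (R := R) mA.
rewrite !mean_indicM//; [|exact: iU|exact: iU].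
congr EFin; apply/eqP; rewrite -subr_eq0 -meanB; last 2 first.
- by apply: intgM => //; exact: iU.
- by apply: intgM => //; exact: iU.
by apply/eqP; rewrite -[RHS](mU s t A s0 st FA); apply: eq_mean => w; ring.
Qed.

Variables (tau : T -> \bar R) (U : R -> T -> R).
Hypothesis st_tau : stopping_time F tau.
Hypothesis MU : martingale P F U.
Hypothesis cU : forall w, ucont (fun r => U r w).

Let iU r : 0 <= r -> intg (U r). Proof. by case: MU => _ h _; exact: h. Qed.
Let FT s : 0 <= s -> F s setT.
Proof.
by move=> s0; rewrite -setC0; apply: gsetC; [exact: filtS|exact: gset0 (filtS filtF s0)].
Qed.

(** The test function [k c] is the cutoff times [x / (1 + |x|)], a continuous stand-in for the sign,
    so that [k c x * x] resembles [|x|]. Since [x ^+ 2 / (1 + |x|) >= |x| - 1], replacing the sign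
    costs at most 1. The test identity then bounds the truncated means of [|V|] by
    [2 * (E |U t| + 1)], uniformly in the level. *)
Lemma stopped_intg s t : 0 <= s -> s <= t ->
  intg (fun w => U (Num.max (stop tau t w) s) w).
Proof.
move=> s0 st; set V := fun w => _; have t0 := le_trans s0 st.
pose k (c x : R) := cutoff c x * (x / (1 + `|x|)).
have k1 c x : 0 < c -> `|k c x| <= `|cutoff c x|.
  move=> c0; rewrite normrM ler_piMr// normrM normfV ler_pdivrMr.
    by rewrite mul1r [leRHS]ger0_norm ?addr_ge0// lerDr.
  by rewrite gtr0_norm ?ltr_pwDl.
have mV : measurable_fun setT V.
  apply: (@measurable_fun_cvg _ _ _ setT (fun n => upstop tau U (grid s t n) n.+1)).
    move=> n.
    have gZ : gmeas (F (grid s t n n.+1)) (upstop tau U (grid s t n) n.+1).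
      apply: (upstop_gmeas filtF st_tau); first by case: MU.
        exact: grid_ge0.
      by move=> j; exact: grid_le.
    by apply: (gmeas_measurable _ gZ); apply: filt_meas => //; exact: grid_ge0.
  by move=> w _; exact: (upstop_cvg st_tau s0 st (cU w)).
suff [] : intg (fun w => `|V w|) /\ mean (fun w => `|V w|) <= 2 * (mean (fun w => `|U t w|) + 1).
  by move=> iV _; apply: (intg_le mV _ iV).
apply: intg_trunc => [||n]; first exact: measurableT_comp.
  by [].
have n0 : (0 : R) < n.+1%:R by rewrite ltr0n.
have [|||i1 i2 E] := @test_stopped _ _ _ P F filtF tau st_tau U s t setT MU cU s0 st (FT s0)
  (k n.+1%:R) (n.+1%:R + 1).
- move=> x; apply: cvgM; first exact: continuous_cutoff.
  apply: cvgM; first exact: cvg_id.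
  apply: cvgV; first by rewrite gt_eqF// ltr_pwDl.
  by apply: cvgD; [exact: cvg_cst|apply: cvg_norm; exact: cvg_id].
- move=> x; rewrite (le_trans (k1 _ x n0))// (le_trans (cutoff_norm x n0))//.
  by rewrite lerDr ltW.
- move=> x; rewrite normrM (le_trans (ler_wpM2r _ (k1 _ x n0)))// -normrM.
  by rewrite (le_trans (cutoffM x n0))// lerDl.
have iUn : intg (fun w => `|U t w|) by apply: intg_norm; exact: iU.
apply: (@le_trans _ _ (mean (fun w => 2 * (\1_setT w * k n.+1%:R (V w) * V w + 1)))).
  apply: le_mean.
  - apply: bmeas_intg; split.
      by apply: measurable_minr => //; exact: measurableT_comp.
    exists n%:R => w; rewrite ger0_norm; last by rewrite le_min normr_ge0/=.
    by rewrite ge_min lexx orbT.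
  - by apply: intgZ; apply: intgD => //; exact: intg_cst.
  - move=> w; rewrite indicT mul1r.
    have := cutoff_min (V w) n0.
    have h : Num.min `|V w| n%:R <= Num.min `|V w| n.+1%:R.
      by rewrite le_min ge_min lexx/= ge_min ler_nat leqnSn orbT.
    have h1 := cutoff_le1 (V w) n0; have h0 := cutoff_ge0 (V w) n0.
    have h2 : cutoff n.+1%:R (V w) * `|V w| <= k n.+1%:R (V w) * V w + 1.
      have v0 : 0 < 1 + `|V w| by rewrite ltr_pwDl.
      have -> : k n.+1%:R (V w) * V w = cutoff n.+1%:R (V w) * (`|V w| - 1 + (1 + `|V w|)^-1).
        rewrite /k -mulrA; congr (_ * _); rewrite mulrAC -expr2 -real_normK ?num_real//.
        by field; rewrite gt_eqF.
      have : 0 <= cutoff n.+1%:R (V w) * (1 + `|V w|)^-1.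
        by rewrite mulr_ge0// invr_ge0 ltW.
      rewrite !mulrDr mulrN mulr1; move: h1; lra.
    move: h h2; lra.
rewrite meanZ; last by apply: intgD => //; exact: intg_cst.
rewrite meanD//; last exact: intg_cst.
rewrite mean_cst ler_wpM2l// lerD2r E; apply: le_mean => //.
move=> w; rewrite indicT mul1r (le_trans (ler_norm _))// normrM ler_piMl//.
by rewrite (le_trans (k1 _ _ n0))// cutoff_norm.
Qed.

(** The cutoff tends to 1 in the test identity; now that [V] is known to be integrable, [|V|] and
    [|U t|] dominate the two sides. *)
Lemma stopped_mean s t B : 0 <= s -> s <= t -> F s B ->
  mean (fun w => \1_B w * U (Num.max (stop tau t w) s) w) =
  mean (fun w => \1_B w * U t w).
Proof.
move=> s0 st FB; pose V w := U (Num.max (stop tau t w) s) w; have t0 := le_trans s0 st.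
have iV : intg V := stopped_intg s0 st.
have mV := intg_meas iV.
have mUt := intg_meas (iU t0).
have mB := filt_meas filtF s0 FB.
have bB := bmeas_indic (R := R) mB.
have mBi : measurable_fun setT (\1_B : T -> R) by exact: measurable_indic.
have B1 w : `|\1_B w| <= 1 :> R.
  by rewrite indicE; case: (_ \in _); rewrite ?normr1 ?normr0.
have n0 n : (0 : R) < n.+1%:R by rewrite ltr0n.
have mk n : measurable_fun setT (fun w => cutoff n.+1%:R (V w)).
  apply: measurableT_comp => //; apply: continuous_measurable_fun.
  exact: continuous_cutoff.
have conv (f : T -> R) : intg f ->
  mean (fun w => \1_B w * cutoff n.+1%:R (V w) * f w) @[n --> \oo] -->
  mean (fun w => \1_B w * f w).
  move=> fi; have mf := intg_meas fi.
  apply: (proj2 (@mean_dct _ _ _ P (fun n w => \1_B w * cutoff n.+1%:R (V w) * f w) _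
    (fun w => `|f w|) _ _ _ _ _)) => //.
  - by move=> n; apply: measurable_funM => //; exact: measurable_funM.
  - exact: measurable_funM.
  - move=> w; apply: cvgM; last exact: cvg_cst.
    rewrite -[X in _ --> X]mulr1; apply: cvgM; first exact: cvg_cst.
    exact: cvg_cutoff.
  - exact: intg_norm.
  - move=> n w; rewrite normrM ler_piMl// normrM mulr_ile1 ?B1//.
    exact: cutoff_norm (n0 n).
apply: (cvg_unique _ (conv _ iV)) => //.
apply: cvg_trans (conv _ (iU t0)); apply: near_eq_cvg; near=> n.
have [|||_ _ E] := @test_stopped _ _ _ P F filtF tau st_tau U s t B MU cU s0 st FB
  (cutoff n.+1%:R) (n.+1%:R + 1).
- exact: continuous_cutoff.
- by move=> x; rewrite (le_trans (cutoff_norm x (n0 n)))// lerDr ltW.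
- by move=> x; rewrite (le_trans (cutoffM x (n0 n)))// lerDl.
by rewrite E.
Unshelve. all: by end_near. Qed.

Lemma martingale_stopped : martingale P F (stopped_process U tau).
Proof.
have tau0 w : (0 <= tau w)%E by case: st_tau.
have aU : adapted F U by case: MU.
have iS t : 0 <= t -> intg (stopped_process U tau t).
  move=> t0; have := stopped_intg (lexx 0) t0; congr (intg _).
  by apply/funext => w; rewrite (max_idPl _)// stop_ge0.
apply: martingaleP => //; first exact: stopped_adapted.
move=> s t B s0 st FB; have t0 := le_trans s0 st.
(* Where [tau <= s] the stopped process does not move between [s] and [t]. Where [s < tau], the time
   [min(tau, t)] is already at least [s], so [stopped_mean] applies on [C]. *)
pose C := B `&` [set w | (s%:E < tau w)%E].
have FC : F s C.
  by apply: (gsetI (filtS filtF s0)) => //; exact: stopping_time_gt.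
have bC := bmeas_indic (R := R) (filt_meas filtF s0 FC).
have -> : mean (fun w => \1_B w * (stopped_process U tau t w - stopped_process U tau s w)) =
    mean (fun w => \1_C w * U (Num.max (stop tau t w) s) w - \1_C w * U s w).
  apply: eq_mean => w; rewrite !stopped_processE.
  have [h|h] := boolP (s%:E < tau w)%E.
    have -> : \1_C w = \1_B w :> R by rewrite !indicE in_setI [X in _ && X]mem_set// andbT.
    have sst : s <= stop tau t w.
      move: h (tau0 w); case E : (tau w) => [r| |]// h _.
        by rewrite (stopE _ E) le_min st andbT; move: h; rewrite lte_fin => /ltW.
      by rewrite (stopy _ E).
    by rewrite (stop_min (tau0 w) st) (max_idPl sst) (min_idPr sst) mulrBr.
  have -> : \1_C w = 0 :> R by rewrite indicE memNset// => -[_ /= h']; rewrite h' in h.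
  rewrite !mul0r subrr; move: h (tau0 w); rewrite -leNgt; case E : (tau w) => [r| |]// h _.
  move: h; rewrite lee_fin => rs.
  by rewrite !(stopE _ E) (min_idPl rs) (min_idPl (le_trans rs st)) subrr mulr0.
rewrite meanB; last 2 first.
- by apply: intgM => //; exact: stopped_intg.
- by apply: intgM => //; exact: iU.
rewrite stopped_mean// -meanB; last 2 first.
- by apply: intgM => //; exact: iU.
- by apply: intgM => //; exact: iU.
rewrite -[RHS](martingale_mean_indic filtF MU s0 st FC).
by apply: eq_mean => w; rewrite mulrBr.
Qed.

End StoppedMartingale.

(** * Localization and the bracket of independent processes *)

Section Localization.
Context {d : measure_display} {T : measurableType d} {R : realType}.
Variables (P : probability T R) (F : R -> set (set T)).
Hypothesis filtF : filtration F.
Hypothesis rcF : right_continuous_filtration F.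
Local Notation mean := (mean P).
Local Notation intg := (intg P).
Local Notation pr := (pr P).

Section Hitting.
Variable G : R -> T -> R.
Hypothesis aG : adapted F G.
Hypothesis cG : forall w, ucont (fun t => G t w).

(** The strict inequality makes the set of times open along a continuous path, so that rational
    times suffice to test it. *)
Definition hitting (p : R) (w : T) : \bar R := first_time [set t | p < G t w].

Lemma hitting_stopping p : stopping_time F (hitting p).
Proof.
apply: (stopping_time_first_time filtF rcF (E := fun t => [set w | p < G t w])).
  move=> t t0; apply: gset_gt; first exact: filtS.
  by move=> B mB; exact: aG.
move=> w t u t0 tu /= pG.
have e0 : 0 < G t w - p by rewrite subr_gt0.
have [dl dl0 H] := cG w u e0.
have tm : t < Num.min u (t + dl) by rewrite lt_min tu ltrDl.
have [q] := rat_in_itvoo tm.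
rewrite in_itv/= lt_min => /andP[tq /andP[qu qd]].
exists q; move: (ratr q) tq qu qd => r tr ru rd.
have r0 : 0 <= r by rewrite (le_trans t0)// ltW.
split => //=; have h : `|G r w - G t w| < G t w - p.
  apply: H; rewrite ?r0 ?t0 ?(ltW ru) ?(ltW tu)//.
  by rewrite ger0_norm ?subr_ge0 ?(ltW tr)// ltrBlDl.
by move: h; rewrite ltr_norml => /andP[]; lra.
Qed.

Lemma lt_hitting p t w : 0 <= t -> (t%:E < hitting p w)%E -> G t w <= p.
Proof.
move=> t0; rewrite ltNge => /negP h; rewrite leNgt; apply/negP => pG; apply: h.
by apply: ge_ereal_inf; exists t%:E => //; exists t.
Qed.

(** The bound holds strictly before the hitting time and extends to it from the left. Time 0 has no
    left neighbourhood and [G 0 w] may exceed [p]; where the lemma is applied, the process is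
    measured from its initial value, so time 0 is trivial. *)
Lemma le_hitting p t w : 0 < t -> (t%:E <= hitting p w)%E -> G t w <= p.
Proof.
move=> t0 th; apply/ler_addgt0Pr => e e0.
have [dl dl0 H] := cG w t e0.
pose r := Num.max (t / 2) (t - dl / 2).
have r0 : 0 <= r by rewrite /r le_max divr_ge0 ?(ltW t0).
have rt : r < t by rewrite /r gt_max; apply/andP; split; lra.
have rd : t - dl / 2 <= r by rewrite /r le_max lexx orbT.
have h1 : G r w <= p by apply: lt_hitting => //; apply: lt_le_trans th; rewrite lte_fin.
have : `|G t w - G r w| < e.
  apply: H; rewrite ?r0 ?(ltW t0) ?(ltW rt) ?lexx//.
  by rewrite ger0_norm ?subr_ge0 ?(ltW rt)//; lra.
by rewrite ltr_norml => /andP[]; lra.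
Qed.

Lemma hitting_le p q w : p <= q -> (hitting p w <= hitting q w)%E.
Proof.
move=> pq; apply: ereal_inf_le_tmp => _ [t [t0 /= qG] <-]; exists t => //.
by split => //=; exact: le_lt_trans qG.
Qed.

Lemma hitting_large w (t : R) : exists N, forall n, (N <= n)%N -> (t%:E < hitting n%:R w)%E.
Proof.
have [c c0 H] := ucont_bounded (t + 1) (cG w).
exists (Num.bound c) => n Nn; apply: (@lt_le_trans _ _ (t + 1)%:E).
  by rewrite lte_fin ltrDl.
apply/ereal_infP => _ [r [r0 /= nG] <-]; rewrite lee_fin leNgt; apply/negP => rt.
move: nG; rewrite ltNge => /negP; apply; apply: (le_trans (ler_norm _)).
apply: (le_trans (H r _)); first by rewrite r0 ltW.
by rewrite (le_trans (ltW (archi_boundP (ltW c0))))// ler_nat.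
Qed.

End Hitting.

(** Stopping at [rho] and then at [kap] is stopping at their minimum, so a localizing time may be
    shortened to gain boundedness. *)
Lemma stopped_local N (rho kap : T -> \bar R) : adapted F N -> (forall w, ucont (fun t => N t w)) ->
  stopping_time F rho -> stopping_time F kap ->
  martingale P F (fun t w => stopped_process N rho t w - N 0 w) ->
  martingale P F (fun t w => stopped_process N (fun w => mine (rho w) (kap w)) t w - N 0 w).
Proof.
move=> aN cN srho skap MU.
have c w : ucont (fun t => stopped_process N rho t w - N 0 w).
  by apply: ucontB; [apply: ucont_stopped => //; case: srho|exact: ucont_cst].
have := martingale_stopped filtF skap MU c.
congr (martingale P F _); apply/funext => t; apply/funext => w.
rewrite /stopped_process; congr (N _ w - _).
have [r0 _] := srho; have [k0 _] := skap.
move: (r0 w) (k0 w); case: (rho w) => [r| |]//; case: (kap w) => [k| |]// _ _;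
  rewrite -?EFin_min/= ?miney ?minye -?EFin_min//=.
by rewrite minA.
Qed.

Lemma ae_eventually_lt (rho : nat -> T -> \bar R) (t : R) :
  {ae P, forall w, rho n w @[n --> \oo] --> +oo%E} ->
  {ae P, forall w, exists N, forall n, (N <= n)%N -> (t%:E < rho n w)%E}.
Proof.
apply: filterS => w /cvgeyPgt /(_ t) [N _ HN].
by exists N.
Qed.

End Localization.

(** * Sums with small deterministic coefficients *)

Section UniformlySmall.
Context {d : measure_display} {T : measurableType d} {R : realType}.
Variables (P : probability T R) (F : R -> set (set T)).
Hypothesis filtF : filtration F.
Hypothesis rcF : right_continuous_filtration F.
Local Notation mean := (mean P).
Local Notation intg := (intg P).
Local Notation pr := (pr P).

Variables (X N A : R -> T -> R).
Hypothesis X_dec : forall (t : R) w, 0 <= t -> X t w = X 0 w + N t w + A t w.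
Hypothesis LN : local_martingale P F N.
Hypothesis cN : forall w, ucont (fun t => N t w).
Hypothesis aA : adapted F A.
Hypothesis vA : forall w, exists W : R -> R, forall a b : R, 0 <= a -> a <= b ->
  `|A b w - A a w| <= W b - W a.

(* Uniformity in the non-random coefficients [c] is what later allows them to be
   replaced by the increments of an independent process. *)
Lemma semimartingale_sum_small (s t lam e : R) : 0 <= s -> s <= t -> 0 < lam -> 0 < e ->
  exists2 dl : R, 0 < dl & forall n (c : nat -> R), (forall k, `|c k| <= dl) ->
    pr [set w | exists2 j, (j <= n.+1)%N & lam <
      `|\sum_(k < j) c k * (X (grid s t n k.+1) w - X (grid s t n k) w)| ] <= e.
Proof.
move=> s0 st lam0 e0; have t0 := le_trans s0 st.
have gt0 n k : 0 <= grid s t n k by exact: grid_ge0.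
have mA r : 0 <= r -> measurable_fun setT (A r).
  by move=> r0; apply: (gmeas_measurable (filt_meas filtF r0)) => B mB; exact: aA.
have aN : adapted F N by case: LN.
have mN r : 0 <= r -> measurable_fun setT (N r).
  by move=> r0; apply: (gmeas_measurable (filt_meas filtF r0)) => B mB; exact: aN.
pose G r w := `|N r w - N 0 w|.
have aG : adapted F G.
  move=> r r0; apply: (gmeas_norm (filtS filtF r0)); apply: (gmeasB (filtS filtF r0)).
    by move=> B mB; exact: aN.
  by move=> B mB; apply: (filt_le filtF (lexx 0) r0); exact: aN.
have cG w : ucont (fun r => G r w).
  by apply: ucont_norm; apply: ucontB => //; exact: ucont_cst.
have [_ [rho [srho rho_nd rho_cvg rhoM]]] := LN.
(* [rho] makes the stopped [N] a martingale, the hitting time makes it bounded by [p]. Both exceed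
   [t] for large [p], almost surely. *)
pose tau p w := mine (rho p w) (hitting G p%:R w).
have shit p : stopping_time F (hitting G p%:R) by exact: hitting_stopping.
have stau p : stopping_time F (tau p) by exact: stopping_time_min.
pose U p t w := stopped_process N (tau p) t w - N 0 w.
have MU p : martingale P F (U p) by exact: stopped_local.
have Ub p r w : 0 <= r -> `|U p r w| <= p%:R.
  move=> r0; rewrite /U stopped_processE; set q := stop _ _ _.
  have tau0 : (0 <= tau p w)%E by case: (stau p).
  have q0 : 0 <= q by exact: stop_ge0.
  have [q1|q1] := leP q 0.
    by rewrite (_ : q = 0) ?subrr ?normr0//; apply/eqP; rewrite eq_le q1.
  apply: (@le_hitting _ _ _ G cG p%:R q w q1).
  have : (q%:E <= tau p w)%E.
    exact: stop_le_tau.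
  by rewrite /tau le_min => /andP[].
have lateE p w (k n : nat) : (t%:E < tau p w)%E -> (k <= n.+1)%N ->
    U p (grid s t n k) w = N (grid s t n k) w - N 0 w.
  move=> tp kn; rewrite /U stopped_processE stop_gt//; first by case: (stau p).
  by apply: le_lt_trans tp; rewrite lee_fin grid_le_end.
pose Q n w := \sum_(k < n.+1) `|A (grid s t n k.+1) w - A (grid s t n k) w|.
have mQ n : measurable_fun setT (Q n).
  apply: measurable_sum => k; apply: measurableT_comp => //.
  by apply: measurable_funB; exact: mA.
have e3 : 0 < e / 3 by rewrite divr_gt0.
have [p Hp] : exists p, pr [set w | (tau p w <= t%:E)%E] <= e / 3.
  have [||n Hn] := @pr_cvg0 _ _ _ P (fun p => [set w | (tau p w <= t%:E)%E]) _ _ _ e3.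
  - by move=> p; apply: (filt_meas filtF t0); case: (stau p) => _; exact.
  - move: (ae_eventually_lt t rho_cvg); apply: filterS => w [n1 H1].
    have [n2 H2] := hitting_large cG w t.
    exists (maxn n1 n2) => n; rewrite geq_max => /andP[h1 h2] /=.
    by apply/negP; rewrite -ltNge lt_min H1// H2.
  by exists n; exact: Hn.
(* The variation [Q n w] of [A] on the grid is at most [W t - W s] for every [n], so one [q] serves
   all grids. As [p] and [q] are fixed before [dl], the latter depends on neither the grid nor the
   coefficients. *)
have [q Hq] : exists q : nat, pr [set w | exists n, q%:R < Q n w] <= e / 3.
  have [||n Hn] := @pr_cvg0 _ _ _ P (fun q : nat => [set w | exists n, q%:R < Q n w]) _ _ _ e3.
  - move=> q; rewrite (_ : [set w | _] = \bigcup_n [set w | q%:R < Q n w]).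
      by apply: bigcupT_measurable => n; exact: measurable_gt.
    by apply/seteqP; split => w /= [n]; [exists n|exists n].
  - apply: aeW => w; have [W HW] := vA w.
    exists (Num.bound `|W t - W s|) => n Nn [k]; apply/negP; rewrite -leNgt.
    apply: (@le_trans _ _ (W t - W s)).
      rewrite -[X in W X - _](gridn s t k) -[X in _ - W X](grid0 s t k).
      rewrite -(telescope_ord (fun j => W (grid s t k j))).
      by apply: ler_sum => j _; apply: HW => //; exact: grid_le.
    apply: (le_trans (ler_norm _)); rewrite (le_trans (ltW (archi_boundP _)))//.
    by rewrite ler_nat.
  by exists n; exact: Hn.
(* The first bound gives [dl * q.+1 <= lam / 2], for the drift. The other two serve the maximal
   inequality at level [lam / 2]: [dl <= 1] gives [dl ^+ 2 <= dl], and the last bound makes the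
   result at most [e / 3]. The successors avoid division by 0. *)
pose dl := Num.min (lam / 2 / q.+1%:R) (Num.min 1 (e / 3 * (lam / 2) ^+ 2 / p.+1%:R ^+ 2)).
have dl0 : 0 < dl.
  rewrite !lt_min ltr01/=; apply/andP; split; first by rewrite !divr_gt0.
  by rewrite divr_gt0 ?mulr_gt0 ?exprn_gt0// divr_gt0.
exists dl => // n c cdl.
pose g := grid s t n.
pose E2 := [set w | exists2 j, (j <= n.+1)%N &
   lam / 2 < `|transform (U p) g (fun k _ => c k) j w|].
have mU k : measurable_fun setT (U p (g k)).
  have [aU _ _] := MU p.
  by apply: (gmeas_measurable (filt_meas filtF (gt0 n k))) => B mB; exact: aU.
have mE2 : measurable E2.
  apply: (@measurable_exists_le _ _ (fun j => [set w | lam / 2 < `|transform (U p) g (fun k _ => c k) j w|])).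
  move=> j; apply: measurable_gt; apply: measurableT_comp => //.
  by apply: measurable_sum => k; apply: measurable_funM => //; exact: measurable_funB.
have HE2 : pr E2 <= e / 3.
  apply: (le_trans (@transform_maximal _ _ _ P F filtF (U p) g p%:R (MU p) _ _ _ c dl (lam / 2) cdl _ n.+1)).
  - exact: grid_ge0.
  - by move=> k; exact: grid_le.
  - by move=> k w; apply: Ub; exact: gt0.
  - by rewrite divr_gt0.
  rewrite ler_pdivrMr ?exprn_gt0 ?divr_gt0//.
  have h1 : dl <= 1 by rewrite /dl !ge_min lexx !orbT.
  have h2 : dl <= e / 3 * (lam / 2) ^+ 2 / p.+1%:R ^+ 2 by rewrite /dl !ge_min lexx !orbT.
  apply: (@le_trans _ _ (dl * p.+1%:R ^+ 2)).
    apply: ler_pM; rewrite ?sqr_ge0//.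
      by rewrite expr2 ler_piMr// ltW.
    by rewrite ler_sqr ?nnegrE// ler_nat.
  by rewrite -ler_pdivlMr// exprn_gt0.
pose E1 := [set w | (tau p w <= t%:E)%E].
pose E3 := [set w | exists n, q%:R < Q n w].
have mE1 : measurable E1 by apply: (filt_meas filtF t0); case: (stau p) => _; exact.
have mE3 : measurable E3.
  rewrite /E3 (_ : [set w | _] = \bigcup_n [set w | q%:R < Q n w]).
    by apply: bigcupT_measurable => j; exact: measurable_gt.
  by apply/seteqP; split => w /= [j]; [exists j|exists j].
have mX k : measurable_fun setT (fun w => X (grid s t n k.+1) w - X (grid s t n k) w).
  rewrite (_ : (fun w => _) = fun w => (N (grid s t n k.+1) w - N (grid s t n k) w) +
    (A (grid s t n k.+1) w - A (grid s t n k) w)).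
    by apply: measurable_funD; apply: measurable_funB; (exact: mN || exact: mA).
  by apply/funext => w; rewrite (X_dec w (gt0 n k.+1)) (X_dec w (gt0 n k)); ring.
(* Three exceptional events, each of probability at most [e / 3]: [tau p] not beyond [t], a large
   transform, a large variation. Off them, martingale and drift contribute at most [lam / 2]
   each. *)
apply: (@le_trans _ _ (pr (E1 `|` E2 `|` E3))).
  apply: pr_le.
  - apply: (@measurable_exists_le _ _ (fun j => [set w | lam <
      `|\sum_(k < j) c k * (X (grid s t n k.+1) w - X (grid s t n k) w)|])).
    move=> j; apply: measurable_gt; apply: measurableT_comp => //.
    by apply: measurable_sum => k; apply: measurable_funM => //; exact: mX.
  - by apply: measurableU => //; exact: measurableU.
  move=> w [j jn hj]; apply: contrapT => /not_orP[/not_orP[n1 n2] n3].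
  have tp : (t%:E < tau p w)%E by rewrite ltNge; apply/negP.
  have a2 : `|transform (U p) g (fun k _ => c k) j w| <= lam / 2.
    by rewrite leNgt; apply/negP => h; apply: n2; exists j.
  have a3 : Q n w <= q%:R by rewrite leNgt; apply/negP => h; apply: n3; exists n.
  move: hj; rewrite ltNge => /negP; apply.
  rewrite (_ : \sum_(k < j) _ = transform (U p) g (fun k _ => c k) j w +
    \sum_(k < j) c k * (A (g k.+1) w - A (g k) w)); last first.
    rewrite /transform -big_split/=; apply: eq_bigr => k _.
    have kn : (k < n.+1)%N by exact: leq_trans (ltn_ord k) jn.
    rewrite (X_dec w (gt0 n k.+1)) (X_dec w (gt0 n k)).
    by rewrite !(lateE p w _ n tp) ?(ltnW kn)//; ring.
  have a4 : `|\sum_(k < j) c k * (A (g k.+1) w - A (g k) w)| <= lam / 2.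
    apply: (le_trans (ler_norm_sum _ _ _)).
    apply: (@le_trans _ _ (dl * \sum_(k < j) `|A (g k.+1) w - A (g k) w|)).
      by rewrite mulr_sumr; apply: ler_sum => k _; rewrite normrM ler_wpM2r.
    apply: (@le_trans _ _ (dl * Q n w)).
      rewrite ler_wpM2l ?(ltW dl0)// /Q.
      rewrite -!(big_mkord predT (fun k => `|A (g k.+1) w - A (g k) w|)).
      rewrite (@big_cat_nat _ _ _ j 0 n.+1)//= lerDl.
      by apply: sumr_ge0 => k _.
    apply: (@le_trans _ _ (dl * q.+1%:R)).
      by rewrite ler_wpM2l ?(ltW dl0)// (le_trans a3)// ler_nat.
    by rewrite -ler_pdivlMr// /dl ge_min lexx.
  by apply: (le_trans (ler_normD _ _)); lra.
apply: (le_trans (pr_leU _ _ _)) => //; first exact: measurableU.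
have := pr_leU P mE1 mE2; rewrite -/E1 -/E3 in Hp Hq *; lra.
Qed.

End UniformlySmall.

(** * Independence and Fubini *)

Section Independence.
Context {d : measure_display} {T : measurableType d} {R : realType}.
Variables (P : probability T R) (G1 G2 : set (set T)).
Hypothesis sG1 : sigma_algebra setT G1.
Hypothesis sG2 : sigma_algebra setT G2.
Hypothesis G1m : G1 `<=` measurable.
Hypothesis G2m : G2 `<=` measurable.
Hypothesis indep : forall A B, G1 A -> G2 B -> P (A `&` B) = (P A * P B)%E.
Local Notation pr := (pr P).
Local Notation T1 := (g_sigma_algebraType G1).
Local Notation T2 := (g_sigma_algebraType G2).

(** The diagonal map sends [T] into [T1 * T2], the same set with two sigma-algebras. The preimage of
    a rectangle is an intersection, so independence says that the image of [P] is a product measure,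
    and the bound on sections is integrated over the first coordinate. *)
Lemma indep_section_le (D : set (T1 * T2)) (e : R) : measurable D ->
  (forall w', pr [set w | D (w', w)] <= e) -> pr [set w | D (w, w)] <= e.
Proof.
move=> mD De.
have m1 : measurable_fun setT (id : T -> T1).
  move=> _ A mA; rewrite setTI; apply: G1m.
  by rewrite -(measurable_g_measurableTypeE sG1).
have m2 : measurable_fun setT (id : T -> T2).
  move=> _ A mA; rewrite setTI; apply: G2m.
  by rewrite -(measurable_g_measurableTypeE sG2).
have m12 : measurable_fun setT ((fun w => (w, w)) : T -> T1 * T2).
  exact: measurable_fun_pair.
pose X1 : {mfun T >-> T1} := HB.pack (id : T -> T1) (isMeasurableFun.Build _ _ _ _ _ m1).
pose X2 : {mfun T >-> T2} := HB.pack (id : T -> T2) (isMeasurableFun.Build _ _ _ _ _ m2).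
pose X12 : {mfun T >-> (T1 * T2)%type} :=
  HB.pack ((fun w => (w, w)) : T -> T1 * T2) (isMeasurableFun.Build _ _ _ _ _ m12).
have E : (distribution P X1 \x distribution P X2)%E D = distribution P X12 D.
  apply: product_measure_unique => // A B mA mB.
  apply: (@indep A B).
    by rewrite -(measurable_g_measurableTypeE sG1).
  by rewrite -(measurable_g_measurableTypeE sG2).
have mdiag : measurable [set w : T | D (w, w)].
  by have := m12 measurableT D mD; rewrite setTI.
have mx (w' : T1) : measurable [set w : T | D (w', w)].
  have := measurable_xsection w' mD.
  move=> h; have := m2 measurableT _ h; rewrite setTI.
  congr measurable; apply/seteqP; split => w /=; by rewrite /xsection/= in_setE.
rewrite -lee_fin -P_pr//.
have -> : P [set w : T | D (w, w)] = distribution P X12 D by [].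
rewrite -E /product_measure1.
apply: (@le_trans _ _ (\int[distribution P X1]_x e%:E)%E).
  apply: ge0_le_integral => //.
  - exact: measurable_fun_xsection.
  - move=> x _ /=; rewrite /distribution /pushforward/= (_ : _ @^-1` _ = [set w | D (x, w)]).
      by rewrite P_pr// lee_fin.
    by apply/seteqP; split => w /=; rewrite /xsection/= in_setE.
rewrite integral_cst// -[leRHS]mule1 lee_wpmul2l//.
  by rewrite lee_fin (le_trans _ (De point))// pr_ge0.
exact: probability_le1.
Qed.

End Independence.

(** * The bracket of two independent processes *)

Section Bracket.
Context {d : measure_display} {T : measurableType d} {R : realType}.
Variables (P : probability T R) (F : R -> set (set T)).
Hypothesis filtF : filtration F.
Hypothesis rcF : right_continuous_filtration F.
Variables (G1 G2 : set (set T)).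
Hypothesis sG1 : sigma_algebra setT G1.
Hypothesis sG2 : sigma_algebra setT G2.
Hypothesis G1m : G1 `<=` measurable.
Hypothesis G2m : G2 `<=` measurable.
Hypothesis indep : forall A B, G1 A -> G2 B -> P (A `&` B) = (P A * P B)%E.
Local Notation pr := (pr P).
Local Notation T1 := (g_sigma_algebraType G1).
Local Notation T2 := (g_sigma_algebraType G2).

Variables (S X N A : R -> T -> R).
Hypothesis X_dec : forall (t : R) w, 0 <= t -> X t w = X 0 w + N t w + A t w.
Hypothesis LN : local_martingale P F N.
Hypothesis cN : forall w, ucont (fun t => N t w).
Hypothesis aA : adapted F A.
Hypothesis vA : forall w, exists W : R -> R, forall a b : R, 0 <= a -> a <= b ->
  `|A b w - A a w| <= W b - W a.
Hypothesis cS : forall w, ucont (fun t => S t w).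
Hypothesis GS : forall t, 0 <= t -> gmeas G1 (S t).
Hypothesis GX : forall t, 0 <= t -> gmeas G2 (X t).

(* Conditionally on the path of [S], the bracket sum integrates a small
   non-random step function against the semimartingale [X]. *)
Lemma indep_bracket_small (s t lam e : R) : 0 <= s -> s <= t -> 0 < lam -> 0 < e ->
  exists M, forall n, (M <= n)%N ->
    pr [set w | exists2 j, (j <= n.+1)%N & lam <
      `|\sum_(k < j) (S (grid s t n k.+1) w - S (grid s t n k) w) *
        (X (grid s t n k.+1) w - X (grid s t n k) w)| ] <= e.
Proof.
move=> s0 st lam0 e0; have t0 := le_trans s0 st.
have gt0 n k : 0 <= grid s t n k by exact: grid_ge0.
have e2 : 0 < e / 2 by rewrite divr_gt0.
have [dl dl0 Hdl] := semimartingale_sum_small filtF rcF X_dec LN cN aA vA s0 st lam0 e2.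
pose dS n k w := S (grid s t n k.+1) w - S (grid s t n k) w.
pose dX n k w := X (grid s t n k.+1) w - X (grid s t n k) w.
have GdS n k : gmeas G1 (dS n k) by apply: (gmeasB sG1); exact: GS.
have GdX n k : gmeas G2 (dX n k) by apply: (gmeasB sG2); exact: GX.
have mdS n k := gmeas_measurable G1m (GdS n k).
have mdX n k := gmeas_measurable G2m (GdX n k).
(* The event that some increment of [S] is too large for the uniform estimate; uniform continuity of
   paths makes its probability vanish with the mesh. *)
pose O n := [set w | exists2 k, (k <= n)%N & dl < `|dS n k w|].
have mO n : measurable (O n).
  apply: (@measurable_exists_le _ _ (fun k => [set w | dl < `|dS n k w|])) => k.
  by apply: measurable_gt; exact: measurableT_comp.
have [|M HM] := @pr_cvg0 _ _ _ P O mO _ _ e2.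
  apply: aeW => w; have [M HM] := ucont_grid (cS w) s0 st dl0.
  exists M => n Mn [k kn] /=; apply/negP; rewrite -leNgt; apply/ltW.
  have := HM n Mn k kn t t0.
  have kn' : (k.+1 <= n.+1)%N by [].
  by rewrite (min_idPr (grid_le_end st kn')) (min_idPr (grid_le_end st (ltnW kn'))).
exists M => n Mn.
(* Increments larger than [dl] are replaced by 0, so that the uniform estimate applies to every
   frozen path [w']. Off [O n] nothing is changed. *)
pose phi (x : R) : R := \1_[set y : R | `|y| <= dl] x * x.
have mphi : measurable_fun setT phi.
  apply: measurable_funM => //; apply: measurable_indic.
  rewrite (_ : [set y : R | _] = `[- dl, dl]%classic)//.
  by apply/seteqP; split => y /=; rewrite in_itv/= ler_norml.
have phidl x : `|phi x| <= dl.
  rewrite /phi indicE; have [h|h] := boolP (`|x| <= dl).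
    by rewrite mem_set// mul1r.
  by rewrite memNset ?mul0r ?normr0 ?ltW//; exact/negP.
have phiE x : `|x| <= dl -> phi x = x.
  by move=> h; rewrite /phi indicE mem_set// mul1r.
pose D : set (T1 * T2) := [set z | exists2 j, (j <= n.+1)%N & lam <
   `|\sum_(k < j) phi (dS n k z.1) * dX n k z.2| ].
have mD : measurable D.
  apply: (@measurable_exists_le _ (T1 * T2)%type (fun j => [set z : T1 * T2 | lam <
   `|\sum_(k < j) phi (dS n k z.1) * dX n k z.2| ])) => j.
  apply: measurable_gt; apply: measurableT_comp => //.
  apply: measurable_sum => k; apply: measurable_funM.
    have := GdS n k; rewrite (gmeasP sG1) => h.
    by apply: measurableT_comp => //; exact: (measurableT_comp h).
  have := GdX n k; rewrite (gmeasP sG2) => h.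
  exact: (measurableT_comp h).
have HD : pr [set w | D (w, w)] <= e / 2.
  apply: (indep_section_le sG1 sG2 G1m G2m indep mD) => w'.
  exact: (Hdl n (fun k => phi (dS n k w')) (fun k => phidl _)).
have mE : measurable [set w | exists2 j, (j <= n.+1)%N & lam <
      `|\sum_(k < j) dS n k w * dX n k w| ].
  apply: (@measurable_exists_le _ _ (fun j => [set w | lam < `|\sum_(k < j) dS n k w * dX n k w| ])) => j.
  apply: measurable_gt; apply: measurableT_comp => //.
  by apply: measurable_sum => k; exact: measurable_funM.
have mDD : measurable [set w : T | D (w, w)].
  apply: (@measurable_exists_le _ _ (fun j => [set w : T | lam < `|\sum_(k < j) phi (dS n k w) * dX n k w| ])) => j.
  apply: measurable_gt; apply: measurableT_comp => //.
  apply: measurable_sum => k; apply: measurable_funM => //.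
  exact: measurableT_comp.
apply: (@le_trans _ _ (pr (O n `|` [set w | D (w, w)]))).
  apply: pr_le => //; first exact: measurableU.
  move=> w [j jn hj]; apply: contrapT => /not_orP[nO nD]; apply: nD.
  exists j => //=; rewrite (eq_bigr (fun k : 'I_j => dS n k w * dX n k w))// => k _.
  rewrite phiE// leNgt; apply/negP => h; apply: nO; exists k => //.
  by rewrite -ltnS; exact: leq_trans (ltn_ord k) jn.
apply: (le_trans (pr_leU P (mO n) mDD)).
have := HM n Mn; lra.
Qed.

End Bracket.

(** * Integration by parts *)

Section StieltjesLike.
Context {R : realType}.

(* [I] is the integral of [S] against [A], and [W] is the variation of [A]. *)
Definition stieltjes_like (S A I : R -> R) : Prop :=
  exists W : R -> R, forall a b c e : R, 0 <= a -> a <= b ->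
    (forall x : R, a < x <= b -> `|S x - c| <= e) ->
    `|I b - I a - c * (A b - A a)| <= e * (W b - W a).

(** [I b - I a] is compared with [S a * (A b - A a)]: the error is small by continuity of [S] and
    finiteness of [W], the product by continuity of [A] and boundedness of [S]. *)
Lemma ucont_stieltjes_like (S A I : R -> R) : ucont S -> ucont A ->
  stieltjes_like S A I -> ucont I.
Proof.
move=> cS cA [W HW] T e e0.
(* Taking [c = 0] and a positive bound for [S], the right side of the estimate dominates an absolute
   value, which forces [W] to be nondecreasing. *)
have W_nd a b : 0 <= a -> a <= b -> W a <= W b.
  move=> a0 ab; have [c c0 Sb] := ucont_bounded b cS.
  have := HW a b 0 c a0 ab.
  have h x : a < x <= b -> `|S x - 0| <= c.
    move=> /andP[ax xb]; rewrite subr0; apply: Sb; rewrite xb andbT.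
    by rewrite (le_trans a0)// ltW.
  move=> /(_ h) /(le_trans (normr_ge0 _)).
  by rewrite pmulr_rge0// subr_ge0.
have [T0|T0] := leP 0 T; last first.
  exists 1 => // a b /andP[a0 aT].
  by move: T0; rewrite ltNge (le_trans a0 aT).
have [c c0 Sb] := ucont_bounded T cS.
have w0 : 0 < W T - W 0 + 1 by rewrite ltr_wpDl// subr_ge0 W_nd.
have e1 : 0 < e / 2 / (W T - W 0 + 1) by rewrite !divr_gt0.
have e2 : 0 < e / 2 / c by rewrite !divr_gt0.
have [d1 d10 H1] := cS T _ e1.
have [d2 d20 H2] := cA T _ e2.
exists (Num.min d1 d2); first by rewrite lt_min d10.
have key a b : 0 <= a <= T -> 0 <= b <= T -> `|a - b| < Num.min d1 d2 -> a <= b ->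
    `|I b - I a| < e.
  move=> aT bT; rewrite lt_min => /andP[ab1 ab2] ab.
  have /andP[a0 aT'] := aT; have /andP[b0 bT'] := bT.
  have h : forall x, a < x <= b -> `|S x - S a| <= e / 2 / (W T - W 0 + 1).
    move=> x /andP[ax xb]; apply/ltW/H1 => //.
      by rewrite (le_trans a0 (ltW ax)) (le_trans xb).
    apply: le_lt_trans ab1; rewrite [leRHS]distrC !ger0_norm ?subr_ge0 ?(ltW ax)//.
    by rewrite lerD2r.
  have h1 := HW a b (S a) _ a0 ab h.
  have h2 : e / 2 / (W T - W 0 + 1) * (W b - W a) < e / 2.
    rewrite -mulrA gtr_pMr ?divr_gt0// mulrC ltr_pdivrMr// mul1r.
    have := W_nd _ _ (lexx 0) a0; have := W_nd _ _ b0 bT'; lra.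
  have h3 : `|S a * (A b - A a)| <= e / 2.
    rewrite normrM; apply: (@le_trans _ _ (c * (e / 2 / c))).
      apply: ler_pM => //; first exact: Sb.
      by rewrite distrC; apply/ltW/H2.
    by rewrite mulrC divfK// gt_eqF.
  rewrite (_ : I b - I a = (I b - I a - S a * (A b - A a)) + S a * (A b - A a)); last by ring.
  apply: (le_lt_trans (ler_normD _ _)); lra.
move=> a b aT bT ab; have [le_ab|lt_ba] := leP a b.
  by rewrite distrC key.
by apply: key => //; [rewrite distrC|exact: ltW].
Qed.

End StieltjesLike.

Section AdaptedIntegral.
Context {d : measure_display} {T : measurableType d} {R : realType}.
Variables (F : R -> set (set T)).
Hypothesis filtF : filtration F.

(** At time [t] the integral is a pointwise limit of Riemann sums that involve [S] and [A] only up
    to [t]. *)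
Lemma adapted_stieltjes_like (S A I : R -> T -> R) : adapted F S -> adapted F A ->
  (forall w, ucont (fun t => S t w)) -> (forall w, I 0 w = 0) ->
  (forall w, stieltjes_like (fun t => S t w) (fun t => A t w) (fun t => I t w)) ->
  adapted F I.
Proof.
move=> aS aA cS I0 HI t t0; have sF := filtS filtF t0.
pose m n k : R := Num.min t (grid 0 t n k).
have m0 n k : 0 <= m n k by rewrite le_min t0 grid_ge0.
have mt n k : m n k <= t by rewrite ge_min lexx.
apply: (@gmeas_cvg _ _ _ _ sF (fun n w => \sum_(k < n.+1)
   S (m n k) w * (A (m n k.+1) w - A (m n k) w))) => [n|w].
  apply: (@gmeas_sum _ _ _ _ sF n.+1 (fun k w => S (m n k) w * (A (m n k.+1) w - A (m n k) w))) => k kn.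
  apply: (gmeasM sF).
    by move=> B mB; apply: (filt_le filtF (m0 n k) (mt n k)); exact: aS.
  apply: (gmeasB sF).
    by move=> B mB; apply: (filt_le filtF (m0 n k.+1) (mt n k.+1)); exact: aA.
  by move=> B mB; apply: (filt_le filtF (m0 n k) (mt n k)); exact: aA.
apply/cvgrPdist_le => e e0; have [W HW] := HI w.
have [N HN] := riemann_stieltjes_grid (cS w) (lexx 0) t0 t0 e0 HW.
exists N => // n Nn; have := HN n Nn.
by rewrite minxx (min_idPr t0) I0 subr0 distrC.
Qed.

End AdaptedIntegral.

(** * Integration by parts for two independent factors *)

Section ProductRule.
Context {d : measure_display} {T : measurableType d} {R : realType}.
Variables (P : probability T R) (F : R -> set (set T)).
Hypothesis filtF : filtration F.
Hypothesis rcF : right_continuous_filtration F.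
Variables (G1 G2 : set (set T)).
Hypothesis sG1 : sigma_algebra setT G1.
Hypothesis sG2 : sigma_algebra setT G2.
Hypothesis G1m : G1 `<=` measurable.
Hypothesis G2m : G2 `<=` measurable.
Hypothesis indep : forall A B, G1 A -> G2 B -> P (A `&` B) = (P A * P B)%E.
Local Notation mean := (mean P).
Local Notation intg := (intg P).
Local Notation pr := (pr P).

Variables (S NS AS X NX AX I1 I2 : R -> T -> R).
Hypothesis S_dec : forall (t : R) w, 0 <= t -> S t w = S 0 w + NS t w + AS t w.
Hypothesis X_dec : forall (t : R) w, 0 <= t -> X t w = X 0 w + NX t w + AX t w.
Hypothesis LNS : local_martingale P F NS.
Hypothesis LNX : local_martingale P F NX.
Hypothesis cNS : forall w, ucont (fun t => NS t w).
Hypothesis cNX : forall w, ucont (fun t => NX t w).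
Hypothesis cS : forall w, ucont (fun t => S t w).
Hypothesis cX : forall w, ucont (fun t => X t w).
Hypothesis aS : adapted F S.
Hypothesis aX : adapted F X.
Hypothesis vAX : forall w, exists W : R -> R, forall a b : R, 0 <= a -> a <= b ->
  `|AX b w - AX a w| <= W b - W a.
Hypothesis HI1 : forall w,
  stieltjes_like (fun t => S t w) (fun t => AX t w) (fun t => I1 t w).
Hypothesis HI2 : forall w,
  stieltjes_like (fun t => X t w) (fun t => AS t w) (fun t => I2 t w).
Hypothesis I10 : forall w, I1 0 w = 0.
Hypothesis I20 : forall w, I2 0 w = 0.
Hypothesis GS : forall t, 0 <= t -> gmeas G1 (S t).
Hypothesis GX : forall t, 0 <= t -> gmeas G2 (X t).

Let aNS : adapted F NS. Proof. by case: LNS. Qed.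
Let aNX : adapted F NX. Proof. by case: LNX. Qed.

Let adapted_fv (Z N A : R -> T -> R) :
  (forall (t : R) w, 0 <= t -> Z t w = Z 0 w + N t w + A t w) ->
  adapted F Z -> adapted F N -> adapted F A.
Proof.
move=> dec aZ aN t t0; have sF := filtS filtF t0.
rewrite (_ : A t = fun w => Z t w - Z 0 w - N t w); last first.
  by apply/funext => w; rewrite (dec t w t0); ring.
apply: (gmeasB sF); last by move=> B mB; exact: aN.
apply: (gmeasB sF); first by move=> B mB; exact: aZ.
by move=> B mB; apply: (filt_le filtF (lexx 0) t0); exact: aZ.
Qed.

Let ucont_fv (Z N A : R -> T -> R) w :
  (forall (t : R) w, 0 <= t -> Z t w = Z 0 w + N t w + A t w) ->
  ucont (fun t => Z t w) -> ucont (fun t => N t w) -> ucont (fun t => A t w).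
Proof.
move=> dec cZ cN.
apply: (@ucont_ext _ (fun t => Z t w - Z 0 w - N t w)) => [t t0|].
  by rewrite (dec t w t0); ring.
by apply: ucontB => //; apply: ucontB => //; exact: ucont_cst.
Qed.

Let aAS : adapted F AS := adapted_fv S_dec aS aNS.
Let aAX : adapted F AX := adapted_fv X_dec aX aNX.

(** It plays the role of [int S dNX + int X dNS]. No stochastic integral is constructed; the process
    is defined by what the product rule leaves over and shown to be a limit of grid transforms. *)
Definition ibp_martingale (t : R) (w : T) : R :=
  S t w * X t w - S 0 w * X 0 w - I1 t w - I2 t w.
Local Notation L := ibp_martingale.

Lemma adapted_ibp : adapted F L.
Proof.
have aI1 : adapted F I1 := adapted_stieltjes_like filtF aS aAX cS I10 HI1.
have aI2 : adapted F I2 := adapted_stieltjes_like filtF aX aAS cX I20 HI2.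
move=> t t0; have sF := filtS filtF t0.
have f0 := filt_le filtF (lexx 0) t0.
apply: (gmeasB sF); last by move=> B mB; exact: aI2.
apply: (gmeasB sF); last by move=> B mB; exact: aI1.
apply: (gmeasB sF); apply: (gmeasM sF); move=> B mB.
- exact: aS.
- exact: aX.
- by apply: f0; exact: aS.
- by apply: f0; exact: aX.
Qed.

Lemma ucont_ibp w : ucont (fun t => L t w).
Proof.
apply: ucontB.
  apply: ucontB.
    by apply: ucontB; [exact: ucontM|exact: ucont_cst].
  exact: (ucont_stieltjes_like (cS w) (ucont_fv X_dec (cX w) (cNX w)) (HI1 w)).
exact: (ucont_stieltjes_like (cX w) (ucont_fv S_dec (cS w) (cNS w)) (HI2 w)).
Qed.

Section Localized.
Variables (tau : T -> \bar R) (p : R).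
Hypothesis stau : stopping_time F tau.
Hypothesis p0 : 0 <= p.
Hypothesis Sp : forall (t : R) w, 0 <= t -> (t%:E < tau w)%E -> `|S t w| <= p.
Hypothesis Xp : forall (t : R) w, 0 <= t -> (t%:E < tau w)%E -> `|X t w| <= p.
Let US t w := stopped_process NS tau t w - NS 0 w.
Let UX t w := stopped_process NX tau t w - NX 0 w.
Hypothesis MUS : martingale P F US.
Hypothesis MUX : martingale P F UX.
Hypothesis USp : forall t w, 0 <= t -> `|US t w| <= p.
Hypothesis UXp : forall t w, 0 <= t -> `|UX t w| <= p.

Let tau0 w : (0 <= tau w)%E. Proof. by case: stau. Qed.

Section Increment.
Variables (s t : R) (B : set T).
Hypothesis s0 : 0 <= s.
Hypothesis st : s <= t.
Hypothesis FB : F s B.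
Let t0 : 0 <= t. Proof. exact: le_trans st. Qed.
Let g n := grid s t n.
Let gt0 n k : 0 <= g n k. Proof. exact: grid_ge0. Qed.
Let u w := stop tau t w.
Let m n k w := Num.min (u w) (g n k).
Let incr w := \1_B w * (stopped_process L tau t w - stopped_process L tau s w).
Let late (r : R) : set T := [set w | (r%:E < tau w)%E].

Let u0 w : 0 <= u w. Proof. by rewrite /u stop_ge0. Qed.

(** Coefficients read at the left end of each cell, restricted to [B] and to paths not yet stopped.
    The latter makes them bounded by [p]. The sum [J n] of the two transforms approximates
    [incr]. *)
Let H (Z : R -> T -> R) n k w := \1_B w * (\1_(late (g n k)) w * Z (g n k) w).
Let J n w := transform UX (g n) (H S n) n.+1 w + transform US (g n) (H X n) n.+1 w.

Let H_gmeas Z n k : adapted F Z -> gmeas (F (g n k)) (H Z n k).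
Proof.
move=> aZ; have sF := filtS filtF (gt0 n k).
apply: (gmeasM sF); first apply: gmeas_indic => //.
  by apply: (filt_le filtF s0) FB; rewrite /g grid_ge.
apply: (gmeasM sF); last by move=> C mC; exact: aZ.
by apply: gmeas_indic => //; exact: stopping_time_gt.
Qed.

Let H_le Z n k w : (forall (t : R) w, 0 <= t -> (t%:E < tau w)%E -> `|Z t w| <= p) ->
  `|H Z n k w| <= p.
Proof.
move=> Zp; rewrite /H !normrM !indicE.
have b1 b : `|(nat_of_bool b)%:R : R| <= 1 by case: b; rewrite ?normr1 ?normr0.
have [h|h] := boolP ((g n k)%:E < tau w)%E.
  rewrite -[leRHS]mul1r ler_pM// -[leRHS]mul1r ler_pM//.
  exact: Zp.
by rewrite [w \in late _]memNset ?normr0 ?mul0r ?mulr0//; exact/negP.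
Qed.

Let UXg n k w : `|UX (g n k) w| <= p. Proof. exact: UXp. Qed.
Let USg n k w : `|US (g n k) w| <= p. Proof. exact: USp. Qed.
Let gS n k : g n k <= g n k.+1. Proof. exact: grid_le. Qed.

Let bT1 n : bmeas (transform UX (g n) (H S n) n.+1).
Proof.
apply: (transform_bmeas filtF MUX (gt0 n 0) (gS n) (UXg n) (H := H S n) (c := p)).
  by move=> k; exact: H_gmeas.
by move=> k w; exact: H_le.
Qed.

Let bT2 n : bmeas (transform US (g n) (H X n) n.+1).
Proof.
apply: (transform_bmeas filtF MUS (gt0 n 0) (gS n) (USg n) (H := H X n) (c := p)).
  by move=> k; exact: H_gmeas.
by move=> k w; exact: H_le.
Qed.

Let J_bmeas n : bmeas (J n). Proof. exact: bmeasD. Qed.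

Let J_mean n : mean (J n) = 0.
Proof.
rewrite /J meanD; [|exact: bmeas_intg|exact: bmeas_intg].
rewrite (transform_mean filtF MUX (gt0 n 0) (gS n) (UXg n) (H := H S n) (c := p)); last 2 first.
- by move=> k; exact: H_gmeas.
- by move=> k w; exact: H_le.
rewrite (transform_mean filtF MUS (gt0 n 0) (gS n) (USg n) (H := H X n) (c := p)); last 2 first.
- by move=> k; exact: H_gmeas.
- by move=> k w; exact: H_le.
by rewrite addr0.
Qed.

Let J_sqr n : mean (fun w => J n w ^+ 2) <= 4 * (p ^+ 2 * p ^+ 2).
Proof.
have sq f : bmeas f -> intg (fun w => f w ^+ 2).
  by move=> bf; apply: bmeas_intg; under eq_fun do rewrite expr2; exact: bmeasM.
have h1 : mean (fun w => transform UX (g n) (H S n) n.+1 w ^+ 2) <= p ^+ 2 * p ^+ 2.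
  apply: (transform_mean_sqr filtF MUX (gt0 n 0) (gS n) (UXg n)).
    by move=> k; exact: H_gmeas.
  by move=> k w; exact: H_le.
have h2 : mean (fun w => transform US (g n) (H X n) n.+1 w ^+ 2) <= p ^+ 2 * p ^+ 2.
  apply: (transform_mean_sqr filtF MUS (gt0 n 0) (gS n) (USg n)).
    by move=> k; exact: H_gmeas.
  by move=> k w; exact: H_le.
apply: (@le_trans _ _ (mean (fun w => 2 * transform UX (g n) (H S n) n.+1 w ^+ 2 +
  2 * transform US (g n) (H X n) n.+1 w ^+ 2))).
  apply: le_mean; [exact: sq|by apply: intgD; apply: intgZ; exact: sq|].
  move=> w; rewrite /J; move: (transform _ _ _ _ _) (transform _ _ _ _ _) => x y.
  have := sqr_ge0 (x - y); nra.
rewrite meanD; [|by apply: intgZ; exact: sq|by apply: intgZ; exact: sq].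
by rewrite !meanZ; [lra|exact: sq|exact: sq].
Qed.

Let stopm n k w : (k <= n.+1)%N -> stop tau (g n k) w = m n k w.
Proof. by move=> kn; rewrite (stop_min (tau0 w) (grid_le_end st kn)). Qed.

Let mn w n : m n n.+1 w = u w.
Proof. by rewrite /m /g gridn (min_idPl _)// stop_le. Qed.

Let m_0 w n : m n 0 w = stop tau s w.
Proof. by rewrite /m /g grid0 -stop_min. Qed.

Let transform_stopped (N Z : R -> T -> R) n w :
  transform (fun t w => stopped_process N tau t w - N 0 w) (g n) (H Z n) n.+1 w =
  \1_B w * \sum_(k < n.+1) Z (m n k w) w * (N (m n k.+1 w) w - N (m n k w) w).
Proof.
rewrite mulr_sumr; apply: eq_bigr => k _.
rewrite /H !stopped_processE (stopm w (ltn_ord k)) (stopm w (ltnW (ltn_ord k))) -!mulrA.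
congr (_ * _); have [h|h] := boolP ((g n k)%:E < tau w)%E.
  have -> : m n k w = g n k.
    by rewrite -(stopm w (ltnW (ltn_ord k))) stop_gt.
  by rewrite indicE mem_set// mul1r; congr (_ * _); ring.
have -> : m n k.+1 w = m n k w.
  rewrite -(stopm w (ltn_ord k)) -(stopm w (ltnW (ltn_ord k))).
  move: h (tau0 w); rewrite -leNgt; case E : (tau w) => [r| |]// h _.
  move: h; rewrite lee_fin => rg.
  by rewrite !(stopE _ E) (min_idPl rg) (min_idPl (le_trans rg (gS n k))).
by rewrite !subrr !mulr0.
Qed.

Let bracket n j w := \sum_(k < j) (S (g n k.+1) w - S (g n k) w) *
  (X (g n k.+1) w - X (g n k) w).

(** The discrete product rule writes [incr] as [J n] plus two Riemann sum errors, the cell cut by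
    [tau], and a bracket sum on uncapped grid times. Each of the four gets [e / 4]. Only the bracket
    is not small on every path, so its smallness is a premise. *)
Let J_close (e : R) w : 0 < e -> exists M, forall n, (M <= n)%N ->
  (forall j, (j <= n.+1)%N -> `|bracket n j w| <= e / 4) -> `|J n w - incr w| <= e.
Proof.
move=> e0; have e4 : 0 < e / 4 by rewrite divr_gt0.
have [W1 HW1] := HI1 w; have [W2 HW2] := HI2 w.
have [M1 HM1] := riemann_stieltjes_grid (cS w) s0 st (u0 w) e4 HW1.
have [M2 HM2] := riemann_stieltjes_grid (cX w) s0 st (u0 w) e4 HW2.
(* Chosen so that [eta * eta <= e / 4], which bounds the error of [stopped_bracket] in the cell
   containing [u w]. *)
pose eta := Num.min 1 (e / 4).
have eta0 : 0 < eta by rewrite lt_min ltr01.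
have [M3 HM3] := ucont_grid (cS w) s0 st eta0.
have [M4 HM4] := ucont_grid (cX w) s0 st eta0.
exists (maxn (maxn M1 M2) (maxn M3 M4)) => n.
rewrite !geq_max => /andP[/andP[n1 n2] /andP[n3 n4]] Hbr.
have {HM1}h1 := HM1 n n1; have {HM2}h2 := HM2 n n2.
have [||j jn h3] := @stopped_bracket _ (fun r => S r w) (fun r => X r w) (g n) (u w) eta n.+1
  (gS n) (ltW eta0).
- by move=> k kn; apply/ltW/HM3 => //; exact: u0.
- by move=> k kn; apply/ltW/HM4 => //; exact: u0.
have h4 := Hbr j jn.
have h5 : eta * eta <= e / 4.
  apply: (@le_trans _ _ (1 * (e / 4))); last by rewrite mul1r.
  by apply: ler_pM; rewrite ?(ltW eta0)// /eta ge_min lexx ?orbT.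
have ut : Num.min (u w) t = u w by rewrite (min_idPl _)// stop_le.
have us : Num.min (u w) s = stop tau s w by rewrite -stop_min.
rewrite ut us in h1 h2.
have pr := discrete_product_rule (fun k => S (m n k w) w) (fun k => X (m n k w) w) n.+1.
rewrite mn m_0 in pr.
have m0 k : 0 <= m n k w by rewrite /m le_min u0 gt0.
have decX : \sum_(k < n.+1) S (m n k w) w * (X (m n k.+1 w) w - X (m n k w) w) =
  \sum_(k < n.+1) S (m n k w) w * (NX (m n k.+1 w) w - NX (m n k w) w) +
  \sum_(k < n.+1) S (m n k w) w * (AX (m n k.+1 w) w - AX (m n k w) w).
  rewrite -big_split/=; apply: eq_bigr => k _.
  by rewrite (X_dec w (m0 k.+1)) (X_dec w (m0 k)); ring.
have decS : \sum_(k < n.+1) X (m n k w) w * (S (m n k.+1 w) w - S (m n k w) w) =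
  \sum_(k < n.+1) X (m n k w) w * (NS (m n k.+1 w) w - NS (m n k w) w) +
  \sum_(k < n.+1) X (m n k w) w * (AS (m n k.+1 w) w - AS (m n k w) w).
  rewrite -big_split/=; apply: eq_bigr => k _.
  by rewrite (S_dec w (m0 k.+1)) (S_dec w (m0 k)); ring.
rewrite decX decS in pr.
rewrite /J /incr !transform_stopped -mulrDr -mulrBr normrM.
rewrite !stopped_processE /L -/(u w).
rewrite -[leRHS]mul1r; apply: ler_pM => //.
  by rewrite indicE; case: (_ \in _); rewrite ?normr1 ?normr0.
move: pr h1 h2 h3 h4; rewrite /bracket -/(m n).
set a1 := \sum_(k < n.+1) S _ _ * (NX _ _ - _).
set a2 := \sum_(k < n.+1) S _ _ * (AX _ _ - _).
set a3 := \sum_(k < n.+1) X _ _ * (NS _ _ - _).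
set a4 := \sum_(k < n.+1) X _ _ * (AS _ _ - _).
set a5 := \sum_(k < n.+1) (S _ _ - _) * _.
set a6 := \sum_(k < j) _.
move=> pr h1 h2 h3 h4.
rewrite (_ : _ - _ = - (a2 - (I1 (u w) w - I1 (stop tau s w) w)) -
  (a4 - (I2 (u w) w - I2 (stop tau s w) w)) - (a5 - a6) - a6); last by lra.
apply: (le_trans (ler_normB _ _)).
have := ler_normB (- (a2 - (I1 (u w) w - I1 (stop tau s w) w)) -
  (a4 - (I2 (u w) w - I2 (stop tau s w) w))) (a5 - a6).
have := ler_normB (- (a2 - (I1 (u w) w - I1 (stop tau s w) w)))
  (a4 - (I2 (u w) w - I2 (stop tau s w) w)).
rewrite normrN; lra.
Qed.

Lemma mean_increment_ibp : intg incr /\ mean incr = 0.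
Proof.
have mB := filt_meas filtF s0 FB.
have mL r : 0 <= r -> measurable_fun setT (stopped_process L tau r).
  move=> r0; apply: (gmeas_measurable (filt_meas filtF r0)).
  exact: (stopped_gmeas filtF stau r0 adapted_ibp ucont_ibp).
have mincr : measurable_fun setT incr.
  by apply: measurable_funM => //; apply: measurable_funB; exact: mL.
apply: (mean0_cvg_prob J_bmeas J_mean J_sqr mincr) => e dl e0 dl0.
have e4 : 0 < e / 4 by rewrite divr_gt0.
have dl2 : 0 < dl / 2 by rewrite divr_gt0.
have [M HM] := indep_bracket_small filtF rcF sG1 sG2 G1m G2m indep X_dec LNX cNX aAX vAX
  cS GS GX s0 st e4 dl2.
pose Br n := [set w | exists2 j, (j <= n.+1)%N & e / 4 < `|bracket n j w|].
have mS r : 0 <= r -> measurable_fun setT (S r).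
  by move=> r0; apply: (gmeas_measurable (filt_meas filtF r0)) => C mC; exact: aS.
have mX r : 0 <= r -> measurable_fun setT (X r).
  by move=> r0; apply: (gmeas_measurable (filt_meas filtF r0)) => C mC; exact: aX.
have mBr n : measurable (Br n).
  apply: (@measurable_exists_le _ _ (fun j => [set w | e / 4 < `|bracket n j w|])) => j.
  apply: measurable_gt; apply: measurableT_comp => //.
  apply: measurable_sum => k; apply: measurable_funM; apply: measurable_funB;
    (apply: mS || apply: mX); exact: gt0.
(* The threshold of [J_close] depends on the path, but along each path these events eventually stop
   occurring, so their probabilities vanish. What is removed, [Br n], is small by independence. *)
pose E n := [set w | e < `|J n w - incr w|] `\` Br n.
have mD n : measurable [set w | e < `|J n w - incr w|].
  apply: measurable_gt; apply: measurableT_comp => //.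
  by apply: measurable_funB => //; case: (J_bmeas n).
have mE n : measurable (E n) by exact: measurableD.
have [|M' HM'] := @pr_cvg0 _ _ _ P E mE _ _ dl2.
  apply: aeW => w; have [M' HM'] := J_close w e0.
  exists M' => n Mn [/= h nBr]; move: h; rewrite ltNge => /negP; apply.
  apply: HM' => // j jn; rewrite leNgt; apply/negP => h; apply: nBr.
  by exists j.
exists (maxn M M'); set n := maxn M M'.
apply: (@le_trans _ _ (pr (E n `|` Br n))).
  apply: pr_le => //; first exact: measurableU.
  by move=> w h; have [hb|hb] := pselect (Br n w); [right|left].
apply: (le_trans (pr_leU P (mE n) (mBr n))).
have h1 := HM n (leq_maxl _ _); have h2 := HM' n (leq_maxr _ _).
rewrite -/(Br n) in h1; lra.
Qed.

End Increment.

Lemma martingale_ibp : martingale P F (fun t w => stopped_process L tau t w - L 0 w).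
Proof.
have L0 w : L 0 w = 0 by rewrite /L I10 I20 subrr !subr0.
have -> : (fun t w => stopped_process L tau t w - L 0 w) = stopped_process L tau.
  by apply/funext => t; apply/funext => w; rewrite L0 subr0.
have F0T : F 0 setT.
  by rewrite -setC0; apply: gsetC; [exact: filtS|exact: gset0 (filtS filtF (lexx 0))].
apply: (martingaleP filtF).
- exact: (stopped_adapted filtF stau adapted_ibp ucont_ibp).
- move=> t t0; have [+ _] := mean_increment_ibp (lexx 0) t0 F0T.
  congr (intg _); apply/funext => w; rewrite indicT mul1r.
  by rewrite [X in _ - X]stopped_processE stop0// L0 subr0.
- by move=> s t B s0 st FB; have [_] := mean_increment_ibp s0 st FB.
Qed.

End Localized.

Lemma local_martingale_ibp : local_martingale P F L.
Proof.
split; first exact: adapted_ibp.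
have [_ [rS [srS rS_nd rS_cvg rSM]]] := LNS.
have [_ [rX [srX rX_nd rX_cvg rXM]]] := LNX.
(* One process dominates all four quantities to be bounded, so one hitting time serves. [S] and [X]
   need not start at 0: their bounds are required only strictly before [tau], hence nowhere when [G]
   exceeds [p] at time 0. *)
pose G t w := `|S t w| + `|X t w| + (`|NS t w - NS 0 w| + `|NX t w - NX 0 w|).
have aG : adapted F G.
  move=> t t0; have sF := filtS filtF t0; have f0 := filt_le filtF (lexx 0) t0.
  apply: (gmeasD sF); apply: (gmeasD sF); apply: (gmeas_norm sF) => //.
  - by move=> B mB; exact: aS.
  - by move=> B mB; exact: aX.
  - apply: (gmeasB sF); first by move=> B mB; exact: aNS.
    by move=> B mB; apply: f0; exact: aNS.
  - apply: (gmeasB sF); first by move=> B mB; exact: aNX.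
    by move=> B mB; apply: f0; exact: aNX.
have cG w : ucont (fun t => G t w).
  apply: ucontD; apply: ucontD; apply: ucont_norm => //.
    by apply: ucontB => //; exact: ucont_cst.
  by apply: ucontB => //; exact: ucont_cst.
pose h p := hitting G p%:R.
have sh p : stopping_time F (h p) by exact: hitting_stopping.
pose tau p w := mine (mine (rS p w) (rX p w)) (h p w).
have stau p : stopping_time F (tau p).
  by apply: stopping_time_min => //; exact: stopping_time_min.
have tauh p w : (tau p w <= h p w)%E by rewrite /tau ge_min lexx orbT.
have G1' t w : `|S t w| <= G t w by rewrite /G -addrA lerDl !addr_ge0.
have G2' t w : `|X t w| <= G t w.
  by rewrite /G -addrA addrCA lerDl !addr_ge0.
have G3 t w : `|NS t w - NS 0 w| <= G t w.
  by rewrite /G addrCA lerDl !addr_ge0.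
have G4 t w : `|NX t w - NX 0 w| <= G t w.
  by rewrite /G addrA lerDr !addr_ge0.
exists tau; split.
- exact: stau.
- move=> n w; rewrite /tau !le_min !ge_min rS_nd rX_nd /=.
  by rewrite /h hitting_le ?orbT ?ler_nat.
- apply: (filterS2 _ _ rS_cvg rX_cvg) => w /cvgeyPgt c1 /cvgeyPgt c2.
  apply/cvgeyPgt => A.
  have [M _ HM] := c1 A; have [M' _ HM'] := c2 A.
  have [M'' HM''] := hitting_large cG w A.
  exists (maxn M (maxn M' M'')) => // n /=; rewrite !geq_max => /and3P[n1 n2 n3].
  by rewrite /tau !lt_min HM//= HM'//= HM''.
- move=> p; apply: (@martingale_ibp (tau p) p%:R) => //.
  + move=> t w t0 tt; apply: (le_trans (G1' t w)); apply: lt_hitting => //.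
    exact: lt_le_trans (tauh p w).
  + move=> t w t0 tt; apply: (le_trans (G2' t w)); apply: lt_hitting => //.
    exact: lt_le_trans (tauh p w).
  + have -> : tau p = fun w => mine (rS p w) (mine (rX p w) (h p w)).
      by apply/funext => w; rewrite /tau minA.
    by apply: stopped_local => //; exact: stopping_time_min.
  + have -> : tau p = fun w => mine (rX p w) (mine (rS p w) (h p w)).
      by apply/funext => w; rewrite /tau minCA minA.
    by apply: stopped_local => //; exact: stopping_time_min.
  + move=> t w t0; rewrite stopped_processE; set q := stop _ _ _.
    have tau0 : (0 <= tau p w)%E by case: (stau p).
    have q0 : 0 <= q by exact: stop_ge0.
    have [q1|q1] := leP q 0.
      by rewrite (_ : q = 0) ?subrr ?normr0//; apply/eqP; rewrite eq_le q1.
    apply: (le_trans (G3 q w)); apply: (le_hitting cG q1).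
    by apply: le_trans (tauh p w); exact: stop_le_tau.
  + move=> t w t0; rewrite stopped_processE; set q := stop _ _ _.
    have tau0 : (0 <= tau p w)%E by case: (stau p).
    have q0 : 0 <= q by exact: stop_ge0.
    have [q1|q1] := leP q 0.
      by rewrite (_ : q = 0) ?subrr ?normr0//; apply/eqP; rewrite eq_le q1.
    apply: (le_trans (G4 q w)); apply: (le_hitting cG q1).
    by apply: le_trans (tauh p w); exact: stop_le_tau.
Qed.

End ProductRule.

(** * The Doob-Meyer decomposition of the product *)

Section Grouping.
Context {d : measure_display} {T : measurableType d} {R : realType}.
Variable P : probability T R.

(** As functions of [A], both sides are finite measures, the restriction of [P] to [B] and [P]
    scaled by [P B]. They agree on the intersection-stable class [K], hence on what it generates. *)
Lemma indep_generated (K : set (set T)) (B : set T) : K `<=` measurable ->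
  setI_closed K -> K setT -> measurable B ->
  (forall A, K A -> P (A `&` B) = (P A * P B)%E) ->
  forall A, <<s K >> A -> P (A `&` B) = (P A * P B)%E.
Proof.
move=> Km KI KT mB KB A sA.
have pB0 : 0 <= fine (P B) by rewrite fine_ge0.
pose r := NngNum pB0.
have E X : mscale r P X = (P X * P B)%E.
  by rewrite /mscale/= fineK ?fin_num_measure// muleC.
rewrite -E; change (mrestr P mB A = mscale r P A).
apply: (@g_sigma_algebra_measure_unique _ _ _ K Km (fun=> setT) _ _ (mrestr P mB) (mscale r P)) => //.
- by apply/seteqP; split => // w _; exists 0.
- by move=> X KX; exact: (etrans (KB X KX) (esym (E X))).
- move=> n; change (P (setT `&` B) < +oo)%E.
  by rewrite setTI (le_lt_trans (probability_le1 P mB))// ltry.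
Qed.

Variables (m : nat) (X : 'I_m -> R -> T -> R).
Hypothesis X_indep : independent_processes P X.
Hypothesis mX : forall i t, 0 <= t -> measurable_fun setT (X i t).

Lemma process_sigma_algebra_measurable i : process_sigma_algebra (X i) `<=` measurable.
Proof.
apply: smallest_sub; first exact: sigma_algebra_measurable.
by move=> _ [t [B [t0 mB ->]]]; rewrite -[_ @^-1` _]setTI; exact: mX.
Qed.

Let sP i : sigma_algebra setT (process_sigma_algebra (X i)).
Proof. exact: smallest_sigma_algebra. Qed.

Lemma process_sigma_algebraT i : process_sigma_algebra (X i) setT.
Proof. by rewrite -setC0; apply: (gsetC (sP i)); exact: gset0. Qed.

(** Rectangles in the processes of index below [k], padded with [setT] to full families as
    [independent_processes] expects them. They are stable under intersection. *)
Definition first_events (k : nat) : set (set T) :=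
  [set A | exists E : 'I_m -> set T, [/\ forall i, process_sigma_algebra (X i) (E i),
    forall i : 'I_m, (k <= i)%N -> E i = setT & A = \bigcap_(i in [set: 'I_m]) E i]].

Definition first_sigma_algebra k := <<s first_events k >>.

Lemma first_events_measurable k : first_events k `<=` measurable.
Proof.
move=> _ [E [sE _ ->]]; apply: fin_bigcap_measurable => // i _.
exact: process_sigma_algebra_measurable.
Qed.

Lemma first_sigma_algebra_measurable k : first_sigma_algebra k `<=` measurable.
Proof.
by apply: smallest_sub; [exact: sigma_algebra_measurable|exact: first_events_measurable].
Qed.

Lemma first_sigma_algebra_gmeas k (i : 'I_m) t : (i < k)%N -> 0 <= t ->
  gmeas (first_sigma_algebra k) (X i t).
Proof.
move=> ik t0 B mB; apply: sub_sigma_algebra.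
exists (fun j => if j == i then X i t @^-1` B else setT); split.
- move=> j; case: eqP => [->|_]; last exact: process_sigma_algebraT.
  by apply: sub_sigma_algebra; exists t, B.
- by move=> j kj; rewrite ifN//; apply: contraTneq ik => <-; rewrite -leqNgt.
- apply/seteqP; split => [w h j _|w h]; first by case: eqP.
  by have := h i Logic.I; rewrite eqxx.
Qed.

(** In a rectangle over the indices below [i] the slot [i] is free. Putting [B] there gives a full
    family, and comparing the two product formulas splits off [P B]. *)
Lemma first_sigma_algebra_indep (i : 'I_m) A B : first_sigma_algebra i A ->
  process_sigma_algebra (X i) B -> P (A `&` B) = (P A * P B)%E.
Proof.
move=> sA sB; apply: (indep_generated _ _ _ _ _ sA).
- exact: first_events_measurable.
- move=> _ _ [E [sE Et ->]] [E' [sE' Et' ->]].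
  exists (fun j => E j `&` E' j); split.
  + by move=> j; apply: (gsetI (sP j)).
  + by move=> j ij; rewrite Et// Et'// setTI.
  + by rewrite bigcapI.
- exists (fun=> setT); split => //; first by move=> j; exact: process_sigma_algebraT.
  by rewrite bigcapT.
- exact: (process_sigma_algebra_measurable sB).
move=> _ [E [sE Et ->]].
pose E' j := if j == i then B else E j.
have sE' j : process_sigma_algebra (X j) (E' j) by rewrite /E'; case: eqP => // ->.
have -> : \bigcap_(j in [set: 'I_m]) E j `&` B = \bigcap_(j in [set: 'I_m]) E' j.
  apply/seteqP; split => [w [h hB] j _|w h].
    by rewrite /E'; case: eqP => // _; exact: h.
  split; last by have := h i Logic.I; rewrite /E' eqxx.
  move=> j _; have := h j Logic.I; rewrite /E'; case: eqP => // -> _.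
  by rewrite Et.
rewrite (X_indep sE') (X_indep sE) (bigD1 i)//= [in RHS](bigD1 i)//=.
rewrite /E' eqxx Et// [P setT](_ : _ = 1%E) ?mul1e; last exact: probability_setT.
rewrite muleC; congr (_ * _)%E; apply: eq_bigr => j ji.
by rewrite (negbTE ji).
Qed.

End Grouping.

Lemma ucont_prod {R : realType} {I : Type} (r : seq I) (p : pred I) (f : I -> R -> R) :
  (forall i, ucont (f i)) -> ucont (fun t => \prod_(i <- r | p i) f i t).
Proof.
move=> cf; elim: r => [|i r IH].
  by under eq_fun do rewrite big_nil; exact: ucont_cst.
under eq_fun do rewrite big_cons.
by case: (p i) => //; exact: ucontM.
Qed.

Lemma gmeas_prod {d : measure_display} {T : measurableType d} {R : realType}
    {I : Type} (G : set (set T)) (r : seq I) (p : pred I) (f : I -> T -> R) :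
  sigma_algebra setT G -> (forall i, p i -> gmeas G (f i)) ->
  gmeas G (fun w => \prod_(i <- r | p i) f i w).
Proof.
move=> sG Gf; elim: r => [|i r IH].
  by under eq_fun do rewrite big_nil; exact: gmeas_cst.
under eq_fun do rewrite big_cons.
by case: (boolP (p i)) => // hi; apply: (gmeasM sG) => //; exact: Gf.
Qed.

(** * Additive decomposition of the product *)

Section DoobMeyerProduct.
Context {d : measure_display} {T : measurableType d} {R : realType}.
Variables (P : probability T R) (F : R -> set (set T)).
Hypothesis filtF : filtration F.
Hypothesis rcF : right_continuous_filtration F.
Variable V : T -> cumulative R R.

Lemma doob_meyer_ext (X X' N Y Y' : R -> T -> R) :
  (forall t w, 0 <= t -> X t w = X' t w) -> (forall t w, 0 <= t -> Y t w = Y' t w) ->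
  doob_meyer P F V X N Y -> doob_meyer P F V X' N Y'.
Proof.
move=> XX YY [LN cN aY iY dec]; split => //.
- move=> t t0; rewrite (_ : Y' t = Y t); first exact: aY.
  by apply/funext => w; rewrite YY.
- move=> t w t0; apply: eq_integrable (iY t w t0) => // s.
  by rewrite inE/= in_itv/= => /andP[s0 _]; rewrite YY// ltW.
- move=> t w t0; rewrite -!XX// dec//; congr (_ + _).
  apply: eq_Rintegral => s; rewrite inE/= in_itv/= => /andP[s0 _].
  by rewrite YY// ltW.
Qed.

Lemma doob_meyer_cst (c : R) : doob_meyer P F V (fun _ _ => c) (fun _ _ => 0) (fun _ _ => 0).
Proof.
have a0 : adapted F (fun _ _ => 0 : R).
  by move=> t t0; apply: gmeas_cst; exact: filtS.
split => //.
- split => //; exists (fun _ _ => +oo%E); split => //.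
  + by move=> n; exact: stopping_time_cst.
  + by apply: aeW => w; exact: cvg_cst.
  + move=> n; apply: (martingaleP filtF).
    * move=> t t0; rewrite /stopped_process; under eq_fun do rewrite subrr.
      exact: a0.
    * by move=> t t0; under eq_fun do rewrite subrr; exact: intg_cst.
    * move=> s t A s0 st FA; under eq_mean do rewrite /stopped_process !subrr mulr0.
      exact: mean_cst.
- by move=> w; apply: ucont_within; exact: ucont_cst.
- by move=> t w t0; exact: integrable0.
- by move=> t w t0; rewrite /stieltjes_integral Rintegral_cst// mul0r !addr0.
Qed.

Lemma stieltjes_integral0 (Y : R -> T -> R) w : stieltjes_integral V Y 0 w = 0.
Proof. by rewrite /stieltjes_integral set_itv_ge ?Rintegral_set0// bnd_simp ltxx. Qed.

(** With no bracket term the drift density is the Leibniz formula, and the martingale part is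
    [ibp_martingale]. The estimates on the integrals against [V] are made path by path. *)
Lemma doob_meyer_mul (G1 G2 : set (set T)) (S NS DS X NX DX : R -> T -> R) :
  sigma_algebra setT G1 -> sigma_algebra setT G2 ->
  G1 `<=` measurable -> G2 `<=` measurable ->
  (forall A B, G1 A -> G2 B -> P (A `&` B) = (P A * P B)%E) ->
  (forall t, 0 <= t -> gmeas G1 (S t)) -> (forall t, 0 <= t -> gmeas G2 (X t)) ->
  adapted F S -> adapted F X ->
  (forall w, ucont (fun t => S t w)) -> (forall w, ucont (fun t => X t w)) ->
  doob_meyer P F V S NS DS -> doob_meyer P F V X NX DX ->
  exists N, doob_meyer P F V (fun t w => S t w * X t w) N
    (fun t w => S t w * DX t w + X t w * DS t w).
Proof.
move=> sG1 sG2 G1m G2m indep GS GX aS aX cS cX [LNS cNS aDS iDS decS] [LNX cNX aDX iDX decX].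
pose I1 := stieltjes_integral V (fun s w => S s w * DX s w).
pose I2 := stieltjes_integral V (fun s w => X s w * DS s w).
have HI1 w : stieltjes_like (fun t => S t w) (fun t => stieltjes_integral V DX t w) (fun t => I1 t w).
  exists (fun t => \int[lebesgue_stieltjes_measure (V w)]_(s in `]0, t]) `|DX s w|).
  move=> a b c e a0 ab h.
  exact: (@stieltjes_estimate _ (V w) (fun t => S t w) (fun t => DX t w) (cS w)
    (fun t => iDX t w) a b c e a0 ab h).
have HI2 w : stieltjes_like (fun t => X t w) (fun t => stieltjes_integral V DS t w) (fun t => I2 t w).
  exists (fun t => \int[lebesgue_stieltjes_measure (V w)]_(s in `]0, t]) `|DS s w|).
  move=> a b c e a0 ab h.
  exact: (@stieltjes_estimate _ (V w) (fun t => X t w) (fun t => DS t w) (cX w)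
    (fun t => iDS t w) a b c e a0 ab h).
have vAX w : exists W : R -> R, forall a b : R, 0 <= a -> a <= b ->
    `|stieltjes_integral V DX b w - stieltjes_integral V DX a w| <= W b - W a.
  exists (fun t => \int[lebesgue_stieltjes_measure (V w)]_(s in `]0, t]) `|DX s w|).
  move=> a b a0 ab.
  exact: (@stieltjes_variation _ (V w) (fun t => DX t w) (fun t => iDX t w) a b a0 ab).
have uNS w : ucont (fun t => NS t w) by exact: within_ucont.
have uNX w : ucont (fun t => NX t w) by exact: within_ucont.
have I10 w : I1 0 w = 0 by exact: stieltjes_integral0.
have I20 w : I2 0 w = 0 by exact: stieltjes_integral0.
have dS t w : 0 <= t -> S t w = S 0 w + NS t w + stieltjes_integral V DS t w by exact: decS.
have dX t w : 0 <= t -> X t w = X 0 w + NX t w + stieltjes_integral V DX t w by exact: decX.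
exists (ibp_martingale S X I1 I2); split.
- exact: (local_martingale_ibp filtF rcF sG1 sG2 G1m G2m indep dS dX LNS LNX uNS uNX cS cX
    aS aX vAX HI1 HI2 I10 I20 GS GX).
- move=> w; apply: ucont_within.
  exact: (ucont_ibp dS dX uNS uNX cS cX HI1 HI2 w).
- move=> t t0; have sF := filtS filtF t0.
  apply: (gmeasD sF); apply: (gmeasM sF); move=> B mB;
    [exact: aS|exact: aDX|exact: aX|exact: aDS].
- move=> t w t0.
  have i1 := @ucont_integrableM _ (V w) _ _ (cS w) (fun t => iDX t w) t t0.
  have i2 := @ucont_integrableM _ (V w) _ _ (cX w) (fun t => iDS t w) t t0.
  exact: (integrableD _ i1 i2).
- move=> t w t0.
  have i1 := @ucont_integrableM _ (V w) _ _ (cS w) (fun t => iDX t w) t t0.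
  have i2 := @ucont_integrableM _ (V w) _ _ (cX w) (fun t => iDS t w) t t0.
  have -> : stieltjes_integral V (fun t w => S t w * DX t w + X t w * DS t w) t w =
      I1 t w + I2 t w.
    exact: (RintegralD _ i1 i2).
  by rewrite /ibp_martingale; ring.
Qed.

Variables (m : nat) (X N Y : 'I_m -> R -> T -> R).
Hypothesis X_adapted : forall i, adapted F (X i).
Hypothesis X_continuous : forall i, continuous_paths (X i).
Hypothesis X_positive : forall i t w, 0 <= t -> 0 < X i t w.
Hypothesis X_independent : independent_processes P X.
Hypothesis X_additive : forall i, doob_meyer P F V (X i) (N i) (Y i).

Let cX i w : ucont (fun t => X i t w).
Proof. by apply: within_ucont; exact: X_continuous. Qed.

(** Dividing out the positive product reduces the sign of the density to that of a sum of
    nonincreasing terms, where monotonicity is visible. *)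
Lemma product_density_ratio t w : 0 <= t ->
  product_density X Y t w = product_process X t w * \sum_(i < m) Y i t w / X i t w.
Proof.
move=> t0; rewrite /product_density /product_process mulr_sumr; apply: eq_bigr => i _.
rewrite [in RHS](bigD1 i)//=; have /gt_eqF/negbT h := X_positive i w t0.
by field.
Qed.

Lemma doob_meyer_product : exists NP,
  doob_meyer P F V (product_process X) NP (product_density X Y).
Proof.
have mX i t : 0 <= t -> measurable_fun setT (X i t).
  move=> t0; apply: (gmeas_measurable (filt_meas filtF t0)) => B mB.
  exact: X_adapted.
pose Z k t w := \prod_(i < m | (i < k)%N) X i t w.
(* The density of the first [k] factors is carried as [Z k * r k], so that the induction step is the
   identity [Z * Y + X * (Z * r) = Z * X * (r + Y / X)]. *)
pose r k t w := \sum_(i < m | (i < k)%N) Y i t w / X i t w.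
suff H k : (k <= m)%N -> exists NP, doob_meyer P F V (Z k) NP (fun t w => Z k t w * r k t w).
  have [NP HNP] := H m (leqnn m); exists NP.
  apply: doob_meyer_ext HNP => t w t0.
    by apply: eq_bigl => i; rewrite ltn_ord.
  rewrite product_density_ratio//; congr (_ * _); apply: eq_bigl => i; rewrite ltn_ord//.
elim: k => [_|k IH km].
  exists (fun _ _ => 0); apply: doob_meyer_ext (doob_meyer_cst 1) => t w t0.
    by rewrite /Z big_pred0.
  by rewrite /r big_pred0// mulr0.
have [NP HNP] := IH (ltnW km).
pose i0 := Ordinal km.
have ltS (i : 'I_m) : ((i < k.+1)%N && (i != i0)) = (i < k)%N.
  by rewrite ltnS ltn_neqAle andbC; congr (_ && _); rewrite -val_eqE.
have ZS t w : Z k.+1 t w = Z k t w * X i0 t w.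
  rewrite /Z (bigD1 i0)//=.
  by rewrite mulrC; congr (_ * _); apply: eq_bigl => i; rewrite ltS.
have rS t w : r k.+1 t w = r k t w + Y i0 t w / X i0 t w.
  rewrite /r (bigD1 i0)//=.
  by rewrite addrC; congr (_ + _); apply: eq_bigl => i; rewrite ltS.
have [|||||||||||NP' HNP'] := @doob_meyer_mul (first_sigma_algebra X k) (process_sigma_algebra (X i0))
  (Z k) NP (fun t w => Z k t w * r k t w) (X i0) (N i0) (Y i0)
  _ _ _ _ _ _ _ _ _ _ _ HNP (X_additive i0).
- exact: smallest_sigma_algebra.
- exact: smallest_sigma_algebra.
- exact: first_sigma_algebra_measurable.
- exact: process_sigma_algebra_measurable.
- by move=> A B sA sB; exact: (@first_sigma_algebra_indep _ _ _ P m X X_independent mX i0).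
- move=> t t0; apply: gmeas_prod; first exact: smallest_sigma_algebra.
  by move=> i ik; exact: first_sigma_algebra_gmeas.
- by move=> t t0 B mB; apply: sub_sigma_algebra; exists t, B.
- move=> t t0; apply: gmeas_prod; first exact: filtS.
  by move=> i _ B mB; exact: X_adapted.
- exact: X_adapted.
- by move=> w; apply: ucont_prod => i; exact: cX.
- by move=> w; exact: cX.
exists NP'; apply: doob_meyer_ext HNP' => t w t0; first by rewrite ZS.
rewrite ZS rS; have := gt_eqF (X_positive i0 w t0) => /negbT h.
by field.
Qed.

End DoobMeyerProduct.

(** * Optimality in the monotone case *)

Section StoppedValue.
Context {d : measure_display} {T : measurableType d} {R : realType}.
Variables (F : R -> set (set T)).
Hypothesis filtF : filtration F.
Variable Z : R -> T -> R.
Hypothesis aZ : adapted F Z.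
Hypothesis cZ : forall w, ucont (fun t => Z t w).
Hypothesis Z0 : forall (t : R) w, 0 <= t -> 0 <= Z t w.

Lemma stopped_value_min (sigma : T -> \bar R) (t : R) w : (0 <= sigma w)%E ->
  stopped_value Z (fun w => mine (sigma w) t%:E) w = (stopped_process Z sigma t w)%:E.
Proof.
rewrite /stopped_value /stopped_process; case: (sigma w) => [r| |]// _.
  by rewrite -EFin_min.
Qed.

Lemma limf_einf_ge0 (f : R -> R) : (forall t : R, 0 <= t -> 0 <= f t) ->
  (0 <= limf_einf (fun t => (f t)%:E) (+oo)%R)%E.
Proof.
move=> f0; rewrite limf_einfE; apply: ereal_sup_ge.
exists (ereal_inf [set (f t)%:E | t in [set t | 0 < t]]).
  by exists [set t | 0 < t] => //; exists 0; split; rewrite ?num_real.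
by apply/ereal_infP => _ [t /= t0 <-]; rewrite lee_fin f0// ltW.
Qed.

Lemma stopped_value_ge0 (sigma : T -> \bar R) w : (0 <= sigma w)%E ->
  (0 <= stopped_value Z sigma w)%E.
Proof.
rewrite /stopped_value; case: (sigma w) => [r| |]// r0.
  by rewrite lee_fin Z0.
by apply: limf_einf_ge0 => t; exact: Z0.
Qed.

(** On finite [sigma] the stopped path is eventually constant. Otherwise the lower limit over real
    times is at most the one along the integers. This prepares Fatou's lemma for sequences. *)
Lemma stopped_value_le_limn_einf (sigma : T -> \bar R) w : (0 <= sigma w)%E ->
  (stopped_value Z sigma w <=
   limn_einf (fun n : nat => (stopped_process Z sigma n%:R w)%:E))%E.
Proof.
move=> s0; move: (s0); rewrite /stopped_value; case E : (sigma w) => [r| |]// r0.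
  have c : (stopped_process Z sigma n%:R w)%:E @[n --> \oo] --> (Z r w)%:E.
    apply: cvg_near_cst; exists (Num.bound `|r|) => // n /= rn.
    rewrite stopped_processE (stopE _ E) (min_idPl _)//.
    rewrite (le_trans (ler_norm _))// (le_trans (ltW (archi_boundP _)))//.
    by rewrite ler_nat.
  by rewrite (cvg_limn_einf_sup c).1.
rewrite limf_einfE; apply: ge_ereal_sup => _ [W [M [_ MW]] <-].
pose u (n : nat) := (stopped_process Z sigma n%:R w)%:E.
rewrite limn_einf_lim.
have cu : einfs u n @[n --> \oo] --> ereal_sup (range (einfs u)).
  exact: ereal_nondecreasing_cvgn (nondecreasing_einfs u).
rewrite (cvg_lim _ cu)//; apply: ereal_sup_ge.
exists (einfs u (Num.bound `|M|)); first by exists (Num.bound `|M|).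
apply/ereal_infP => _ [n /= Mn <-]; apply: ereal_inf_lbound.
exists n%:R; last by rewrite /u stopped_processE (stopy _ E).
apply: MW; apply: (le_lt_trans (ler_norm _)); apply: (lt_le_trans (archi_boundP _)) => //.
by rewrite ler_nat.
Qed.

(* Stopped paths are eventually constant on [tau < oo], so that
   [X_tau] is the lower limit of the stopped path in all cases. *)
Lemma stopped_value_limf_einf (sigma : T -> \bar R) w : (0 <= sigma w)%E ->
  stopped_value Z sigma w =
  limf_einf (fun t => (stopped_process Z sigma t w)%:E) (+oo)%R.
Proof.
move=> s0; move: (s0); rewrite {1}/stopped_value; case E : (sigma w) => [r| |]// r0.
  have sE t : r < t -> stopped_process Z sigma t w = Z r w.
    by move=> rt; rewrite stopped_processE (stopE _ E) (min_idPl _)// ltW.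
  rewrite limf_einfE; apply/eqP; rewrite eq_le; apply/andP; split.
    apply: ereal_sup_ge.
    exists (ereal_inf [set (stopped_process Z sigma t w)%:E | t in [set t | r < t]]).
      by exists [set t | r < t] => //; exists r; split; rewrite ?num_real.
    by apply/ereal_infP => _ [t /= rt <-]; rewrite sE.
  apply: ge_ereal_sup => _ [W [M [_ MW]] <-]; apply: ereal_inf_lbound.
  exists (Num.max r M + 1).
    by apply: MW; rewrite ltr_pwDr// le_max lexx orbT.
  by rewrite sE// ltr_pwDr// le_max lexx.
by congr (limf_einf _ _); apply/funext => t; rewrite stopped_processE (stopy _ E).
Qed.

(** A sequence running through the nonnegative rationals; codes of no rational give 0. *)
Let qpos (k : nat) : R := if unpickle k is Some q then `|ratr (q : rat)| else 0.

Let qpos_ge0 k : 0 <= qpos k.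
Proof. by rewrite /qpos; case: unpickle => [q|]; [exact: normr_ge0|exact: lexx]. Qed.

Let qpos_dense (x y : R) : 0 <= x -> x < y -> exists k, x < qpos k < y.
Proof.
move=> x0 xy; have [q] := rat_in_itvoo xy.
rewrite in_itv/= => qxy; exists (pickle q); rewrite /qpos pickleK.
move: (ratr q) qxy => r /andP[xr ry].
by rewrite ger0_norm ?xr// (le_trans x0)// ltW.
Qed.

(** Continuity allows each infimum over a half-line to be taken over rational distances from an
    integer, which makes the lower limit of a continuous process a measurable function. *)
Lemma limf_einf_countable (f : R -> R) : ucont f ->
  limf_einf (fun t => (f t)%:E) (+oo)%R =
  ereal_sup (range (fun n : nat => ereal_inf (range (fun k => (f (n%:R + qpos k))%:E)))).
Proof.
move=> cf; rewrite limf_einfE; apply/eqP; rewrite eq_le; apply/andP; split.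
  apply: ge_ereal_sup => _ [W [M [_ MW]] <-]; apply: ereal_sup_ge.
  pose n := Num.bound `|M|.
  exists (ereal_inf (range (fun k => (f (n%:R + qpos k))%:E))); first by exists n.
  apply/ereal_infP => _ [k _ <-]; apply: ereal_inf_lbound.
  exists (n%:R + qpos k) => //; apply: MW.
  apply: (@lt_le_trans _ _ n%:R); last by rewrite lerDl.
  exact: (le_lt_trans (ler_norm _) (archi_boundP _)).
apply: ge_ereal_sup => _ [n _ <-]; apply: ereal_sup_ge.
exists (ereal_inf [set (f t)%:E | t in [set t | n%:R < t]]).
  by exists [set t | n%:R < t] => //; exists n%:R; split; rewrite ?num_real.
apply/ereal_infP => _ [t /= nt <-]; apply/lee_addgt0Pr => e e0.
have [dl dl0 H] := cf (t + 1) e e0.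
have tm : t - n%:R < Num.min (t - n%:R + 1) (t - n%:R + dl).
  by rewrite lt_min ltrDl ltr01 ltrDl.
have t0 : 0 <= t by rewrite (le_trans (ler0n _ n))// ltW.
have [k /andP[k1 k2]] := qpos_dense (ltW (eqbRL (subr_gt0 _ _) nt)) tm.
apply: (@le_trans _ _ (f (n%:R + qpos k))%:E).
  by apply: ereal_inf_lbound; exists k.
move: k2; rewrite lt_min => /andP[k2 k3].
have tq : t < n%:R + qpos k by rewrite -ltrBlDl.
have : `|f t - f (n%:R + qpos k)| < e.
  apply: H; first by rewrite t0/= lerDl ler01.
    by rewrite (le_trans t0 (ltW tq))/=; move: k2; rewrite addrAC ltrBrDl => /ltW.
  rewrite distrC ger0_norm ?subr_ge0 ?(ltW tq)// ltrBlDl.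
  by move: k3; rewrite addrAC ltrBrDl.
by rewrite ltr_norml -EFinD lee_fin => /andP[]; lra.
Qed.

Lemma measurable_stopped_value sigma : stopping_time F sigma ->
  measurable_fun setT (stopped_value Z sigma).
Proof.
move=> ss; have [s0 _] := ss.
pose h (n k : nat) w := (stopped_process Z sigma (n%:R + qpos k) w)%:E.
have -> : stopped_value Z sigma = fun w => esups (fun n => einfs (fun k => h n k w) 0) 0.
  apply/funext => w; rewrite stopped_value_limf_einf//.
  rewrite (limf_einf_countable (ucont_stopped (s0 w) (cZ w))).
  rewrite /esups /einfs /sdrop; congr ereal_sup.
  apply/seteqP; split => x [n _ <-]; exists n => //; congr ereal_inf;
    by apply/seteqP; split => y [k _ <-]; exists k.
apply: (measurable_fun_esups (f := fun n w => einfs (fun k => h n k w) 0)) => n.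
apply: (measurable_fun_einfs (f := fun k w => h n k w)) => k.
have q0 : 0 <= n%:R + qpos k by rewrite addr_ge0.
apply/measurable_EFinP; apply: (gmeas_measurable (filt_meas filtF q0)).
exact: stopped_gmeas.
Qed.

End StoppedValue.

(** * Optimality of the myopic time *)

Section MonotoneCase.
Context {d : measure_display} {T : measurableType d} {R : realType}.
Variables (P : probability T R) (F : R -> set (set T)).
Hypothesis filtF : filtration F.
Hypothesis rcF : right_continuous_filtration F.
Variables (V : T -> cumulative R R) (Z N D : R -> T -> R).
Hypothesis aZ : adapted F Z.
Hypothesis cZ : forall w, ucont (fun t => Z t w).
Hypothesis Z0 : forall (t : R) w, 0 <= t -> 0 <= Z t w.
Hypothesis Z_dec : doob_meyer P F V Z N D.
Hypothesis MN : martingale P F N.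
Hypothesis D_mono : forall w (s t : R), 0 <= s -> s <= t -> D s w <= 0 -> D t w <= 0.
Local Notation mean := (mean P).
Local Notation intg := (intg P).
Local Notation tau := (myopic_time D).

Let cN w : ucont (fun t => N t w).
Proof. by case: Z_dec => _ h _ _ _; exact: within_ucont. Qed.

(** No regularity of [D] in time is available. Its monotone sign replaces it: once nonpositive at
    [t], the density is nonpositive at every later rational. *)
Lemma myopic_stopping : stopping_time F tau.
Proof.
apply: (stopping_time_first_time filtF rcF (E := fun t => [set w | D t w <= 0])).
  move=> t t0; apply: gset_le; first exact: filtS.
  by case: Z_dec => _ _ h _ _ B mB; exact: h.
move=> w t u t0 tu /= Dt.
have [q] := rat_in_itvoo tu; rewrite in_itv/= => h.
exists q; move: (ratr q) h => r /andP[tr ru].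
split => //; first by rewrite (le_trans t0)// ltW.
by apply: (D_mono t0 _ Dt); exact: ltW.
Qed.

Let A t w := stieltjes_integral V D t w.

Let tau0 w : (0 <= tau w)%E. Proof. by case: myopic_stopping. Qed.

(** The density is nonnegative before [tau] and nonpositive after it, so on [[0, L]] the drift is
    largest at [min(tau, L)]. *)
Lemma drift_le_myopic (L a : R) w : 0 <= a -> a <= L -> A a w <= A (stop tau L w) w.
Proof.
move=> a0 aL; have L0 := le_trans a0 aL.
have [_ _ _ iD dec] := Z_dec.
have iDw t : 0 <= t -> (lebesgue_stieltjes_measure (V w)).-integrable
        `]0, t] (EFin \o (fun s => D s w)) by exact: iD.
have cA : ucont (fun t => A t w).
  apply: (@ucont_ext _ (fun t => Z t w - Z 0 w - N t w)) => [t t0|].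
    by rewrite dec// /A; ring.
  by apply: ucontB => //; apply: ucontB => //; exact: ucont_cst.
set c := stop tau L w.
have c0 : 0 <= c by exact: stop_ge0.
have cL : c <= L by exact: stop_le.
have Dpos s : 0 <= s -> (s%:E < tau w)%E -> 0 <= D s w.
  move=> s0 st; rewrite leNgt; apply/negP => Ds.
  suff : (tau w <= s%:E)%E by rewrite leNgt st.
  by apply: ereal_inf_lbound; exists s => //; split => //=; exact: ltW.
have Dneg s : 0 <= s -> (tau w < s%:E)%E -> D s w <= 0.
  move=> s0 /ereal_inf_ltP [_ [r [r0 /= Dr] <-]]; rewrite lte_fin => rs.
  by apply: D_mono Dr => //; exact: ltW.
have [ca|ac] := leP c a.
  have [cL'|cLt] := leP L c.
    by rewrite (_ : a = c)//; apply/eqP; rewrite eq_le ca (le_trans aL).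
  have tauc : tau w = c%:E.
    move: cLt (tau0 w); rewrite /c; case E : (tau w) => [r| |]//.
      by rewrite (stopE _ E) => h _; congr EFin; move: h; rewrite /Order.min; case: (ltP r L) => //; rewrite ltxx.
    by rewrite (stopy _ E) ltxx.
  rewrite -subr_le0 /A /stieltjes_integral.
  rewrite (@Rintegral_ocB _ (V w) (fun s => D s w) c a iDw c0 ca).
  have ica : (lebesgue_stieltjes_measure (V w)).-integrable `]c, a] (EFin \o (fun s => D s w)).
    exact: (integrable_itv_oc iDw c0 a0).
  apply: (@le_trans _ _ (\int[lebesgue_stieltjes_measure (V w)]_(s in `]c, a]) 0)).
    apply: le_Rintegral => //; first exact: integrable0.
    move=> s /=; rewrite in_itv/= => /andP[cs sa]; apply: Dneg; last by rewrite tauc lte_fin.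
    by rewrite (le_trans c0)// ltW.
  by rewrite Rintegral_cst// mul0r.
have incr b : a <= b -> (b%:E < tau w)%E -> A a w <= A b w.
  move=> ab bt; have b0 := le_trans a0 ab.
  rewrite -subr_ge0 /A /stieltjes_integral.
  rewrite (@Rintegral_ocB _ (V w) (fun s => D s w) a b iDw a0 ab).
  apply: Rintegral_ge0 => s /=; rewrite in_itv/= => /andP[as_ sb]; apply: Dpos.
    by rewrite (le_trans a0)// ltW.
  by apply: le_lt_trans bt; rewrite lee_fin.
(* At [tau] itself the density may have either sign and [dV] may have an atom. The comparison is
   made up to a time [b] strictly before [c], and continuity of the drift, inherited from [Z] and
   [N], closes the gap. *)
apply/ler_addgt0Pr => e e0.
have [dl dl0 H] := cA c e e0.
pose b := Num.max a (c - dl / 2).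
have bc : b < c by rewrite /b gt_max ac/= ltrBlDr ltrDl divr_gt0.
have ab : a <= b by rewrite /b le_max lexx.
have bt : (b%:E < tau w)%E.
  by apply: (@lt_le_trans _ _ c%:E); [rewrite lte_fin|exact: stop_le_tau].
have h1 := incr b ab bt.
have : `|A c w - A b w| < e.
  apply: H; rewrite ?c0 ?lexx ?(le_trans a0 ab) ?(ltW bc)//.
  have : c - dl / 2 <= b by rewrite /b le_max lexx orbT.
  by rewrite ger0_norm ?subr_ge0 ?(ltW bc)//; lra.
by rewrite ltr_norml => /andP[]; lra.
Qed.

Lemma mean_stopped_martingale sigma (n : nat) : stopping_time F sigma ->
  intg (stopped_process N sigma n%:R) /\ mean (stopped_process N sigma n%:R) = mean (N 0).
Proof.
move=> ss; have [s0 _] := ss.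
have MS := martingale_stopped filtF ss MN cN.
have iS : intg (stopped_process N sigma n%:R) by case: MS => _ h _; exact: h.
split => //.
have F0T : F 0 setT.
  by rewrite -setC0; apply: gsetC; [exact: filtS|exact: gset0 (filtS filtF (lexx 0))].
have := martingale_mean_indic filtF MS (lexx 0) (ler0n _ n) F0T.
under eq_mean do rewrite indicT mul1r.
rewrite meanB//; last by case: MS => _ h _; exact: h.
move/eqP; rewrite subr_eq0 => /eqP ->; apply: eq_mean => w.
by rewrite stopped_processE stop0.
Qed.

Lemma integral_stopped_le sigma (n : nat) : stopping_time F sigma ->
  (\int[P]_w (stopped_process Z sigma n%:R w)%:E <=
   \int[P]_w (stopped_process Z tau n%:R w)%:E)%E.
Proof.
move=> ss; have [s0 _] := ss.
have n0 : (0 : R) <= n%:R by exact: ler0n.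
have mS (rho : T -> \bar R) : stopping_time F rho ->
    measurable_fun setT (stopped_process Z rho n%:R).
  move=> sr; apply: (gmeas_measurable (filt_meas filtF n0)).
  exact: stopped_gmeas.
have ge0S (rho : T -> \bar R) w : stopping_time F rho -> 0 <= stopped_process Z rho n%:R w.
  by move=> [r0 _]; rewrite stopped_processE Z0// stop_ge0.
(* Integrability of the stopped [Z] is not assumed. If the right side is infinite there is nothing
   to prove; otherwise [le_path] dominates the nonnegative left integrand by an integrable
   function. *)
have [->|finZ] := eqVneq (\int[P]_w (stopped_process Z tau n%:R w)%:E)%E +oo%E.
  exact: leey.
have stau := myopic_stopping.
have iZ : intg (stopped_process Z tau n%:R).
  apply/integrableP; split; first by apply/measurable_EFinP; exact: mS.
  under eq_integral do rewrite /= ger0_norm ?ge0S//.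
  by rewrite ltey.
have [iNs Es] := mean_stopped_martingale n ss.
have [iNt Et] := mean_stopped_martingale n stau.
have le_path w : stopped_process Z sigma n%:R w <=
    stopped_process Z tau n%:R w + (stopped_process N sigma n%:R w - stopped_process N tau n%:R w).
  have [_ _ _ _ dec] := Z_dec.
  rewrite !stopped_processE (dec (stop sigma n%:R w))//; last exact: stop_ge0.
  rewrite (dec (stop tau n%:R w))//; last exact: stop_ge0.
  have := @drift_le_myopic n%:R (stop sigma n%:R w) w (stop_ge0 (s0 w) n0) (stop_le (s0 w) n%:R).
  rewrite /A; lra.
have iR : intg (fun w => stopped_process Z tau n%:R w +
    (stopped_process N sigma n%:R w - stopped_process N tau n%:R w)).
  by apply: intgD => //; exact: intgB.
have iZs : intg (stopped_process Z sigma n%:R).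
  apply: (intg_le (mS _ ss) _ iR) => w.
  by rewrite ger0_norm ?ge0S.
have : mean (stopped_process Z sigma n%:R) <= mean (stopped_process Z tau n%:R).
  apply: (le_trans (le_mean iZs iR le_path)).
  rewrite meanD//; last exact: intgB.
  by rewrite meanB// Es Et subrr addr0.
rewrite -lee_fin /mean /Rintegral !fineK//; exact: integrable_fin_num.
Qed.

Theorem monotone_case_optimal : condition_V1 P Z tau -> optimal P F Z tau.
Proof.
move=> [l [cl lle]]; have stau := myopic_stopping.
have adm : admissible P F Z tau.
  split => //; split; first exact: (measurable_stopped_value filtF aZ cZ stau).
  right; rewrite (eq_integral (cst 0%E)) ?integral0 ?ltry// => w _.
  by rewrite (ge0_funenegE (D := setT)) ?inE// => x _; exact: stopped_value_ge0.
split => //; apply/eqP; rewrite eq_le; apply/andP; split.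
  by apply: ereal_sup_ubound; exists tau.
apply: ge_ereal_sup => _ [sigma [ss [ms _]] <-]; have [s0 _] := ss.
apply: le_trans lle.
have mS (n : nat) (rho : T -> \bar R) : stopping_time F rho ->
    measurable_fun setT (fun w => (stopped_process Z rho n%:R w)%:E).
  move=> sr; apply/measurable_EFinP.
  apply: (gmeas_measurable (filt_meas filtF (ler0n _ n))).
  exact: stopped_gmeas.
have ge0S (n : nat) (rho : T -> \bar R) w : stopping_time F rho ->
    (0 <= (stopped_process Z rho n%:R w)%:E)%E.
  by move=> [r0 _]; rewrite lee_fin stopped_processE Z0// stop_ge0.
apply: (@le_trans _ _ (\int[P]_w limn_einf (fun n : nat => (stopped_process Z sigma n%:R w)%:E))%E).
  apply: ge0_le_integral => //.
  - by move=> w _; exact: stopped_value_ge0.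
  - rewrite /limn_einf; apply: measurableT_comp => //.
    apply: (measurable_fun_limn_esup (f := fun n w => - (stopped_process Z sigma n%:R w)%:E)%E) => n.
    by apply: measurableT_comp => //; exact: mS.
  - by move=> w _; exact: stopped_value_le_limn_einf.
apply: (le_trans (@fatou _ _ _ P setT measurableT
  (fun (n : nat) w => (stopped_process Z sigma n%:R w)%:E) _ _)).
- by move=> n; exact: mS.
- by move=> n w _; exact: ge0S.
(* The limit in (V1) runs over real horizons; Fatou's lemma needs it along the integers only. *)
have cn : (\int[P]_w (stopped_process Z tau n%:R w)%:E)%E @[n --> \oo] --> l.
  have -> : (fun n : nat => \int[P]_w (stopped_process Z tau n%:R w)%:E)%E =
     (fun L : R => \int[P]_w stopped_value Z (fun w => mine (tau w) L%:E) w)%E \o (fun n : nat => n%:R).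
    apply/funext => n /=; apply: eq_integral => w _.
    by rewrite stopped_value_min.
  by apply: cvg_comp cl; exact: cvgr_idn.
rewrite limn_einf_lim -(cvg_lim _ cn)//; apply: lee_lim.
- exact: is_cvg_einfs.
- by apply/cvg_ex; exists l.
near=> n; apply: (@le_trans _ _ (\int[P]_w (stopped_process Z sigma n%:R w)%:E)%E).
  by apply: ereal_inf_lbound; exists n => /=.
exact: integral_stopped_le.
Unshelve. all: by end_near. Qed.

End MonotoneCase.

Lemma first_time_ext (R : realType) (S S' : set R) :
  (forall t, 0 <= t -> S t <-> S' t) -> first_time S = first_time S'.
Proof.
move=> SS; congr ereal_inf; apply/seteqP; split => _ [t [t0 St] <-]; exists t => //;
  by split => //; apply/(SS t t0).
Qed.

(** In both formulas for the myopic time the ratios are taken at time [t] itself, because the sign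
    of the density at [t] decides; they agree since the product of exponentials is the exponential
    of the sum. In the last clause [NP] is a true martingale, so that stopping it at bounded times
    preserves its mean. *)
Theorem proposition3p5 (R : realType) (d : measure_display)
    (T : measurableType d) (P : probability T R) (F : R -> set (set T))
    (V : T -> cumulative R R) (m : nat) (X M N Y : 'I_m -> R -> T -> R)
    (F_filtration : filtration F)
    (F_right_continuous : right_continuous_filtration F)
    (V_adapted : adapted F (fun t w => V w t))
    (X_adapted : forall i, adapted F (X i))
    (X_continuous : forall i, continuous_paths (X i))
    (X_positive : forall i t w, 0 <= t -> 0 < X i t w)
    (X_independent : independent_processes P X)
    (X_additive : forall i, doob_meyer P F V (X i) (N i) (Y i))
    (M_local_martingale : forall i, local_martingale P F (M i))
    (X_multiplicative : forall i t w, 0 <= t ->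
       X i t w = M i t w *
         expR (stieltjes_integral V (fun s w => Y i s w / X i s w) t w))
    (YX_nonincreasing : forall i w s t, 0 <= s -> s <= t ->
       Y i t w / X i t w <= Y i s w / X i s w) :
  [/\ monotone_case P F V (product_process X) (product_density X Y),
      forall w, myopic_time (product_density X Y) w =
        first_time [set t | \prod_(i < m) expR (Y i t w / X i t w) <= 1],
      forall w, myopic_time (product_density X Y) w =
        first_time [set t | \sum_(i < m) Y i t w / X i t w <= 0] &
      forall NP : R -> T -> R,
        doob_meyer P F V (product_process X) NP (product_density X Y) ->
        martingale P F NP ->
        condition_V1 P (product_process X) (myopic_time (product_density X Y)) ->
        optimal P F (product_process X) (myopic_time (product_density X Y))].
Proof.
have Z_gt0 t w : 0 <= t -> 0 < product_process X t w.
  by move=> t0; apply: prodr_gt0 => i _; exact: X_positive.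
have density_le0 t w : 0 <= t ->
    (product_density X Y t w <= 0) = (\sum_(i < m) Y i t w / X i t w <= 0).
  move=> t0; rewrite (product_density_ratio Y X_positive)//.
  by rewrite pmulr_rle0// Z_gt0.
have density_mono w s t : 0 <= s -> s <= t ->
    product_density X Y s w <= 0 -> product_density X Y t w <= 0.
  move=> s0 st; rewrite !density_le0// ?(le_trans s0)//; apply: le_trans.
  by apply: ler_sum => i _; exact: YX_nonincreasing.
split.
- split.
    exact: (doob_meyer_product F_filtration F_right_continuous X_adapted X_continuous
      X_positive X_independent X_additive).
  move=> w t t0 /ereal_inf_ltP[_ [s [s0 /= Ds] <-]]; rewrite lte_fin => st.
  by apply: density_mono Ds => //; exact: ltW.
- move=> w; apply: first_time_ext => t t0 /=.
  by rewrite density_le0// -expR_sum expR_le1.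
- by move=> w; apply: first_time_ext => t t0 /=; rewrite density_le0.
move=> NP dNP mNP V1.
apply: (monotone_case_optimal F_filtration F_right_continuous _ _ _ dNP mNP density_mono V1).
- move=> t t0; apply: gmeas_prod; first exact: (filtS F_filtration).
  by move=> i _ B mB; exact: X_adapted.
- by move=> w; apply: ucont_prod => i; apply: within_ucont; exact: X_continuous.
- by move=> t w t0; exact/ltW/Z_gt0.
Qed.
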